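(* Let $G=(V,E)$ be a finite graph. (a) The counting function $\kappa(G;p,q)$ of positive integers $p,q$ (respectively $\bar\kappa(G;p,q)$ of nonnegative integers $p,q$) is a polynomial function having the same degree as the Tutte polynomial $T_G$, and is independent of the chosen set of distinct representatives of the cut-Eulerian equivalence classes. Denote these polynomials by $\kappa(G;x,y)$, $\bar\kappa(G;x,y)$. (b) (Decomposition) $\kappa(G;x,y)=\sum_{[\rho]\in[\mathcal O(G)]}\kappa_\rho(G;x,y)$ and $\bar\kappa(G;x,y)=\sum_{[\rho]\in[\mathcal O(G)]}\bar\kappa_\rho(G;x,y)$ (one representative $\rho$ per class). (c) (Reciprocity) $\kappa(G;-x,-y)=\sum_{[\rho]\in[\mathcal O(G)]}(-1)^{r(G)+|C_\rho|}\bar\kappa_\rho(G;x,y)$ and $\bar\kappa(G;-x,-y)=\sum_{[\rho]\in[\mathcal O(G)]}(-1)^{r(G)+|C_\rho|}\kappa_\rho(G;x,y)$. (d) (Specializations) $\kappa(G;x,1)=\tau(G,x)$, $\kappa(G;1,y)=\varphi(G,y)$, $\bar\kappa(G;x,-1)=\bar\tau(G,x)$, $\bar\kappa(G;-1,y)=\bar\varphi(G,y)$. (e) (Convolution) $\kappa(G;x,y)=\sum_{X\subseteq E}\tau(G/X,x)\,\varphi(G|X,y)$ and $\bar\kappa(G;x,y)=\sum_{X\subseteq E}\bar\tau(G/X,x)\,\bar\varphi(G|X,y)$.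
   Context: $G=(V,E)$ is a finite graph, loops and multiple edges allowed; $c(G)$ is its number of components, $r(G)=|V|-c(G)$, $n(G)=|E|-r(G)$. For $X\subseteq E$, $G|X=(V,X)$ and $G/X$ is $G$ with the edges of $X$ contracted. An orientation chooses for each edge one of its two directions (a loop also has two); $\mathcal O(G)$ is the set of orientations, $(G,\varepsilon)$ is $G$ with orientation $\varepsilon$, and $E(\rho\neq\sigma)$ is the set of edges where $\rho,\sigma$ differ. For an abelian group $A$, $g:E\to A$ is an $A$-flow of $(G,\varepsilon)$ if at each vertex the sum of $g$ over incoming edges equals that over outgoing edges (loops do not contribute); $f:E\to A$ is an $A$-tension if $f(e)=h(u)-h(v)$ for each edge $e$ directed from $u$ to $v$, for some $h:V\to A$. $\ker f=\{e: f(e)=0\}$, $\operatorname{supp} g=\{e:g(e)\neq0\}$. A directed circuit is a consistently oriented circuit; a bond is a minimal nonempty edge set $[S,V\setminus S]$, directed if all its edges point the same way across. $C_\rho$ is the set of edges lying in a directed circuit of $(G,\rho)$. $\rho$ is acyclic (totally cyclic) if $(G,\rho)$ has no directed circuit (no directed bond); sets $\mathcal O_{ac}(G)$, $\mathcal O_{tc}(G)$. A locally directed cut is an edge set $[S,V\setminus S]$ with an orientation making it a disjoint union of directed bonds; a directed Eulerian subgraph is an edge set with an orientation having equal in- and out-degree at each vertex. $\rho\sim_{ce}\sigma$ (cut-Eulerian equivalent) if $E(\rho\ne\sigma)$, oriented by $\rho$, is a disjoint union of a locally directed cut and a directed Eulerian subgraph (either possibly empty); this is an equivalence relation with classes $[\rho]$,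 set of classes $[\mathcal O(G)]$. For $\rho\in\mathcal O(G)$: $\kappa_\rho(G;p,q)$ is the number of pairs $(f,g)$, $f$ an integer tension and $g$ an integer flow of $(G,\rho)$, with $f(e)g(e)=0$, $f(e)+g(e)>0$, $0\le f(e)<p$, $0\le g(e)<q$ for all $e$; $\bar\kappa_\rho(G;p,q)$ is the number of such pairs with $0\le f(e)\le p$, $0\le g(e)\le q$ for all $e$ (no other condition); both agree with polynomials in $(p,q)$. $\kappa(G;p,q)$ is the number of pairs $(f,g)$ with $f$ an $A$-tension and $g$ a $B$-flow of $(G,\varepsilon)$ (any fixed orientation $\varepsilon$, abelian groups $|A|=p$, $|B|=q$) with $\ker f=\operatorname{supp} g$. $\bar\kappa(G;p,q)=\sum_{\rho}\bar\kappa_\rho(G;p,q)$, $\rho$ running over a set of distinct representatives of $[\mathcal O(G)]$. $\tau(G,q)$ ($\varphi(G,q)$) is the number of nowhere-zero $A$-tensions ($A$-flows) with $|A|=q$; $\bar\tau(G,q)$ ($\bar\varphi(G,q)$) is the number of pairs $(\rho,f)$ with $\rho$ in a set of distinct representatives of the cut-Eulerian classes contained in $\mathcal O_{ac}(G)$ ($\mathcal O_{tc}(G)$) and $f$ an integer tension (flow) of $(G,\rho)$ with $0\le f(e)\le q$ for all $e$; these are polynomials in $q$. $T_G(x,y)=R_G(x-1,y-1)$ where $R_G(x,y)=\sum_{X\subseteq E}x^{r(G)-r(G|X)}y^{n(G|X)}$. *)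

(* Defs.v *)
From HB Require Import structures.
From mathcomp Require Import all_boot all_order all_algebra.
From mathcomp Require Import boolp.
From mathcomp Require Import mpoly.
Set Implicit Arguments.
Unset Strict Implicit.
Unset Printing Implicit Defensive.
Import GRing.Theory.
Local Open Scope ring_scope.

(* The order of the two ends is only a reference direction: orientations
   are recorded relative to it. *)
Record mgraph := MGraph {
  vert : finType;
  edge : finType;
  src : edge -> vert;
  tgt : edge -> vert }.
Arguments src {G} e : rename.
Arguments tgt {G} e : rename.

Section Graph.
Variable G : mgraph.
Implicit Types (S : {set vert G}) (X B C D F : {set edge G}).

Definition adj : rel (vert G) := fun u v =>
  [exists e : edge G, ((src e == u) && (tgt e == v))
                   || ((src e == v) && (tgt e == u))].

Definition comp_of (v : vert G) : {set vert G} := [set w | connect adj v w].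

Definition comps : {set {set vert G}} :=
  [set comp_of v | v in [set: vert G]].

Definition rk : nat := #|vert G| - #|comps|.
Definition nullity : nat := #|edge G| - rk.

(* [true] keeps the reference direction of an edge, [false] reverses it;
   a loop therefore has two orientations as well. *)
Definition orient := {ffun edge G -> bool}.
Implicit Types rho sigma eps : orient.

Definition etail rho (e : edge G) : vert G := if rho e then src e else tgt e.
Definition ehead rho (e : edge G) : vert G := if rho e then tgt e else src e.

Definition cut S : {set edge G} :=
  [set e | (src e \in S) != (tgt e \in S)].

Definition is_cut B : bool := [exists S, cut S == B].

Definition bond B : bool := minset (fun D => (D != set0) && is_cut D) B.

Definition dbond rho B : bool :=
  bond B && [exists S, (cut S == B) && [forall e in B, etail rho e \in S]].

(* [c] lists the edges of C in cyclic order; the distinctness of their tails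
   says that no vertex is visited twice. *)
Definition dcircuit rho C : bool :=
  (C != set0) &&
  [exists c : #|C|.-tuple (edge G),
     [&& [set e in c] == C,
         cycle (fun e e' => ehead rho e == etail rho e') c
       & uniq [seq etail rho e | e <- c]]].

Definition Cset rho : {set edge G} := \bigcup_(C | dcircuit rho C) C.

Definition acyclic : {set orient} :=
  [set rho | [forall C, ~~ dcircuit rho C]].
Definition totally_cyclic : {set orient} :=
  [set rho | [forall B, ~~ dbond rho B]].

Definition loc_dcut rho D : bool :=
  is_cut D &&
  [exists P : {set {set edge G}},
     partition P D && [forall B in P, dbond rho B]].

Definition deulerian rho F : bool :=
  [forall v, #|[set e in F | ehead rho e == v]|
          == #|[set e in F | etail rho e == v]|].

Definition cut_eulerian : rel orient := fun rho sigma =>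
  [exists D : {set edge G}, exists F : {set edge G},
     [&& D :|: F == [set e | rho e != sigma e],
         [disjoint D & F], loc_dcut rho D & deulerian rho F]].

Definition ce_classes : {set {set orient}} :=
  equivalence_partition cut_eulerian [set: orient].
Definition ac_classes : {set {set orient}} :=
  [set K in ce_classes | K \subset acyclic].
Definition tc_classes : {set {set orient}} :=
  [set K in ce_classes | K \subset totally_cyclic].

Definition reps (K : {set {set orient}}) (R : {set orient}) : bool :=
  is_transversal R K (cover K).

(* A loop contributes the same term to both sides, hence nothing. *)
Definition is_flow (A : zmodType) rho (g : edge G -> A) : Prop :=
  forall v, \sum_(e | ehead rho e == v) g e = \sum_(e | etail rho e == v) g e.

Definition is_tension (A : zmodType) rho (f : edge G -> A) : Prop :=
  exists h : vert G -> A, forall e, f e = h (etail rho e) - h (ehead rho e).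

Definition zero_set (A : zmodType) (f : edge G -> A) : {set edge G} :=
  [set e | f e == 0].
Definition supp_set (A : zmodType) (g : edge G -> A) : {set edge G} :=
  [set e | g e != 0].

(* An integer function with values in [0, k) is given by its values in 'I_k. *)
Definition intf k (f : {ffun edge G -> 'I_k}) : edge G -> int :=
  fun e => (f e : nat)%:Z.

Definition kappa_count (A B : finZmodType) eps : nat :=
  #|[set fg : {ffun edge G -> A} * {ffun edge G -> B} |
      `[< [/\ is_tension eps fg.1, is_flow eps fg.2
            & zero_set fg.1 = supp_set fg.2] >]]|.

Definition kappa_or_count rho (p q : nat) : nat :=
  #|[set fg : {ffun edge G -> 'I_p} * {ffun edge G -> 'I_q} |
      `[< [/\ is_tension rho (intf fg.1), is_flow rho (intf fg.2)
            & forall e, intf fg.1 e * intf fg.2 e = 0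
                     /\ 0 < intf fg.1 e + intf fg.2 e] >]]|.

Definition kappab_or_count rho (p q : nat) : nat :=
  #|[set fg : {ffun edge G -> 'I_p.+1} * {ffun edge G -> 'I_q.+1} |
      `[< is_tension rho (intf fg.1) /\ is_flow rho (intf fg.2) >]]|.

Definition kappab_count (R : {set orient}) (p q : nat) : nat :=
  (\sum_(rho in R) kappab_or_count rho p q)%N.

Definition tau_count (A : finZmodType) eps : nat :=
  #|[set f : {ffun edge G -> A} |
      `[< is_tension eps f /\ forall e, f e != 0 >]]|.

Definition phi_count (A : finZmodType) eps : nat :=
  #|[set g : {ffun edge G -> A} |
      `[< is_flow eps g /\ forall e, g e != 0 >]]|.

Definition taub_count (R : {set orient}) (q : nat) : nat :=
  #|[set rf : orient * {ffun edge G -> 'I_q.+1} |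
      (rf.1 \in R) && `[< is_tension rf.1 (intf rf.2) >]]|.

Definition phib_count (R : {set orient}) (q : nat) : nat :=
  #|[set rf : orient * {ffun edge G -> 'I_q.+1} |
      (rf.1 \in R) && `[< is_flow rf.1 (intf rf.2) >]]|.

End Graph.

Section Minors.
Variables (G : mgraph) (X : {set edge G}).

Definition restriction : mgraph :=
  @MGraph (vert G) {e : edge G | e \in X}
    (fun e => src (val e)) (fun e => tgt (val e)).

(* The vertices of G/X are the components of G|X; an edge outside X with both
   ends in the same component becomes a loop. *)
Lemma comp_of_in (v : vert restriction) : comp_of v \in comps restriction.
Proof. by apply: imset_f; rewrite inE. Qed.

Definition contract_vert (v : vert restriction) :
  {K : {set vert restriction} | K \in comps restriction} :=
  exist _ (comp_of v) (comp_of_in v).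

Definition contraction : mgraph :=
  @MGraph {K : {set vert restriction} | K \in comps restriction}
    {e : edge G | e \notin X}
    (fun e => contract_vert (src (val e)))
    (fun e => contract_vert (tgt (val e))).

End Minors.

(* 'X_0 and 'X_1 play the roles of x and y. *)
Definition varx : {mpoly rat[2]} := 'X_ord0.
Definition vary : {mpoly rat[2]} := 'X_ord_max.

Definition ev (P : {mpoly rat[2]}) (x y : rat) : rat :=
  P.@[fun i : 'I_2 => if i == ord0 then x else y].

Definition rank_gen (G : mgraph) : {mpoly rat[2]} :=
  \sum_(X : {set edge G})
    varx ^+ (rk G - rk (restriction X)) * vary ^+ nullity (restriction X).

Definition tutte (G : mgraph) : {mpoly rat[2]} :=
  rank_gen G \mPo [tuple varx - 1; vary - 1].

(* Every positive integer is the order of some abelian group, so A and B of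
   orders p and q range over all pairs of positive integers. *)
Definition is_kappa (G : mgraph) (P : {mpoly rat[2]}) : Prop :=
  forall (p q : nat) (A B : finZmodType) (eps : orient G),
    #|A| = p -> #|B| = q -> ev P p%:R q%:R = (kappa_count A B eps)%:R.

Definition is_kappab (G : mgraph) (P : {mpoly rat[2]}) : Prop :=
  forall (R : {set orient G}) (p q : nat),
    reps (ce_classes G) R -> ev P p%:R q%:R = (kappab_count R p q)%:R.

Definition is_kappa_or (G : mgraph) (rho : orient G) (P : {mpoly rat[2]}) :=
  forall p q : nat, (0 < p)%N -> (0 < q)%N ->
    ev P p%:R q%:R = (kappa_or_count rho p q)%:R.

Definition is_kappab_or (G : mgraph) (rho : orient G) (P : {mpoly rat[2]}) :=
  forall p q : nat, ev P p%:R q%:R = (kappab_or_count rho p q)%:R.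

Definition is_tau (G : mgraph) (t : {poly rat}) : Prop :=
  forall (q : nat) (A : finZmodType) (eps : orient G),
    #|A| = q -> t.[q%:R] = (tau_count A eps)%:R.

Definition is_phi (G : mgraph) (t : {poly rat}) : Prop :=
  forall (q : nat) (A : finZmodType) (eps : orient G),
    #|A| = q -> t.[q%:R] = (phi_count A eps)%:R.

Definition is_taub (G : mgraph) (t : {poly rat}) : Prop :=
  forall (R : {set orient G}) (q : nat),
    reps (ac_classes G) R -> t.[q%:R] = (taub_count R q)%:R.

Definition is_phib (G : mgraph) (t : {poly rat}) : Prop :=
  forall (R : {set orient G}) (q : nat),
    reps (tc_classes G) R -> t.[q%:R] = (phib_count R q)%:R.

(* Main.v *)
(** Integer tensions and integer flows of a graph form orthogonal lattices [L]
    and [M] in Z^E in which every vector divided by a positive integer can be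
    rounded up or down coordinatewise.  Rounding makes the number of points of
    such a lattice in a dilated cube [0, p]^E a polynomial in [p]: the points
    with some coordinate equal to [p] lie on faces that reflect into cubes of
    lattices of smaller support.

    Two orientations are cut-Eulerian equivalent iff half the difference of
    their sign vectors lies in [L + M].  Each residue class of [L] mod [p] has
    a lift with coordinates in (-p, p); choosing one lift per class, and one
    per class of [M] mod [q], turns the triples (orientation in a transversal,
    tension, flow) in the closed boxes bijectively into triples (orientation,
    residue class, residue class) whose chosen lifts are nonnegative for the
    orientation.  Grouping these by [X = C_rho] splits the sum into an acyclic
    count off [X] and a totally cyclic count on [X], each evaluated by counting
    the regions of an arrangement by deletion-restriction.  The result is the
    sum over [X] of the products for [G/X] and [G|X]; restricting it to residue
    classes with complementary supports gives the open version.  Decomposition,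
    reciprocity, specialization and convolution follow by comparing explicit
    sums over edge sets; in particular the closed polynomial is [R_G]. *)

Require Import Defs.
From HB Require Import structures.
From mathcomp Require Import all_boot all_order all_algebra.
From mathcomp Require Import boolp.
From mathcomp Require Import mpoly.
From mathcomp Require Import zify ring lra.
Set Implicit Arguments.
Unset Strict Implicit.
Unset Printing Implicit Defensive.
Import Order.TTheory GRing.Theory Num.Theory.
Local Open Scope ring_scope.

(** * Lattices admitting coordinatewise rounding *)

(** A closed box of side p represents residue 0 twice, by 0 and by p, and a nonzero residue by
    different integers according to the sign prescribed at the edge. Passing between representatives
    subtracts p at an edge and flips it. Rounding makes the total correction a lattice vector with
    entries 0 or one unit along the orientation, and orthogonality gives the tension and flow
    corrections disjoint supports, so together they are exactly a cut-Eulerian flip.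

    After the transfer a tension condition and a flow condition still share the orientation. They
    decouple because, for [C s = X], the first involves only signs off [X] and the second only signs
    on [X]. Everything is counted over complete sign patterns on [E], at the price of the powers of
    two in the identities.

    The sums carry a weight depending on C_rho: the constant 1 gives the decomposition, the sign
    (-1)^(r(G)+|X|) the reciprocity, and the indicators of [X = set0] and [X = setT] the polynomials
    of acyclic and totally cyclic classes. This is why the transversal only has to meet the classes
    of nonzero weight. *)

Lemma sum_sign_subset (R : comNzRingType) (E : finType) (B : {set E}) :
  \sum_(Z : {set E} | Z \subset B) (-1) ^+ #|Z| = (B == set0)%:R :> R.
Proof.
have -> : (B == set0)%:R = \prod_(e : E) ((if e \in B then -1 else 0) + 1) :> R.
  have [->|/set0Pn[e eB]] := eqVneq B set0.
    by rewrite big1 // => e _; rewrite inE add0r.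
  by rewrite (bigD1 e) //= eB addNr mul0r.
rewrite bigA_distr big_mkcond /=; apply: eq_bigr => Z _.
rewrite -big_mkcond /=; case: ifPn => [/subsetP sZB|/subsetPn[e eZ eB]].
  by rewrite -prodr_const; apply: eq_bigr => e eZ; rewrite sZB.
by rewrite (bigD1 e) //= (negPf eB) mul0r.
Qed.

(** An [x] with [X] inside [bad x] contributes the alternating sum over the subsets of
    [bad x :\: X], which vanishes unless that difference is empty. *)
Lemma inclusion_exclusion (R : comNzRingType) (E T : finType) (A : {set T})
    (bad : T -> {set E}) (X : {set E}) :
  (#|[set x in A | bad x == X]|%:R : R) =
  \sum_(Y : {set E} | Y \subset ~: X)
    (-1) ^+ #|Y| * #|[set x in A | X :|: Y \subset bad x]|%:R.
Proof.
have cardE (P : pred T) : #|[set x in A | P x]|%:R = \sum_(x in A) (P x)%:R :> R.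
  rewrite -sum1_card natr_sum (eq_bigl (fun x => (x \in A) && P x)); last first.
    by move=> x; rewrite inE.
  by rewrite big_mkcondr /=; apply: eq_bigr => x _; case: (P x).
rewrite cardE; under [RHS]eq_bigr do rewrite cardE mulr_sumr.
rewrite exchange_big /=; apply: eq_bigr => x _.
have [sX|nsX] := boolP (X \subset bad x); last first.
  rewrite big1 => [|Y _]; last by rewrite subUset (negPf nsX) mulr0.
  by case: eqP => // eX; rewrite eX subxx in nsX.
have -> : (bad x == X) = (bad x :\: X == set0) by rewrite eqEsubset sX andbT setD_eq0.
rewrite -sum_sign_subset big_mkcond [RHS]big_mkcond /=; apply: eq_bigr => Y _.
rewrite subUset sX setDE subsetI.
by case: (Y \subset bad x); case: (Y \subset ~: X); rewrite /= ?mulr1 ?mulr0.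
Qed.

Section Roundable.
Variable E : finType.
Implicit Types (L : (E -> int) -> Prop) (f g a : E -> int) (X Y Z : {set E}).

(* The last clause says that [f / p] can be rounded, up or down at each
   coordinate, inside the lattice: this is the only form in which total
   unimodularity is used. *)
Definition roundable L : Prop :=
  [/\ L (fun=> 0), forall f g, L f -> L g -> L (fun e => f e - g e)
    & forall f (p : nat), (0 < p)%N -> L f ->
        exists a, L a /\ forall e, `|f e - p%:Z * a e| < p%:Z].

Definition vanishing L Y f : Prop := L f /\ forall e, e \in Y -> f e = 0.

Definition sgn (b : bool) : int := if b then 1 else -1.

Definition reorient (s : E -> bool) L f : Prop := L (fun e => sgn (s e) * f e).

Definition box L (p : nat) : nat :=
  #|[set f : {ffun E -> 'I_p.+1} | `[< L (fun e => (f e : nat)%:Z) >]]|.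

Definition face L (p : nat) Y Z : nat :=
  #|[set f : {ffun E -> 'I_p.+1} | `[< L (fun e => (f e : nat)%:Z) >]
      && [forall e in Y, f e == ord0] && [forall e in Z, f e == ord_max]]|.

Lemma roundable0 L : roundable L -> L (fun=> 0). Proof. by case. Qed.

Lemma roundableB L f g : roundable L -> L f -> L g -> L (fun e => f e - g e).
Proof. by case=> _ + _; apply. Qed.

Lemma roundableN L f : roundable L -> L f -> L (fun e => - f e).
Proof.
move=> rL Lf; have := roundableB rL (roundable0 rL) Lf.
by congr L; apply/funext => e; rewrite sub0r.
Qed.

Lemma roundableD L f g : roundable L -> L f -> L g -> L (fun e => f e + g e).
Proof.
move=> rL Lf Lg; have := roundableB rL Lf (roundableN rL Lg).
by congr L; apply/funext => e; rewrite opprK.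
Qed.

Lemma roundableZ L f (k : int) : roundable L -> L f -> L (fun e => k * f e).
Proof.
move=> rL Lf; have nat_case (n : nat) : L (fun e => n%:Z * f e).
  elim: n => [|n IHn].
    have := roundable0 rL.
    by congr L; apply/funext => e; rewrite mul0r.
  have := roundableD rL Lf IHn.
  by congr L; apply/funext => e; rewrite intS mulrDl mul1r.
case: k => n; first exact: nat_case.
have := roundableN rL (nat_case n.+1).
by congr L; apply/funext => e; rewrite NegzE mulNr.
Qed.

(** Saturation of the lattice: when f / p is already integral, the only rounding at distance less
    than 1 is f / p itself. *)
Lemma roundable_div L f g (p : nat) : (0 < p)%N -> roundable L -> L f ->
  (forall e, f e = p%:Z * g e) -> L g.
Proof.
move=> p0 rL Lf fE; case: (rL) => _ _ /(_ f p p0 Lf) [a [La aP]].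
suff -> : g = a by [].
apply/funext => e; have := aP e; rewrite fE; nia.
Qed.

Lemma sgnK b (x : int) : sgn b * (sgn b * x) = x.
Proof. by case: b => /=; rewrite ?mul1r // !mulN1r opprK. Qed.

Lemma sgn_norm b (x : int) : `|sgn b * x| = `|x|.
Proof. by case: b; rewrite /= ?mul1r // mulN1r normrN. Qed.

Lemma vanishing_roundable L Y : roundable L -> roundable (vanishing L Y).
Proof.
move=> rL; split.
- by split=> //; apply: roundable0.
- move=> f g [Lf fY] [Lg gY]; split; first exact: roundableB.
  by move=> e eY; rewrite fY // gY // subr0.
- move=> f p p0 [Lf fY]; case: (rL) => _ _ /(_ f p p0 Lf) [a [La aP]].
  exists a; split=> //; split=> // e eY; have := aP e; rewrite fY //; nia.
Qed.

Lemma reorient_roundable (s : E -> bool) L : roundable L -> roundable (reorient s L).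
Proof.
move=> rL; split.
- rewrite /reorient; under boolp.eq_fun do rewrite mulr0; exact: roundable0.
- move=> f g Lf Lg; have := roundableB rL Lf Lg.
  by congr L; apply/funext => e; rewrite mulrBr.
- move=> f p p0 Lf; case: (rL) => _ _ /(_ _ p p0 Lf) [a [La aP]].
  exists (fun e => sgn (s e) * a e); split.
    by have := La; congr L; apply/funext => e; rewrite sgnK.
  move=> e; rewrite -(sgn_norm (s e)) mulrBr mulrCA sgnK; exact: aP.
Qed.

Lemma vanishingU L X Y : vanishing (vanishing L X) Y = vanishing L (X :|: Y).
Proof.
apply/funext => f; apply/propext; split=> [[[Lf fX] fY]|[Lf fXY]].
  by split=> // e; rewrite inE => /orP[/fX|/fY].
by split; [split=> //|] => e eX; apply: fXY; rewrite inE eX ?orbT.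
Qed.

Lemma face_vanishing L p Y Z : face L p Y Z = face (vanishing L Y) p set0 Z.
Proof.
apply: eq_card => f; rewrite !inE; congr (_ && _).
have -> : [forall e in set0, f e == ord0] by apply/forall_inP => e; rewrite inE.
rewrite andbT; apply/andP/asboolP => [[/asboolP Lf /forall_inP fY]|[Lf fY]].
  by split=> // e /fY/eqP ->.
split; [exact/asboolP|apply/forall_inP => e /fY].
by move/eqP; rewrite eqz_nat => /eqP f0; apply/eqP/val_inj.
Qed.

Lemma face00 L p : face L p set0 set0 = box L p.
Proof.
apply: eq_card => f; rewrite !inE; case: `[< _ >] => //=.
by apply/andP; split; apply/forall_inP => e; rewrite inE.
Qed.

(* Reflecting the coordinates in the support of a 0/1 vector [a] of [L] that
   is 1 on [Z] turns the face [f = p] on [Z] into a face through 0. *)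
Lemma face_reflect L p Z (A : {set E}) : roundable L -> Z \subset A ->
  L (fun e => (e \in A)%:R) ->
  face L p set0 Z = box (vanishing (reorient (fun e => e \notin A) L) Z) p.
Proof.
move=> rL sZA LA; rewrite -face00 -face_vanishing /face.
pose phi (f : {ffun E -> 'I_p.+1}) := [ffun e => if e \in A then rev_ord (f e) else f e].
have phiK : involutive phi.
  by move=> f; apply/ffunP => e; rewrite !ffunE; case: (e \in A) => //; rewrite rev_ordK.
rewrite -(card_imset _ (inv_inj phiK)); apply: eq_card => f.
rewrite -{1}[f]phiK mem_imset; last exact: inv_inj.
rewrite !inE.
have -> : [forall e in set0, phi f e == ord0] by apply/forall_inP => e; rewrite inE.
have -> : [forall e in set0, f e == ord_max] by apply/forall_inP => e; rewrite inE.
rewrite !andbT; congr (_ && _); last first.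
  apply: eq_forallb_in => e eZ; rewrite ffunE (subsetP sZA) //.
  by case: (f e) => k lk; rewrite -!val_eqE /=; lia.
have key e : (phi f e : nat)%:Z =
    sgn (e \notin A) * (f e : nat)%:Z + p%:Z * (e \in A)%:R.
  by rewrite ffunE; case: (f e) => k lk; case: (e \in A) => /=; lia.
apply/asboolP/asboolP => [Lf|Lf].
  have := roundableB rL Lf (roundableZ p rL LA).
  by congr L; apply/funext => e; rewrite key addrK.
have := roundableD rL Lf (roundableZ p rL LA).
by congr L; apply/funext => e; rewrite key.
Qed.

(** Rounding f / p for a point [f] of the face gives a 0/1 vector of [L], equal to 1 wherever [f]
    takes the value p, in particular on [Z]. *)
Lemma face_empty L p Z : roundable L -> (0 < p)%N ->
  ~ (exists A : {set E}, Z \subset A /\ L (fun e => (e \in A)%:R)) ->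
  face L p set0 Z = 0%N.
Proof.
move=> rL p0 nA; apply/eqP; rewrite cards_eq0; apply/set0Pn => -[f].
rewrite !inE => /andP[/andP[/asboolP Lf _] /forall_inP fZ]; apply: nA.
case: (rL) => _ _ /(_ _ p p0 Lf) [a [La aP]].
have a01 e : a e = (a e == 1)%:R.
  by have := aP e; have := ltn_ord (f e); case: eqP => /=; nia.
exists [set e | a e == 1]; split.
  apply/subsetP => e eZ; rewrite inE; have := aP e.
  rewrite (eqP (fZ e eZ)) /=; nia.
by move: La; congr L; apply/funext => e; rewrite inE -a01.
Qed.

Definition lsupp L : {set E} := [set e | `[< exists2 f, L f & f e != 0 >]].

(** The cube of side p is the part of the cube of side p+1 with no coordinate at the top;
    inclusion-exclusion runs over the set of top coordinates. *)
Lemma box_difference L p : (box L p)%:R =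
  \sum_(Z : {set E}) (-1) ^+ #|Z| * (face L p.+1 set0 Z)%:R :> rat.
Proof.
pose A := [set f : {ffun E -> 'I_p.+2} | `[< L (fun e => (f e : nat)%:Z) >]].
pose top (f : {ffun E -> 'I_p.+2}) := [set e | f e == ord_max].
have -> : (box L p) = #|[set f in A | top f == set0]|.
  pose up (f : {ffun E -> 'I_p.+1}) : {ffun E -> 'I_p.+2} := [ffun e => widen_ord (leqnSn _) (f
    e)].
  have up_inj : injective up.
    by move=> f g /ffunP fg; apply/ffunP => e; have := fg e; rewrite !ffunE => -[/val_inj].
  rewrite /box -(card_imset _ up_inj); apply: eq_card => f; apply/imsetP/idP => [[g]|].
    rewrite !inE => Lg ->; apply/andP; split.
      move/asboolP: Lg => Lg; apply/asboolP; move: Lg.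
      by congr L; apply/funext => e; rewrite ffunE.
    apply/eqP/setP => e; rewrite !inE ffunE -val_eqE /=.
    by apply/negbTE; rewrite neq_ltn ltn_ord.
  rewrite !inE => /andP[/asboolP Lf /eqP/setP ftop].
  have lef e : (f e < p.+1)%N.
    have := ftop e; rewrite in_set0 inE -val_eqE /= => /negbT.
    by move=> ne; rewrite ltn_neqAle ne -ltnS ltn_ord.
  exists [ffun e => Ordinal (lef e)].
    rewrite inE; apply/asboolP; move: Lf; congr L.
    by apply/funext => e; rewrite ffunE.
  by apply/ffunP => e; rewrite !ffunE; apply/val_inj.
rewrite inclusion_exclusion; apply: eq_big => [Z|Z _].
  by rewrite setC0 subsetT.
congr (_ * _%:R); apply: eq_card => f; rewrite !inE set0U.
have -> : [forall e in set0, f e == ord0] by apply/forall_inP => e; rewrite inE.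
rewrite andbT; congr (_ && _); apply/subsetP/forall_inP => h e /h; rewrite ?inE //.
Qed.

(** Discrete antiderivative by induction on the degree: a multiple of a telescoping difference
    absorbs the top coefficient. *)
Lemma sum_polynomial (Q : {poly rat}) :
  exists P : {poly rat}, forall n : nat, P.[n%:R] = \sum_(k < n) Q.[k%:R].
Proof.
suff main (d : nat) : forall Q : {poly rat}, (size Q <= d)%N ->
    exists P : {poly rat}, forall n : nat, P.[n%:R] = \sum_(k < n) Q.[k%:R].
  exact: (main _ _ (leqnn _)).
elim: d => [|d IHd] {}Q szQ.
  move: szQ; rewrite leqn0 size_poly_eq0 => /eqP ->.
  by exists 0 => n; rewrite horner0 big1 // => k _; rewrite horner0.
(* ((x+1)^(d+1) - x^(d+1)) / (d+1) = x^d + lower terms *)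
pose D : {poly rat} := (('X + 1) ^+ d.+1 - 'X^(d.+1)).
have DE k : D.[k%:R] = k.+1%:R ^+ d.+1 - k%:R ^+ d.+1.
  by rewrite !hornerE -[k.+1]addn1 natrD.
have DX : D = \sum_(i < d.+1) 'X^i *+ 'C(d.+1, i).
  rewrite /D addrC -['X + 1]addrC exprDn big_ord_recr /= subnn expr0 mul1r binn mulr1n.
  by rewrite addrC addrK; apply: eq_bigr => i _; rewrite expr1n mul1r.
have [P PE] : exists P : {poly rat}, forall n : nat,
    P.[n%:R] = \sum_(k < n) (Q - (Q`_d / d.+1%:R) *: D).[k%:R].
  apply: IHd; apply/leq_sizeP => j; rewrite leq_eqVlt => /orP[/eqP <-|dj].
    rewrite coefB coefZ DX coef_sum big_ord_recr /= coefMn coefXn eqxx.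
    rewrite big1 ?add0r => [|i _]; last first.
      by rewrite coefMn coefXn gtn_eqF // mul0rn.
    by rewrite binSn mulfVK ?subrr // pnatr_eq0.
  rewrite coefB coefZ DX coef_sum big1 ?mulr0 ?subr0; last first.
    by move=> i _; rewrite coefMn coefXn gtn_eqF ?mul0rn // (leq_trans (ltn_ord i)).
  by move/leq_sizeP: szQ => ->.
exists (P + (Q`_d / d.+1%:R) *: 'X^(d.+1)) => n; rewrite hornerD PE !hornerE.
elim: n => [|n IHn]; first by rewrite !big_ord0 add0r expr0n mulr0.
rewrite !big_ord_recr /= -IHn hornerD hornerN hornerZ DE; ring.
Qed.

(** The threshold [m] is 0 for boxes and 1 for faces and open boxes: at p = 0 the two ends of the
    interval coincide, and a face without a 0/1 vector still contains the origin. *)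
Definition polynomial_from (m : nat) (N : nat -> nat) : Prop :=
  exists P : {poly rat}, forall n, (m <= n)%N -> P.[n%:R] = (N n)%:R.

(** Only the first difference in p is expanded into faces; it is polynomial by induction on the
    support, and summing it back recovers the box from its value at 0. *)
Lemma box_polynomial L : roundable L -> polynomial_from 0 (box L).
Proof.
have [n le_n] := ubnP #|lsupp L|; elim: n L le_n => // n IHn L le_n rL.
have faceP (Z : {set E}) : Z != set0 -> polynomial_from 1 (fun p => face L p set0 Z).
  move=> Z0; have [[A [sZA LA]]|nA] :=
    pselect (exists A : {set E}, Z \subset A /\ L (fun e => (e \in A)%:R)); last first.
    by exists 0 => p p0; rewrite face_empty // horner0.
  set L' := vanishing (reorient (fun e => e \notin A) L) Z.
  have [||P PE] := IHn L'.
  (* Vectors of [L'] vanish on [Z], whereas the indicator of [A] is a vector of [L] that is nonzero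
     there: the support shrinks strictly. *)
  - rewrite -ltnS; apply: leq_trans le_n; rewrite ltnS; apply: proper_card.
    apply/properP; split.
      apply/subsetP => e; rewrite !inE => /asboolP[f [Lf _] fe]; apply/asboolP.
      by exists (fun e => sgn (e \notin A) * f e) => //; move: fe; case: (e \notin A) => /=; lia.
    case/set0Pn: Z0 => e eZ; exists e; rewrite inE.
      by apply/asboolP; exists (fun e => (e \in A)%:R) => //; rewrite (subsetP sZA).
    by apply/asboolP => -[f [_ fZ]]; rewrite fZ.
  - by apply: vanishing_roundable; apply: reorient_roundable.
  by exists P => p p0; rewrite (face_reflect _ rL sZA LA) PE.
have /choice[P PE] (Z : {set E}) : exists P : {poly rat}, Z != set0 ->
    forall p, (1 <= p)%N -> P.[p%:R] = (face L p set0 Z)%:R.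
  by have [->|/faceP[P]] := eqVneq Z set0; [exists 0|exists P].
pose Q := - \sum_(Z : {set E} | Z != set0) (-1) ^+ #|Z| *: (P Z \Po ('X + 1)).
(* The term [Z = set0] of [box_difference] is the box of side p+1 itself; it moves to the left, and
   only faces with nonempty [Z] remain. *)
have boxS p : (box L p.+1)%:R - (box L p)%:R = Q.[p%:R].
  rewrite (box_difference L p) (bigD1 set0) //= cards0 expr0 mul1r face00.
  rewrite opprD addrA subrr add0r /Q hornerN horner_sum; congr (- _).
  apply: eq_bigr => Z Z0; rewrite hornerZ horner_comp -(PE Z Z0 p.+1) //.
  by rewrite !hornerE natr1.
have [P1 P1E] := sum_polynomial Q; exists (P1 + (box L 0)%:R%:P) => p _.
rewrite hornerD hornerC P1E; elim: p => [|p IHp]; first by rewrite big_ord0 add0r.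
by rewrite big_ord_recr /= -boxS addrAC IHp addrC subrK.
Qed.

Lemma face_polynomial L Y Z : roundable L -> polynomial_from 1 (fun p => face L p Y Z).
Proof.
move=> rL; have rLY := @vanishing_roundable L Y rL.
have [[A [sZA LA]]|nA] := pselect (exists A : {set E},
    Z \subset A /\ vanishing L Y (fun e => (e \in A)%:R)); last first.
  by exists 0 => p p0; rewrite face_vanishing face_empty // horner0.
have [|P PE] := @box_polynomial (vanishing (reorient (fun e => e \notin A) (vanishing L Y)) Z).
  by apply: vanishing_roundable; apply: reorient_roundable.
by exists P => p p0; rewrite face_vanishing (face_reflect _ rLY sZA LA) PE.
Qed.

Definition open_box L (p : nat) X : nat :=
  #|[set f : {ffun E -> 'I_p} | `[< L (fun e => (f e : nat)%:Z) >]
      && ([set e | (f e : nat) == 0%N] == X)]|.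

(** Two inclusion-exclusions: [Y] excludes zeros outside [X], [Z] excludes the upper end. Since
    [box_difference] writes the cube with values 0..p through faces at p+1, the polynomial comes out
    in the open bound p+1. *)
Lemma open_box_polynomial L X : roundable L -> polynomial_from 1 (fun p => open_box L p X).
Proof.
move=> rL.
have /choice[P PE] (YZ : {set E} * {set E}) : exists P : {poly rat},
    forall p, (1 <= p)%N -> P.[p%:R] = (face L p YZ.1 YZ.2)%:R.
  exact: face_polynomial.
exists (\sum_(Y : {set E} | Y \subset ~: X) (-1) ^+ #|Y| *:
   \sum_(Z : {set E}) (-1) ^+ #|Z| *: P (X :|: Y, Z)) => -[//|p] _.
rewrite horner_sum.
pose A := [set f : {ffun E -> 'I_p.+1} | `[< L (fun e => (f e : nat)%:Z) >]].
have -> : open_box L p.+1 X = #|[set f in A | [set e | (f e : nat) == 0%N] == X]|.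
  by apply: eq_card => f; rewrite !inE.
rewrite inclusion_exclusion; apply: eq_bigr => Y _; rewrite hornerZ; congr (_ * _).
have -> : #|[set f in A | X :|: Y \subset [set e | (f e : nat) == 0%N]]|
    = box (vanishing L (X :|: Y)) p.
  rewrite -face00 -face_vanishing; apply: eq_card => f; rewrite !inE.
  have -> : [forall e in set0, f e == ord_max] by apply/forall_inP => e; rewrite inE.
  by rewrite andbT; congr (_ && _); apply/subsetP/forall_inP => h e /h; rewrite inE.
rewrite box_difference horner_sum; apply: eq_bigr => Z _.
by rewrite hornerZ PE // face_vanishing.
Qed.

End Roundable.

(** * Sign patterns realized by a lattice *)

Lemma norm_bound (E : finType) (f : E -> int) :
  exists K : int, 0 <= K /\ forall e, `|f e| <= K.
Proof.
exists (\sum_e `|f e|); split; first exact: sumr_ge0.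
by move=> e; rewrite (bigD1 e) //= lerDl sumr_ge0.
Qed.

Lemma sum_subsetU1 (R : nmodType) (E : finType) (e : E) (F : {set E})
    (g : {set E} -> R) : e \notin F ->
  \sum_(Y : {set E} | Y \subset e |: F) g Y =
  \sum_(Y : {set E} | Y \subset F) (g Y + g (e |: Y)).
Proof.
move=> eF; rewrite big_split /= (bigID (fun Y : {set E} => e \notin Y)) /=; congr (_ + _).
  apply: eq_bigl => Y; apply/andP/idP => [[/subsetP sY eY]|sY].
    by apply/subsetP => x xY; have := sY x xY; rewrite !inE => /orP[/eqP xe|//];
      rewrite -xe xY in eY.
  split; first exact: subset_trans sY (subsetUr _ _).
  by apply: contra eF => /(subsetP sY).
rewrite (reindex_onto (fun Y => e |: Y) (fun Y => Y :\ e)) /=; last first.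
  by move=> Y /andP[_ /negPn eY]; rewrite setD1K.
apply: eq_bigl => Y; rewrite setU11 andbT; apply/andP/idP => [[sY /eqP eY]|sY].
  have eNY : e \notin Y by rewrite -eY setD11.
  by apply/subsetP => x xY; have := subsetP sY x;
    rewrite !inE xY orbT => /(_ isT) /orP[/eqP xe|//]; rewrite -xe xY in eNY.
have eNY : e \notin Y by apply: contra eF => /(subsetP sY).
by rewrite setUS // setU1K.
Qed.

Section SignPatterns.
Variable E : finType.
Implicit Types (s t : {ffun E -> bool}).

(** Independence of functions of complementary coordinates. In the double sum of [P s * Q t],
    exchanging the parts of [s] and [t] off [D] makes both factors depend on [s] alone, and [t]
    becomes free. *)
Lemma sum_mix (R : comNzRingType) (D : {set E}) (P Q : {ffun E -> bool} -> R) :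
  (forall s t, {in D, s =1 t} -> P s = P t) ->
  (forall s t, {in ~: D, s =1 t} -> Q s = Q t) ->
  2 ^+ #|E| * (\sum_s P s * Q s) = (\sum_s P s) * (\sum_s Q s).
Proof.
move=> PD QD; pose mix s t : {ffun E -> bool} := [ffun e => if e \in D then s e else t e].
pose swap st := (mix st.1 st.2, mix st.2 st.1).
have swapK : involutive swap.
  by move=> [s t]; congr pair; apply/ffunP => e; rewrite !ffunE /=; case: (e \in D).
rewrite mulr_suml; under [RHS]eq_bigr do rewrite mulr_sumr.
rewrite pair_bigA /= (reindex_inj (inv_inj swapK)) /=.
under [RHS]eq_bigr => st _.
  rewrite (PD _ st.1); last by move=> e eD; rewrite ffunE eD.
  rewrite (QD _ st.1); last by move=> e; rewrite inE ffunE => /negPf ->.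
  over.
rewrite -(pair_bigA _ (fun s t => P s * Q s)) /= exchange_big /= big_const.
by rewrite card_ffun card_bool iter_addr_0 -[RHS]mulr_natl natrX.
Qed.

Lemma card_prescribed (D : {set E}) (b : E -> bool) :
  #|[set s : {ffun E -> bool} | [forall e in D, s e == b e]]| = (2 ^ #|~: D|)%N.
Proof.
transitivity (\prod_(e : E) \sum_(v : bool) ((e \in D) ==> (v == b e)))%N.
  rewrite bigA_distr_bigA /= -sum1_card big_mkcond /=; apply: eq_bigr => s _.
  rewrite inE; case: ifPn => [/forall_inP sb|/forall_inPn[e eD se]].
    by rewrite big1 // => e _; case: (boolP (e \in D)) => //= /sb ->.
  by rewrite (bigD1 e) //= eD (negPf se).
rewrite (bigID (mem D)) /= big1 => [|e eD]; last first.
  by rewrite big_bool /= eD /=; case: (b e).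
rewrite mul1n (eq_bigr (fun=> 2%N)) => [|e /negPf eD]; last by rewrite big_bool /= eD.
by rewrite (eq_bigl (mem (~: D))) ?prod_nat_const // => e; rewrite !inE.
Qed.

End SignPatterns.

Lemma sgn_align b (x : int) : x != 0 -> 0 < sgn b * (sgn ((0 < x) == b) * x).
Proof. by case: b; case: (ltP 0 x) => /=; lia. Qed.

Lemma sgn_gt0_norm b (x : int) : 0 < sgn b * x -> 0 < `|x|.
Proof. by case: b => /=; lia. Qed.

Lemma sgn_eq0 b (x : int) : sgn b * x = 0 -> x = 0.
Proof. by case: b => /=; lia. Qed.

Lemma sgn_lt0 b (x : int) : sgn b * x < 0 -> 0 < sgn (~~ b) * x.
Proof. by case: b => /=; lia. Qed.

Lemma sgn_opposite b (x y : int) : 0 < sgn b * x -> 0 < sgn (~~ b) * y ->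
  `|y| * x + `|x| * y = 0.
Proof. by case: b => /=; rewrite ?mul1r ?mulN1r => x0 y0; nia. Qed.

(** Integral form of a small perturbation: instead of shrinking the perturbation, the main vector is
    scaled by K+1. *)
Lemma sgn_dominate (K u v : int) : 0 < u -> 0 <= K -> `|v| <= K -> 0 < (K + 1) * u + v.
Proof. nia. Qed.

Section Regions.
Variable E : finType.
Implicit Types (L : (E -> int) -> Prop) (f : E -> int) (X Y F : {set E}).
Implicit Types (s t : {ffun E -> bool}).

Definition positive_on L F s : bool :=
  `[< exists f, L f /\ forall e, e \in F -> 0 < sgn (s e) * f e >].

(** The pattern off [F] is unconstrained, so every region of the arrangement given by the
    coordinates in [F] is counted 2^(|E|-|F|) times; this explains the factor 2 in the recurrence
    and the powers of two later. *)
Definition nregions L F : nat := #|[set s | positive_on L F s]|.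

Definition toggle (e : E) s : {ffun E -> bool} := [ffun x => (x == e) (+) s x].

Lemma toggleK e : involutive (toggle e).
Proof. by move=> s; apply/ffunP => x; rewrite !ffunE addbA addbb. Qed.

(* Deletion-restriction: the hyperplane [f e = 0] cuts exactly those regions
   that meet it. *)
Lemma nregions_rec L F e : roundable L -> e \notin F -> (exists2 f, L f & f e != 0) ->
  (2 * nregions L (e |: F) = nregions L F + nregions (vanishing L [set e]) F)%N.
Proof.
move=> rL eF [h Lh he].
have nE L' F' : nregions L' F' = (\sum_s positive_on L' F' s)%N.
  by rewrite /nregions -sum1_card big_mkcond /=; apply: eq_bigr => s _; rewrite inE;
    case: positive_on.
(* Pairing each pattern with the one toggled at [e] reduces the claim to the pointwise identity N +
   N' = P + Q. *)
rewrite mul2n -addnn {2}[nregions L (e |: F)]nE (reindex_inj (inv_inj (toggleK e))) /=.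
rewrite !nE -!big_split /=; apply: eq_bigr => s _.
have tF x : x \in F -> toggle e s x = s x.
  by move=> xF; rewrite ffunE; case: eqP => // xe; rewrite -xe xF in eF.
have te : toggle e s e = ~~ s e by rewrite ffunE eqxx addTb.
pose P := positive_on L F s; pose Q := positive_on (vanishing L [set e]) F s.
pose N := positive_on L (e |: F) s; pose N' := positive_on L (e |: F) (toggle e s).
rewrite -/P -/Q -/N -/N'.
(* A vector on the hyperplane, scaled by K+1, is pushed to either side by adding plus or minus [h],
   without changing its signs on [F]. *)
have QNN : Q -> N /\ N'.
  case/asboolP => f [[Lf fe] fF]; have {}fe : f e = 0 by apply: fe; rewrite inE.
  have [K [K0 hK]] := norm_bound h.
  have main (b : bool) : exists g, L g /\ (0 < sgn b * g e) /\
      forall x, x \in F -> 0 < sgn (s x) * g x.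
    pose c := sgn ((0 < h e) == b).
    exists (fun x => (K + 1) * f x + c * h x); split.
      by apply: roundableD => //; apply: roundableZ.
    split; first by rewrite fe mulr0 add0r sgn_align.
    move=> x /fF fx; rewrite mulrDr mulrCA; apply: sgn_dominate => //.
    by rewrite sgn_norm sgn_norm.
  split; apply/asboolP.
    have [g [Lg [ge gF]]] := main (s e); exists g; split=> // x.
    by rewrite !inE => /orP[/eqP ->|/gF].
  have [g [Lg [ge gF]]] := main (~~ s e); exists g; split=> // x.
  by rewrite !inE => /orP[/eqP ->|xF]; [rewrite te|rewrite tF // gF].
(* Two vectors on opposite sides of the hyperplane, weighted by [|g e|] and [|f e|], cancel at [e]
   and keep their common signs on [F]. *)
have NNQ : N -> N' -> Q.
  case/asboolP=> f [Lf fF] /asboolP[g [Lg gF]]; apply/asboolP.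
  have fe := fF e (setU11 _ _); have ge := gF e (setU11 _ _).
  exists (fun x => `|g e| * f x + `|f e| * g x); split.
    split; first by apply: roundableD => //; apply: roundableZ.
    move=> x; rewrite inE => /eqP ->; apply: (sgn_opposite fe).
    by rewrite -te.
  move=> x xF; have fx := fF x (setU1r _ xF); have := gF x (setU1r _ xF).
  rewrite tF // => gx; rewrite mulrDr ![sgn (s x) * (_ * _)]mulrCA.
  have ge' := sgn_gt0_norm ge; have fe' := sgn_gt0_norm fe.
  by rewrite addr_gt0 // mulr_gt0.
have NP : N -> P.
  by case/asboolP => f [Lf fF]; apply/asboolP; exists f; split=> // x xF; apply/fF/setU1r.
have N'P : N' -> P.
  case/asboolP => f [Lf fF]; apply/asboolP; exists f; split=> // x xF.
  by rewrite -(tF x xF); apply/fF/setU1r.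
have PNQ : P -> N || N' || Q.
  case/asboolP => f [Lf fF]; case: (ltgtP (sgn (s e) * f e) 0) => fe.
  - apply/orP; left; apply/orP; right; apply/asboolP; exists f; split=> // x.
    rewrite !inE => /orP[/eqP ->|xF]; last by rewrite tF // fF.
    by rewrite te; apply: sgn_lt0.
  - apply/orP; left; apply/orP; left; apply/asboolP; exists f; split=> // x.
    by rewrite !inE => /orP[/eqP ->|/fF].
  - apply/orP; right; apply/asboolP; exists f; split=> //; split=> // x.
    by rewrite inE => /eqP ->; apply: sgn_eq0 fe.
move: QNN NNQ NP N'P PNQ; clearbody P Q N N'.
case: P; case: Q; case: N; case: N' => // H1 H2 H3 H4 H5;
  by [have := H1 isT; case|have := H2 isT isT|have := H3 isT|have := H4 isT|have := H5 isT].
Qed.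

Variables (L : (E -> int) -> Prop) (d : {set E} -> nat).
Hypothesis rL : roundable L.

Definition residues (p : nat) : {set {ffun E -> 'I_p.+1}} :=
  [set r : {ffun E -> 'I_p.+1} |
     `[< exists f, L f /\ forall e, (p.+1%:Z %| f e - (r e : nat)%:Z)%Z >]].

Definition zeros p (r : {ffun E -> 'I_p.+1}) : {set E} := [set e | r e == ord0].

(** Subtracting from any lift p+1 times its rounding leaves coordinates smaller than p+1 in absolute
    value. The zero function is only a default outside [residues]. *)
Lemma canonical_lift p : exists c : {ffun E -> 'I_p.+1} -> E -> int,
  forall r, r \in residues p ->
    [/\ L (c r), forall e, (p.+1%:Z %| c r e - (r e : nat)%:Z)%Z
      & forall e, `|c r e| < p.+1%:Z].
Proof.
pose P (r : {ffun E -> 'I_p.+1}) (c : E -> int) := r \in residues p ->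
    [/\ L c, forall e, (p.+1%:Z %| c e - (r e : nat)%:Z)%Z & forall e, `|c e| < p.+1%:Z].
suff /choice[c cP] : forall r, exists c, P r c by exists c.
move=> r; case: (boolP (r \in residues p)) => [|nr]; last by exists (fun=> 0) => rr;
  rewrite rr in nr.
rewrite inE => /asboolP[f [Lf fr]].
case: (rL) => _ _ /(_ f p.+1 isT Lf) [a [La aP]].
exists (fun e => f e - p.+1%:Z * a e) => _; split=> //.
  by apply: roundableB => //; apply: roundableZ.
by move=> e; rewrite addrAC rpredB // dvdz_mulr.
Qed.

(** The only candidates for [x] are i and i - (p+1), and the bound excludes the second one when i =
    0. *)
Lemma lift_eq0 p (x : int) (i : 'I_p.+1) : (p.+1%:Z %| x - (i : nat)%:Z)%Z ->
  `|x| < p.+1%:Z -> (x == 0) = (i == ord0).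
Proof.
move=> /dvdzP dv xp; have [k xk] : exists k : int, x - (i : nat)%:Z = k * p.+1%:Z by [].
rewrite -val_eqE /=; move: (ltn_ord i) xk; case: i {dv} => i /= _ lei xk.
have [k0|[k0|k0]] : k = 0 \/ (1 <= k \/ k <= -1) by lia.
- by rewrite k0 mul0r in xk; apply/eqP/eqP; lia.
- by have kp : p.+1%:Z <= k * p.+1%:Z; [nia|exfalso; lia].
- have kp : k * p.+1%:Z <= - p.+1%:Z by nia.
  have x0 : x < 0 by lia.
  have i0 : (0 < i)%N by clear x0; lia.
  by rewrite lt_eqF // gtn_eqF.
Qed.

Hypothesis card_residues : forall p X,
  #|[set r in residues p | X \subset zeros r]| = (p.+1 ^ d X)%N.

(** The dimension is read off modulo 2: canonical lifts have the same zero sets as their residues,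
    so a residue vector vanishing on [X] also vanishes at [e]. *)
Lemma dim_zero X e : (forall f, vanishing L X f -> f e = 0) -> d (e |: X) = d X.
Proof.
move=> Xe; apply: (@expnI 2) => //; rewrite -!card_residues.
apply: eq_card => r; rewrite !inE subUset; case: (boolP `[< _ >]) => //= rr.
case: (boolP (X \subset zeros r)) => [sX|]; rewrite ?andbF // andbT sub1set inE.
have [c cP] := canonical_lift 1;
  have [Lc cr cp] : [/\ L (c r), _ & _] := cP r (etrans (in_set _ _) rr).
rewrite -(lift_eq0 (cr e) (cp e)); apply/eqP/Xe; split=> // x xX.
by apply/eqP; rewrite (lift_eq0 (cr x) (cp x)); have := subsetP sX x xX; rewrite inE.
Qed.

(** Rounding [f / |f e|] gives a lattice vector [a], zero on [X], with [a e] equal to 1 or -1.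
    Translation by [a] modulo 2 is an involution of the residue vectors vanishing on [X] that
    exchanges the values 0 and 1 at [e], so exactly half of them vanish there. *)
Lemma dim_nonzero X e f : vanishing L X f -> f e != 0 -> d X = (d (e |: X)).+1.
Proof.
move=> Lf fe; have [_ _ /(_ f `|f e|%N)] := @vanishing_roundable E L X rL.
case=> [||a [[La aX] aP]]; rewrite ?absz_gt0 //.
have ae : odd `|a e|.
  suff [->|->] : a e = 1 \/ a e = -1 by [].
  have := aP e; move: fe; case: (f e) => n fn /= an.
    by left; suff : ~ (2 <= a e) /\ ~ (a e <= 0); [lia|split=> ?; nia].
  by right; suff : ~ (0 <= a e) /\ ~ (a e <= -2); [lia|split=> ?; nia].
pose y x : 'I_2 := inZp `|a x|; pose tog (r : {ffun E -> 'I_2}) := [ffun x => r x + y x].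
have y2 x : y x + y x = 0 :> 'I_2 by apply/val_inj => /=; rewrite modnDm addnn;
  rewrite modn2 odd_double.
have togK : involutive tog by move=> r; apply/ffunP => x; rewrite !ffunE -addrA y2 addr0.
pose A := [set r in residues 1 | X \subset zeros r].
have togA r : (tog r \in A) = (r \in A).
  suff sub r' : r' \in A -> tog r' \in A.
    by apply/idP/idP => /sub; rewrite ?togK.
  rewrite !inE => /andP[/asboolP[g [Lg gr]] sX]; apply/andP; split.
    apply/asboolP; exists (fun x => g x + a x); split; first exact: roundableD.
    move=> x; rewrite ffunE /= modnDmr; have := gr x.
    case: (r' x) => i /= _; case: (a x) => n; rewrite /=; lia.
  apply/subsetP => x xX; have := subsetP sX x xX; rewrite !inE ffunE => /eqP ->.
  by rewrite /y aX // add0r; apply/eqP/val_inj.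
have eA : [set r in residues 1 | e |: X \subset zeros r] = [set r in A | r e == ord0].
  by apply/setP => r; rewrite !inE subUset sub1set inE; case: (`[< _ >]) => //=; rewrite andbC.
apply: (@expnI 2) => //; rewrite expnS -!card_residues eA -/A mul2n -addnn.
have cN : #|[set r in A | r e != ord0]| = #|[set r in A | r e == ord0]|.
  set S0 := [set r in A | r e == ord0]; set S1 := [set r in A | r e != ord0].
  suff <- : [set tog r | r in S0] = S1 by rewrite card_imset //; exact: inv_inj.
  apply/setP => r; rewrite -{1}[r]togK mem_imset; last exact: inv_inj.
  rewrite in_set [RHS]in_set togA.
  congr (_ && _); rewrite ffunE.
  have -> : y e = 1 by apply/val_inj; rewrite /= modn2 ae.
  by case: (r e) => [[|[|]]].
rewrite -{1}cN -cardsUI.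
have -> : [set r in A | r e != ord0] :&: [set r in A | r e == ord0] = set0.
  by apply/setP => r; rewrite !inE; case: eqP; rewrite !andbF.
rewrite cards0 addn0; apply: eq_card => r; rewrite !in_setU !in_set.
by case: eqP; rewrite ?andbT ?andbF ?orbF.
Qed.

(** Zaslavsky's count: Whitney's expansion of the characteristic polynomial at -1, the rank of [Y]
    being [d X - d (X :|: Y)]; only its parity matters, hence the sum in the exponent. *)
Lemma nregions_vanishing X F :
  (2 ^+ #|F| * (nregions (vanishing L X) F)%:R =
  2 ^+ #|E| * \sum_(Y : {set E} | Y \subset F) (-1) ^+ (#|Y| + (d X + d (X :|: Y))) :> int).
Proof.
have [n le_n] := ubnP #|F|; elim: n X F le_n => // n IHn X F le_n.
have [->|/set0Pn[e eF]] := eqVneq F set0.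
  rewrite cards0 expr0 mul1r (big_pred1 set0) => [|Y]; last by rewrite subset0.
  rewrite cards0 setU0 addnn -signr_odd odd_double mulr1 /nregions.
  rewrite (@eq_card _ _ predT) ?card_ffun ?card_bool ?natrX // => s; rewrite !inE.
  apply/asboolP; exists (fun=> 0); split=> [|e]; last by rewrite inE.
  exact: (roundable0 (vanishing_roundable X rL)).
set F' := F :\ e; have eF' : e \notin F' by rewrite setD11.
have cF : #|F| = #|F'|.+1 by rewrite (cardsD1 e) eF.
have lt_n : (#|F'| < n)%N by rewrite -ltnS -cF.
rewrite -(setD1K eF) -/F' sum_subsetU1 // setD1K // cF.
have [[f Lf fe]|nf] := pselect (exists2 f, vanishing L X f & f e != 0).
  have rLX := @vanishing_roundable E L X rL.
  have := nregions_rec rLX eF' (ex_intro2 _ _ f Lf fe); rewrite setD1K // vanishingU => rec.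
  rewrite exprSr -mulrA -natrM rec natrD mulrDr !IHn // -mulrDr -big_split /=.
  congr (_ * _); apply: eq_bigr => Y sY; congr (_ + _).
  have eY : e \notin Y by apply: contra eF' => /(subsetP sY).
  rewrite cardsU1 eY add1n (dim_nonzero Lf fe) [X :|: [set e]]setUC -[_ :|: X :|: Y]setUA.
  by rewrite [X :|: (_ :|: _)]setUCA !addSn addnS !exprS !mulN1r opprK.
(* If every vector vanishes at [e] there is no region, and on the right [Y] and [e |: Y] have the
   same dimension and opposite signs. *)
rewrite (_ : nregions _ _ = 0%N); last first.
  apply/eqP; rewrite cards_eq0; apply/set0Pn => -[s]; rewrite inE => /asboolP[f [Lf fF]].
  apply: nf; exists f => //; apply/eqP => fe0.
  by have := fF e eF; rewrite fe0 mulr0 ltxx.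
rewrite mulr0 big1 ?mulr0 // => Y sY.
have eY : e \notin Y by apply: contra eF' => /(subsetP sY).
rewrite cardsU1 eY add1n setUCA dim_zero ?addSn ?exprS ?mulN1r ?subrr // => f Lf.
apply/eqP/negPn/negP => fe; apply: nf; exists f => //.
by case: Lf => Lf fXY; split=> // x xX; apply: fXY; rewrite inE xX.
Qed.

Definition strictly_positive F s : bool :=
  `[< exists f, L f /\ forall e, (e \in F -> 0 < sgn (s e) * f e) /\ (e \notin F -> f e = 0) >].

Variables (p : nat) (c : {ffun E -> 'I_p.+1} -> E -> int).
Hypothesis cP : forall r, r \in residues p ->
  [/\ L (c r), forall e, (p.+1%:Z %| c r e - (r e : nat)%:Z)%Z
    & forall e, `|c r e| < p.+1%:Z].

Definition nonneg_lift s r : bool := [forall e, 0 <= sgn (s e) * c r e].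

Lemma canonical_eq0 r e : r \in residues p -> (c r e == 0) = (r e == ord0).
Proof. by move=> /cP[_ cr cp]; apply: lift_eq0. Qed.

(* For a fixed residue vector [r] with zero set [K], the sign patterns counted
   on the left are prescribed off [K] and, on [K :\: X], are those of the
   regions of the vectors of [L] vanishing on [X]. *)
Lemma sum_strictly_positive X :
  \sum_s (strictly_positive (~: X) s)%:R *
     #|[set r in residues p | (X \subset zeros r) && nonneg_lift s r]|%:R =
  2 ^+ #|X| * \sum_(Y : {set E} | Y \subset ~: X)
     (-1) ^+ (#|Y| + (d X + d (X :|: Y))) * p.+1%:R ^+ d (X :|: Y) :> int.
Proof.
pose A := [set r in residues p | X \subset zeros r].
transitivity (\sum_(r in A) 2 ^+ #|X| *
    \sum_(Y : {set E} | Y \subset zeros r :\: X) (-1) ^+ (#|Y| + (d X + d (X :|: Y))) : int).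
  transitivity (\sum_(r in A) \sum_s (strictly_positive (~: X) s && nonneg_lift s r)%:R : int).
    rewrite exchange_big /=; apply: eq_bigr => s _; rewrite -sum1_card natr_sum mulr_sumr.
    rewrite (eq_bigl (fun r => (r \in A) && nonneg_lift s r)); last first.
      by move=> r; rewrite !inE andbA.
    rewrite big_mkcondr /=; apply: eq_bigr => r _; rewrite mulr1.
    by case: nonneg_lift; rewrite ?andbT ?andbF.
  apply: eq_bigr => r; rewrite inE => /andP[rr sX]; have [Lc _ cp] := cP rr.
  pose K := zeros r; pose P s := positive_on (vanishing L X) (K :\: X) s.
  pose Q s := [forall e in ~: K, s e == (0 < c r e)].
  have cK e : (c r e == 0) = (e \in K) by rewrite inE canonical_eq0.
  have PQ s : strictly_positive (~: X) s && nonneg_lift s r = P s && Q s.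
    apply/andP/andP => [[/asboolP[f [Lf fX]] /forallP cs]|[/asboolP[f [[Lf fX] fK]] /forall_inP
      sc]].
      split.
        apply/asboolP; exists f; split=> [|e].
          by split=> // e eX; apply: (fX e).2; rewrite inE eX.
        by rewrite inE => /andP[eX _]; apply: (fX e).1; rewrite inE.
      apply/forall_inP => e; rewrite inE -cK => ce0; have := cs e.
      by move: ce0; case: (s e) => /=; case: ltgtP => //=; lia.
    have sc' e : e \notin K -> 0 < sgn (s e) * c r e.
      move=> eK; have /eqP -> : s e == (0 < c r e) by apply: sc; rewrite inE.
      by move: eK; rewrite -cK; case: (ltP 0 (c r e)) => //=; lia.
    split; last first.
      apply/forallP => e; have [eK|/sc'/ltW //] := boolP (e \in K).
      by move: eK; rewrite -cK => /eqP ->; rewrite mulr0.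
    have [B [B0 fB]] := norm_bound f.
    (* [c r] vanishes on [K] and agrees in sign with [s] elsewhere: a large multiple of it settles
       the signs off [K] and leaves those of [f] on [K]. *)
    apply/asboolP; exists (fun e => f e + (B + 1) * c r e); split.
      by apply: roundableD => //; apply: roundableZ.
    move=> e; split; rewrite inE => eX; last first.
      rewrite fX; last by move: eX; rewrite negbK.
      have : e \in K by apply: (subsetP sX); move: eX; rewrite negbK.
      by rewrite -cK => /eqP ->; rewrite mulr0.
    have [eK|/sc' ce] := boolP (e \in K).
      have := eK; rewrite -cK => /eqP ->; rewrite mulr0 addr0; apply: fK.
      by rewrite inE eX.
    have := fB e; rewrite mulrDr mulrCA -(sgn_norm (s e)).
    by move: ce; set u := sgn (s e) * c r e; set v := sgn (s e) * f e; nia.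
  have two_n0 n : 2 ^+ n != 0 :> int by rewrite expf_neq0.
  (* These two factors are the ones demanded by [nregions_vanishing] and [sum_mix]; they balance in
     the end because |K \ X| + |X| = |K|. *)
  apply: (mulfI (two_n0 #|K :\: X|)); apply: (mulfI (two_n0 #|E|)).
  under [in LHS]eq_bigr => s _ do rewrite PQ -mulnb natrM.
  rewrite mulrCA (@sum_mix _ _ K); last 2 first.
  - move=> s t st; congr ((nat_of_bool _)%:R); apply/asboolP/asboolP => -[f [Lf fK]];
      exists f; split=> // e eK; have := fK e eK; rewrite st //; by case/setDP: eK.
  - move=> s t st; congr ((nat_of_bool _)%:R); apply: eq_forallb => e.
    by case: (boolP (e \in _)) => //= eK; rewrite st.
  have nat_sum (B : pred {ffun E -> bool}) : \sum_s (B s)%:R = #|[set s | B s]|%:R :> int.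
    rewrite -sum1_card natr_sum [RHS]big_mkcond /=; apply: eq_bigr => s _.
    by rewrite inE; case: (B s).
  rewrite (nat_sum Q) card_prescribed setCK.
  rewrite (_ : \sum_s (P s)%:R = (nregions (vanishing L X) (K :\: X))%:R); last exact: nat_sum.
  rewrite [LHS]mulrA nregions_vanishing.
  rewrite natrX -!mulrA; congr (_ * _); rewrite mulrC mulrA; congr (_ * _).
  by rewrite -exprD addnC -(cardsID X K) (setIidPr sX).
rewrite -mulr_sumr; congr (_ * _).
(* With the sum over [r] innermost, each [Y] collects the residue vectors vanishing on [X :|: Y],
   whose number is a power of p+1. *)
rewrite (exchange_big_dep (fun Y : {set E} => Y \subset ~: X)) /=; last first.
  by move=> r Y _; rewrite setDE subsetI => /andP[].
apply: eq_bigr => Y sY; rewrite big_const iter_addr_0 -[LHS]mulr_natr; congr (_ * _).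
rewrite -natrX -card_residues; congr _%:R; apply: eq_card => r.
rewrite [LHS]unfold_in /= /A in_set [RHS]in_set subUset setDE subsetI sY andbT.
by rewrite andbA.
Qed.

End Regions.

(** * A pair of orthogonal lattices *)

Lemma mul_sub_ge0 (a u : int) : `|u| <= 1 -> 0 <= a * (a - u).
Proof.
move=> u1; have [->|[a1|a1]] : a = 0 \/ (1 <= a \/ a <= -1) by lia.
- by rewrite mul0r.
- by apply: mulr_ge0; lia.
- by apply: mulr_le0; lia.
Qed.

Lemma sgn_step (b : bool) (P x y a : int) : 0 < P -> 0 <= sgn b * x -> sgn b * x <= P ->
  `|y| < P -> x - y = a * P -> a = 0 \/ a = sgn b.
Proof.
move=> P0 x0 xP yP xya.
have [a0|[a1|a2]] : sgn b * a = 0 \/ (sgn b * a = 1 \/ (sgn b * a <= -1 \/ 2 <= sgn b * a)) by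
  lia.
- by left; move: a0; case: (b) => /=; lia.
- by right; move: a1; case: (b) => /=; lia.
have e : sgn b * x - sgn b * y = (sgn b * a) * P by rewrite -mulrBr xya mulrA.
have : `|sgn b * y| < P by rewrite sgn_norm.
move: e x0 xP a2; set u := sgn b * x; set v := sgn b * y; set w := sgn b * a.
move=> e x0 xP a2 vP; exfalso; case: a2 => w0.
  have : w * P <= - P by nia.
  by clear w0; lia.
have : 2 * P <= w * P by nia.
by clear w0; lia.
Qed.

Lemma sgn_flip_dominate (x y B : int) u v : 0 <= sgn u * x -> x != 0 -> `|x| <= B ->
  (u = v /\ y = 0) \/ (u != v /\ y = sgn u) -> 0 < sgn v * (x - (B + 1) * y).
Proof.
by move=> x0 xn xB [[<- ->]|[uv ->]]; [|move: uv]; move: x0 xn xB;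
  case: u; case: v => //=; rewrite ?mulr0 ?subr0; lia.
Qed.

Lemma eq_addMl (x y : int) (m : nat) : (y + m.+1%:Z * x == y) = (x == 0).
Proof. by rewrite -subr_eq0 addrC addKr mulf_eq0. Qed.

Section Pair.
Variable E : finType.
Variables (L M : (E -> int) -> Prop).
Hypotheses (rL : roundable L) (rM : roundable M).
Hypothesis orth : forall f g, L f -> M g -> \sum_e f e * g e = 0.
Implicit Types (s t : {ffun E -> bool}) (f g a b : E -> int) (X Y : {set E}).

Definition flip_equiv s t : bool :=
  `[< exists a b, [/\ L a, M b
       & forall e, a e + b e = if s e == t e then 0 else sgn (s e)] >].

(** Complementary slackness: when both vectors are aligned with [s], the vanishing inner product is
    a sum of nonnegative terms. *)
Lemma orthogonal_eq0 s f g : L f -> M g -> (forall e, 0 <= sgn (s e) * f e) ->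
  (forall e, 0 <= sgn (s e) * g e) -> forall e, f e * g e = 0.
Proof.
move=> Lf Mg f0 g0 e.
have fg0 x : true -> 0 <= f x * g x.
  move=> _; have := mulr_ge0 (f0 x) (g0 x); rewrite mulrACA.
  by case: (s x); rewrite /= ?mulN1r ?opprK ?mul1r ?mulr1.
exact: (psumr_eq0P fg0 (orth Lf Mg)).
Qed.

(* Pairing [a + b] with [a] gives [\sum_e a e * (a e - (a e + b e)) = 0], a sum
   of nonnegative integers because [a + b] takes its values in {-1, 0, 1}. *)
Lemma flip_split s t a b : L a -> M b ->
  (forall e, a e + b e = if s e == t e then 0 else sgn (s e)) ->
  forall e, if s e == t e then a e = 0 /\ b e = 0
            else (a e = sgn (s e) /\ b e = 0) \/ (a e = 0 /\ b e = sgn (s e)).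
Proof.
move=> La Mb ab e.
have u1 x : `|a x + b x| <= 1 by rewrite ab; case: ifP => _; case: (s x).
have s0 : \sum_x a x * (a x - (a x + b x)) = 0.
  under eq_bigr do rewrite opprD addrA subrr add0r mulrN.
  by rewrite sumrN orth ?oppr0.
have /(_ e isT)/eqP := psumr_eq0P (fun x _ => mul_sub_ge0 (a x) (u1 x)) s0.
rewrite mulf_eq0 subr_eq0 => a01; have := ab e; case: ifP => _ abe.
  by move: a01 abe; lia.
by case/orP: a01 => /eqP a0; [right|left]; lia.
Qed.

Lemma flip_equiv_refl s : flip_equiv s s.
Proof.
apply/asboolP; exists (fun=> 0), (fun=> 0); split; try exact: roundable0.
by move=> e; rewrite eqxx addr0.
Qed.

Lemma flip_equiv_sym s t : flip_equiv s t -> flip_equiv t s.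
Proof.
case/asboolP => a [b [La Mb ab]]; apply/asboolP.
exists (fun e => - a e), (fun e => - b e); split; try exact: roundableN.
by move=> e; rewrite -opprD ab; case: (s e); case: (t e).
Qed.

Lemma flip_equiv_trans s t u : flip_equiv s t -> flip_equiv t u -> flip_equiv s u.
Proof.
case/asboolP => a [b [La Mb ab]] /asboolP[a' [b' [La' Mb' ab']]]; apply/asboolP.
exists (fun e => a e + a' e), (fun e => b e + b' e); split; try exact: roundableD.
by move=> e; rewrite addrACA ab ab'; case: (s e); case: (t e); case: (u e).
Qed.

Variable C : {ffun E -> bool} -> {set E}.
Hypothesis CP : forall s, strictly_positive L (~: C s) s /\ strictly_positive M (C s) s.

Lemma strictly_positive_ge0 (N : (E -> int) -> Prop) X s : strictly_positive N X s ->
  exists f, [/\ N f, forall e, 0 <= sgn (s e) * f e, forall e, e \in X -> f e != 0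
    & forall e, e \notin X -> f e = 0].
Proof.
case/asboolP => f [Nf fX]; exists f; split=> // e; last exact: (fX e).2.
  by have [/(fX e).1/ltW//|/(fX e).2 ->] := boolP (e \in X); rewrite mulr0.
by move=> /(fX e).1; apply: contraTneq => ->; rewrite mulr0 ltxx.
Qed.

(** Slackness between a vector of [L] nonzero off [A] and a vector of [M] nonzero on [B] gives the
    inclusion of [B] in [A]; it is applied in both directions. *)
Lemma C_unique s X : strictly_positive L (~: X) s -> strictly_positive M X s -> C s = X.
Proof.
have sub A B : strictly_positive L (~: A) s -> strictly_positive M B s -> B \subset A.
  case/strictly_positive_ge0 => f [Lf f0 fA _] /strictly_positive_ge0[g [Mg g0 gB _]].
  apply/subsetP => e eB; apply/negPn/negP => eA.
  have /eqP := orthogonal_eq0 Lf Mg f0 g0 e.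
  by rewrite mulf_eq0 (negPf (gB e eB)) (negPf (fA e _)) // inE.
move=> LX MX; have [LC MC] := CP s.
by apply/eqP; rewrite eqEsubset !sub.
Qed.

(** Slackness shows that [a] vanishes on [C s] and [b] off it. Subtracting a large multiple of the
    flip vector from a strictly positive witness for [s] then reverses it exactly at the flipped
    edges, giving a witness for [t] on the same set. *)
Lemma flip_equiv_C s t : flip_equiv s t -> C s = C t.
Proof.
case/asboolP => a [b [La Mb ab]]; have aux := flip_split La Mb ab.
have [/strictly_positive_ge0[f [Lf f0 fC fC0]] /strictly_positive_ge0[g [Mg g0 gC gC0]]] := CP s.
have a0 e : 0 <= sgn (s e) * a e.
  have := aux e; case: ifP => _; first by case=> -> _; rewrite mulr0.
  by case=> -[-> _]; case: (s e).
have b0 e : 0 <= sgn (s e) * b e.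
  have := aux e; case: ifP => _; first by case=> _ ->; rewrite mulr0.
  by case=> -[_ ->]; case: (s e).
have aC e : e \in C s -> a e = 0.
  move=> eC; have /eqP := orthogonal_eq0 La Mg a0 g0 e.
  by rewrite mulf_eq0 (negPf (gC e eC)) orbF => /eqP.
have bC e : e \notin C s -> b e = 0.
  move=> eC; have /eqP := orthogonal_eq0 Lf Mb f0 b0 e.
  by rewrite mulf_eq0 (negPf (fC e _)) ?inE // => /eqP.

apply/esym/C_unique; apply/asboolP.
  have [B [B0 fB]] := norm_bound f.
  exists (fun e => f e - (B + 1) * a e); split.
    by apply: roundableB => //; apply: roundableZ.
  move=> e; split; rewrite inE => eC; last first.
    by rewrite fC0 ?inE ?aC ?mulr0 ?subr0 // -[_ \in _]negbK.
  apply: (sgn_flip_dominate (u := s e)) => //; first by apply: fC; rewrite inE.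
  have := aux e; rewrite (bC e eC); case: eqP => [-> [-> _]|/eqP st]; first by left.
  by case=> -[ae be]; right; split=> //; move: be; case: (s e).
have [B [B0 gB]] := norm_bound g.
exists (fun e => g e - (B + 1) * b e); split.
  by apply: roundableB => //; apply: roundableZ.
move=> e; split=> eC; last by rewrite gC0 // bC // mulr0 subr0.
apply: (sgn_flip_dominate (u := s e)) => //; first exact: gC.
have := aux e; rewrite (aC e eC); case: eqP => [-> [_ ->]|/eqP st]; first by left.
by case=> -[ae be]; right; split=> //; move: ae; case: (s e).
Qed.

Definition signed p s (f : {ffun E -> 'I_p}) : E -> int :=
  fun e => sgn (s e) * (f e : nat)%:Z.

Definition residue p f : {ffun E -> 'I_p.+1} := [ffun e => inord `|(f e %% p.+1%:Z)%Z|].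

Lemma residueP p f e : (p.+1%:Z %| f e - (residue p f e : nat)%:Z)%Z.
Proof.
have m0 : 0 <= (f e %% p.+1%:Z)%Z by apply: modz_ge0.
have mp : (f e %% p.+1%:Z)%Z < p.+1%:Z by apply: ltz_pmod.
rewrite ffunE inordK; last by rewrite -ltz_nat gez0_abs.
by rewrite gez0_abs // {1}(divz_eq (f e) p.+1) addrK dvdz_mull.
Qed.

Lemma residue_eq p f (r : {ffun E -> 'I_p.+1}) :
  (forall e, (p.+1%:Z %| f e - (r e : nat)%:Z)%Z) -> residue p f = r.
Proof.
move=> fr; apply/ffunP => e; apply/val_inj.
have h1 : (f e = (r e : nat)%:Z %[mod p.+1%:Z])%Z by apply/eqP; rewrite eqz_mod_dvd.
have h2 : (f e = (residue p f e : nat)%:Z %[mod p.+1%:Z])%Z.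
  by apply/eqP; rewrite eqz_mod_dvd residueP.
have := etrans (esym h2) h1; rewrite !modz_nat => -[].
by rewrite !modn_small.
Qed.

(** The difference from the chosen lift is p+1 times a vector of [N] by saturation, and the bounds
    on both sides leave room for at most one step, in the direction of [s]. *)
Lemma lift_difference (N : (E -> int) -> Prop) p (c : {ffun E -> 'I_p.+1} -> E -> int) s
    (f : {ffun E -> 'I_p.+2}) : roundable N ->
  (forall r, r \in residues N p ->
    [/\ N (c r), forall e, (p.+1%:Z %| c r e - (r e : nat)%:Z)%Z
      & forall e, `|c r e| < p.+1%:Z]) ->
  N (signed s f) -> let r := residue p (signed s f) in
  [/\ r \in residues N p, forall e, 0 <= sgn (s e) * signed s f e
    & exists a, [/\ N a, forall e, signed s f e = c r e + p.+1%:Z * a e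
        & forall e, a e = 0 \/ a e = sgn (s e)]].
Proof.
move=> rN cP Nf r; have rr : r \in residues N p.
  by rewrite inE; apply/asboolP; exists (signed s f); split=> // e; apply: residueP.
have [Nc cr cp] := cP r rr; have f0 e : 0 <= sgn (s e) * signed s f e by rewrite sgnK.
split=> //; exists (fun e => ((signed s f e - c r e) %/ p.+1%:Z)%Z).
have dv e : (p.+1%:Z %| signed s f e - c r e)%Z.
  have := rpredB (residueP p (signed s f) e) (cr e); congr (_ %| _)%Z; rewrite -/r; ring.
split.
- apply: (roundable_div (p := p.+1) isT rN (roundableB rN Nf Nc)) => e.
  by rewrite mulrC divzK.
- by move=> e; rewrite mulrC divzK // addrC subrK.
- move=> e; apply: (@sgn_step (s e) p.+1 (signed s f e) (c r e)) => //.
    by rewrite /signed sgnK; have := ltn_ord (f e); case: (f e) => k /=; lia.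
  by rewrite divzK.
Qed.

Variables (p q : nat).
Variables (c : {ffun E -> 'I_p.+1} -> E -> int) (c' : {ffun E -> 'I_q.+1} -> E -> int).
Hypothesis cP : forall r, r \in residues L p ->
  [/\ L (c r), forall e, (p.+1%:Z %| c r e - (r e : nat)%:Z)%Z
    & forall e, `|c r e| < p.+1%:Z].
Hypothesis c'P : forall r, r \in residues M q ->
  [/\ M (c' r), forall e, (q.+1%:Z %| c' r e - (r e : nat)%:Z)%Z
    & forall e, `|c' r e| < q.+1%:Z].

Variable R : {set {ffun E -> bool}}.
Hypothesis R_inj : {in R &, forall s t, flip_equiv s t -> s = t}.

(** Values in ['I_p.+2] form the closed box of side p+1, matching the modulus p+1: both ends have
    residue 0. *)
Definition closed_triples :
    {set {ffun E -> bool} * {ffun E -> 'I_p.+2} * {ffun E -> 'I_q.+2}} :=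
  [set x | [&& x.1.1 \in R, `[< L (signed x.1.1 x.1.2) >] & `[< M (signed x.1.1 x.2) >]]].

Definition lift_triples :
    {set {ffun E -> bool} * {ffun E -> 'I_p.+1} * {ffun E -> 'I_q.+1}} :=
  [set y | [&& [exists t in R, flip_equiv t y.1.1], y.1.2 \in residues L p,
      y.2 \in residues M q, nonneg_lift c y.1.1 y.1.2 & nonneg_lift c' y.1.1 y.2]].

(** An edge is flipped where one of the two box vectors differs from its chosen lift; there that
    lift is zero or has the sign opposite to [s]. *)
Definition normalize (x : {ffun E -> bool} * {ffun E -> 'I_p.+2} * {ffun E -> 'I_q.+2}) :=
  let s := x.1.1 in
  let r := residue p (signed s x.1.2) in let r' := residue q (signed s x.2) in
  ([ffun e => if (signed s x.1.2 e == c r e) && (signed s x.2 e == c' r' e)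
              then s e else ~~ s e] : {ffun E -> bool}, r, r').

(** The corrections [a] and [b] are aligned with [s], so they have disjoint supports and their sum
    is the flip vector. Where [b] is nonzero the tension vanishes, and where [a] is nonzero the flow
    vanishes, so a flip caused by one factor does not spoil the sign of the lift in the other. *)
Lemma normalize_spec x : x \in closed_triples -> let s := x.1.1 in let y := normalize x in
  exists a b, [/\ L a, M b,
    forall e, a e + b e = if s e == y.1.1 e then 0 else sgn (s e),
    forall e, signed s x.1.2 e = c y.1.2 e + p.+1%:Z * a e
  & forall e, signed s x.2 e = c' y.2 e + q.+1%:Z * b e]
  /\ y \in lift_triples.
Proof.
case: x => [[s f] g]; rewrite inE /= => /and3P[sR /asboolP Lf /asboolP Mg].
have [rr f0 [a [La fa a01]]] := lift_difference rL cP Lf.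
have [rr' g0 [b [Mb gb b01]]] := lift_difference rM c'P Mg.
rewrite /normalize /=; set r := residue p _ in rr fa *; set r' := residue q _ in rr' gb *.
set t := finfun _.
have tE e : t e = if (a e == 0) && (b e == 0) then s e else ~~ s e.
  by rewrite ffunE fa gb !eq_addMl.
have a0 e : 0 <= sgn (s e) * a e by case: (a01 e) => ->; case: (s e).
have b0 e : 0 <= sgn (s e) * b e by case: (b01 e) => ->; case: (s e).
have ab0 := orthogonal_eq0 La Mb a0 b0.
have fb0 := orthogonal_eq0 Lf Mb f0 b0.
have ag0 := orthogonal_eq0 La Mg a0 g0.
have sn0 e : sgn (s e) != 0 by case: (s e).
have ab e : a e + b e = if s e == t e then 0 else sgn (s e).
  rewrite tE; have := ab0 e; case: (a01 e) => ->; case: (b01 e) => ->;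
    rewrite ?eqxx ?(negPf (sn0 e)) /=.
  - by rewrite addr0.
  - by rewrite add0r; case: (s e).
  - by rewrite addr0; case: (s e).
  - by case: (s e).
have st : flip_equiv s t by apply/asboolP; exists a, b.
exists a, b; split=> //; rewrite inE /= rr rr' /=; apply/and3P; split.
- by apply/existsP; exists s; rewrite sR.
- apply/forallP => e; rewrite tE.
  have [_ _ cp] := cP rr; have := cp e; have := fa e; have := f0 e; have := fb0 e.
  have fle : sgn (s e) * signed s f e <= p.+1.
    by rewrite /signed sgnK; case: (f e) => k /=; lia.
  case: (a01 e) => ->; last first.
    by rewrite (negPf (sn0 e)) /=; move: fle; case: (s e) => /=; lia.
  rewrite eqxx /= mulr0 addr0; case: (b01 e) => ->; first by rewrite eqxx => _ ? <-.
  rewrite (negPf (sn0 e)) => /eqP; rewrite mulf_eq0 (negPf (sn0 e)) orbF => /eqP ->.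
  by move=> _ <-; rewrite mulr0.
- apply/forallP => e; rewrite tE.
  have [_ _ cp] := c'P rr'; have := cp e; have := gb e; have := g0 e; have := ag0 e.
  have gle : sgn (s e) * signed s g e <= q.+1.
    by rewrite /signed sgnK; case: (g e) => k /=; lia.
  case: (b01 e) => ->; last first.
    by rewrite (negPf (sn0 e)) andbF; move: gle; case: (s e) => /=; lia.
  rewrite eqxx andbT mulr0 addr0; case: (a01 e) => ->; first by rewrite eqxx => _ ? <-.
  rewrite (negPf (sn0 e)) => /eqP; rewrite mulf_eq0 (negPf (sn0 e)) => /eqP ->.
  by move=> _ <-; rewrite mulr0.
Qed.

Lemma signed_inj m s : injective (@signed m s).
Proof.
move=> f g fg; apply/ffunP => e; apply/val_inj.
by have := congr1 (fun h => sgn (s e) * h e) fg; rewrite /signed !sgnK => -[].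
Qed.

(** Equal images make the two patterns equivalent, hence equal as members of [R]. Then [a - a']
    equals [b' - b], lies in both lattices, and is orthogonal to itself. *)
Lemma normalize_inj : {in closed_triples &, injective normalize}.
Proof.
move=> [[s f] g] [[t h] k] xS yS xy.
have [a [b [[La Mb ab fa gb] xL]]] := normalize_spec xS.
have [a' [b' [[La' Mb' ab' fa' gb'] _]]] := normalize_spec yS.
rewrite -xy /= in fa' gb' ab'; move: fa gb ab => /= fa gb ab.
have sR : s \in R by move: xS; rewrite inE => /andP[].
have tR : t \in R by move: yS; rewrite inE => /andP[].
have st : s = t.
  apply: R_inj => //; apply: (@flip_equiv_trans _ (normalize (s, f, g)).1.1).
    by apply/asboolP; exists a, b.
  by apply: flip_equiv_sym; apply/asboolP; exists a', b'.
subst t.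
have aa' e : a e - a' e = b' e - b e.
  by apply/eqP; rewrite subr_eq addrAC eq_sym subr_eq eq_sym ab [_ + a' e]addrC ab'.
have d0 e : a e = a' e.
  have Ld := roundableB rL La La'; have Md := roundableB rM Mb' Mb.
  apply/eqP; rewrite -subr_eq0 -[_ == 0]orbb -mulf_eq0; apply/eqP.
  apply: (psumr_eq0P (fun x (_ : xpredT x) => sqr_ge0 (a x - a' x))) => //.
  by rewrite -[RHS](orth Ld Md); apply: eq_bigr => x _; rewrite -aa'.
have b'b e : b e = b' e by have := aa' e; rewrite d0 subrr => /eqP;
  rewrite eq_sym subr_eq0 => /eqP.
congr (_, _, _).
  by apply: (@signed_inj _ s); apply/funext => e; rewrite fa fa' d0.
by apply: (@signed_inj _ s); apply/funext => e; rewrite gb gb' b'b.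
Qed.

Lemma lift_box m (u : bool) (x a : int) : `|x| < m.+1%:Z -> a = 0 \/ a = sgn u ->
  (a = 0 -> 0 <= sgn u * x) -> (a != 0 -> sgn u * x <= 0) ->
  exists i : 'I_m.+2, sgn u * (i : nat)%:Z = x + m.+1%:Z * a.
Proof.
move=> xm a01 h1 h2.
have lt : (`|(x + m.+1%:Z * a)%R|%N < m.+2)%N.
  by case: a01 h1 h2 => -> h1 h2; [lia|case: u h2 {h1} => /= /(_ isT); lia].
exists (Ordinal lt) => /=; case: a01 h1 h2 => ae h1 h2.
  by have := h1 ae; rewrite ae; case: (u) => /=; lia.
by move: h2; rewrite ae; case: (u) => /= /(_ isT); lia.
Qed.

(** The inverse adds to each lift the modulus times the corresponding part of the flip vector from
    the representative in [R]. *)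
Lemma normalize_image : [set normalize x | x in closed_triples] = lift_triples.
Proof.
apply/setP => y; apply/imsetP/idP => [[x xS ->]|].
  by have [a [b [_ ?]]] := normalize_spec xS.
case: y => [[t r] r'];
  rewrite inE /= => /and5P[/existsP[s /andP[sR st]] rr rr' /forallP tr /forallP tr'].
case/asboolP: (st) => a [b [La Mb ab]]; have aux := flip_split La Mb ab.
have [Lc cr cp] := cP rr; have [Mc cr' cq] := c'P rr'.
have a01 e : a e = 0 \/ a e = sgn (s e).
  by have := aux e; case: ifP => _; [case=> ->; left|case=> -[-> _]; [right|left]].
have b01 e : b e = 0 \/ b e = sgn (s e).
  by have := aux e; case: ifP => _; [case=> _ ->; left|case=> -[_ ->]; [left|right]].
(* Seen from [t] the flip is reversed, so [- a] and [- b] are aligned with [t], like the lifts.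
   Slackness then makes [c r] vanish where [b] does not, and [c' r'] where [a] does not. *)
have ta e : 0 <= sgn (t e) * - a e.
  have := aux e; case: eqP => [_ [-> _]|/eqP]; first by rewrite oppr0 mulr0.
  by case: (s e) (t e) => -[] //= _ [] [-> _].
have tb e : 0 <= sgn (t e) * - b e.
  have := aux e; case: eqP => [_ [_ ->]|/eqP]; first by rewrite oppr0 mulr0.
  by case: (s e) (t e) => -[] //= _ [] [_ ->].
have cb0 e : c r e * b e = 0.
  have := orthogonal_eq0 Lc (roundableN rM Mb) tr tb e.
  by rewrite mulrN => /eqP; rewrite oppr_eq0 => /eqP.
have ca0 e : a e * c' r' e = 0.
  have := orthogonal_eq0 (roundableN rL La) Mc ta tr' e.
  by rewrite mulNr => /eqP; rewrite oppr_eq0 => /eqP.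
have sn0 e : sgn (s e) != 0 by case: (s e).
have fP e : exists i : 'I_p.+2, sgn (s e) * (i : nat)%:Z = c r e + p.+1%:Z * a e.
  apply: lift_box => //; have := tr e; have := cb0 e; have := aux e; case: eqP => [->|/eqP ne].
  - by [].
  - case=> -[-> ->]; first by move=> _ _ /eqP; rewrite (negPf (sn0 e)).
    by move=> /eqP; rewrite mulf_eq0 (negPf (sn0 e)) orbF => /eqP -> _ _; rewrite mulr0.
  - by case=> -> _ _ _; rewrite eqxx.
  - case=> -[-> _]; last by rewrite eqxx.
    by move=> _ + _; move: ne; case: (s e) (t e) => -[] //= _; lia.
have gP e : exists i : 'I_q.+2, sgn (s e) * (i : nat)%:Z = c' r' e + q.+1%:Z * b e.
  apply: lift_box => //; have := tr' e; have := ca0 e; have := aux e; case: eqP => [->|/eqP ne].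
  - by [].
  - case=> -[-> ->]; last by move=> _ _ /eqP; rewrite (negPf (sn0 e)).
    by move=> /eqP; rewrite mulf_eq0 (negPf (sn0 e)) => /eqP -> _ _; rewrite mulr0.
  - by case=> _ -> _ _; rewrite eqxx.
  - case=> -[_ ->]; first by rewrite eqxx.
    by move=> _ + _; move: ne; case: (s e) (t e) => -[] //= _; lia.
have /choice[f0 f0P] := fP; have /choice[g0 g0P] := gP.
pose f := [ffun e => f0 e]; pose g := [ffun e => g0 e].
have fE : signed s f = (fun e => c r e + p.+1%:Z * a e).
  by apply/funext => e; rewrite /signed ffunE f0P.
have gE : signed s g = (fun e => c' r' e + q.+1%:Z * b e).
  by apply/funext => e; rewrite /signed ffunE g0P.
exists (s, f, g).
  rewrite inE /= sR fE gE /=; apply/andP; split; apply/asboolP.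
    exact: (roundableD rL Lc (roundableZ _ rL La)).
  exact: (roundableD rM Mc (roundableZ _ rM Mb)).
have rE : residue p (signed s f) = r.
  by apply: residue_eq => e; rewrite fE addrAC rpredD // dvdz_mulr.
have rE' : residue q (signed s g) = r'.
  by apply: residue_eq => e; rewrite gE addrAC rpredD // dvdz_mulr.
rewrite /normalize /= rE rE'; congr (_, _, _); apply/ffunP => e; rewrite !ffunE fE gE.
rewrite !eq_addMl.
have := aux e; case: eqP => [-> [-> ->]|/eqP ne]; first by rewrite eqxx.
by case=> -[-> ->]; rewrite (negPf (sn0 e)) ?andbF; move: ne; case: (s e); case: (t e).
Qed.

(** The weight may see the pattern only through its class, because [normalize] replaces the pattern
    by an equivalent one. *)
Lemma transfer (V : nmodType)
    (W : {ffun E -> bool} -> {ffun E -> 'I_p.+1} -> {ffun E -> 'I_q.+1} -> V) :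
  (forall s t r r', flip_equiv s t -> W s r r' = W t r r') ->
  \sum_(x in closed_triples)
     W x.1.1 (residue p (signed x.1.1 x.1.2)) (residue q (signed x.1.1 x.2)) =
  \sum_(y in lift_triples) W y.1.1 y.1.2 y.2.
Proof.
move=> Winv; rewrite -normalize_image big_imset /=; last exact: normalize_inj.
apply: eq_bigr => x xS; apply: Winv.
have [a [b [[La Mb ab _ _] _]]] := normalize_spec xS.
by apply/asboolP; exists a, b.
Qed.

End Pair.

Lemma card_setE (R : pzSemiRingType) (T : finType) (P : pred T) :
  #|[set x | P x]|%:R = \sum_x (P x)%:R :> R.
Proof.
rewrite -sum1_card natr_sum big_mkcond /=; apply: eq_bigr => x _.
by rewrite inE; case: (P x).
Qed.

Lemma sum_triples (R : pzSemiRingType) (A B D : finType)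
    (P : pred (A * B * D)) (F : A * B * D -> R) :
  \sum_(x in [set x | P x]) F x = \sum_a \sum_b \sum_d (P (a, b, d))%:R * F (a, b, d).
Proof.
rewrite big_mkcond (eq_bigr (fun x : A * B * D => (P (x.1.1, x.1.2, x.2))%:R * F (x.1.1, x.1.2,
  x.2))).
  rewrite -(pair_bigA _ (fun (x : A * B) d => (P (x.1, x.2, d))%:R * F (x.1, x.2, d))) /=.
  by rewrite -(pair_bigA _ (fun a b => \sum_d (P (a, b, d))%:R * F (a, b, d))).
by move=> [[a b] d] _; rewrite inE /=; case: (P _); rewrite ?mul1r ?mul0r.
Qed.

Lemma sum_triples_card (R : comPzSemiRingType) (A B D : finType) (P : pred A)
    (PB : A -> pred B) (PD : A -> pred D) (F : A -> R) :
  \sum_(x in [set x : A * B * D | [&& P x.1.1, PB x.1.1 x.1.2 & PD x.1.1 x.2]]) F x.1.1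
  = \sum_(a | P a) F a * #|[set b | PB a b]|%:R * #|[set d | PD a d]|%:R.
Proof.
rewrite sum_triples [RHS]big_mkcond /=; apply: eq_bigr => a _.
case: (P a) => /=; last by rewrite big1 // => b _; rewrite big1 // => d _; rewrite mul0r.
rewrite !card_setE -mulrA mulr_suml mulr_sumr; apply: eq_bigr => b _.
rewrite mulr_sumr mulr_sumr; apply: eq_bigr => d _.
by rewrite -mulnb natrM mulrC.
Qed.

(** * Weighted sums over a transversal, for closed boxes and for complementary supports *)

Section Sums.
Variable E : finType.
Variables (L M : (E -> int) -> Prop).
Hypotheses (rL : roundable L) (rM : roundable M).
Hypothesis orth : forall f g, L f -> M g -> \sum_e f e * g e = 0.
Variable C : {ffun E -> bool} -> {set E}.
Hypothesis CP : forall s, strictly_positive L (~: C s) s /\ strictly_positive M (C s) s.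
Variables (dL dM : {set E} -> nat).
Hypothesis cardL : forall p (X : {set E}), #|[set r in residues L p | X \subset zeros r]| =
  (p.+1 ^ dL X)%N.
Hypothesis cardM : forall p (X : {set E}), #|[set r in residues M p | X \subset zeros r]| =
  (p.+1 ^ dM X)%N.
Implicit Types (s t : {ffun E -> bool}) (X Y : {set E}).

(** For tensions this becomes the closed polynomial of the contraction at p+1; for flows, with
    complemented sets, that of the restriction. *)
Definition dimsum (d : {set E} -> nat) X p : int :=
  \sum_(Y : {set E} | Y \subset ~: X)
    (-1) ^+ (#|Y| + (d X + d (X :|: Y))) * p.+1%:R ^+ d (X :|: Y).

Variable R : {set {ffun E -> bool}}.
Hypothesis R_inj : {in R &, forall s t, flip_equiv L M s t -> s = t}.
Variable w : {set E} -> int.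
Hypothesis R_cover : forall s, w (C s) != 0 -> exists2 t, t \in R & flip_equiv L M t s.

Lemma covered s : (~~ [exists t in R, flip_equiv L M t s]) -> w (C s) = 0.
Proof.
by apply: contraNeq => /R_cover[t tR ts]; apply/existsP; exists t; rewrite tR.
Qed.

(** The lifts counted vanish off [D], so the signs there have no influence; this is the locality
    that [sum_mix] requires. *)
Lemma nonneg_lift_local (N : (E -> int) -> Prop) p (c : {ffun E -> 'I_p.+1} -> E -> int) (D :
  {set E}) s t :
  (forall r, r \in residues N p ->
    [/\ N (c r), forall e, (p.+1%:Z %| c r e - (r e : nat)%:Z)%Z
      & forall e, `|c r e| < p.+1%:Z]) ->
  roundable N -> {in D, s =1 t} ->
  (strictly_positive N D s)%:R *
    #|[set r in residues N p | (~: D \subset zeros r) && nonneg_lift c s r]|%:R =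
  (strictly_positive N D t)%:R *
    #|[set r in residues N p | (~: D \subset zeros r) && nonneg_lift c t r]|%:R :> int.
Proof.
move=> cP rN st; congr (_%:R * _%:R).
  congr (nat_of_bool _); apply/asboolP/asboolP => -[f [Nf fD]]; exists f; split=> // e;
    by have [eD _] := fD e; split; [move=> De; have := eD De; rewrite st|have [] := fD e].
congr #|pred_of_set _|; apply/setP => r; rewrite [LHS]in_set [RHS]in_set.
case: (boolP (_ \in residues N p)) => //= rr.
case: (boolP (~: D \subset zeros r)) => //= /subsetP sD.
apply: eq_forallb => e; have [eD|eD] := boolP (e \in D); first by rewrite st.
have : e \in zeros r by apply: sD; rewrite inE.
by rewrite inE -(canonical_eq0 cP _ rr) => /eqP ->; rewrite !mulr0.
Qed.

(** After the transfer every pattern of nonzero weight occurs. Those with [C s = X] are singled out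
    by two strict positivity conditions on complementary coordinates, so their sum factors into a
    tension part and a flow part. *)
Lemma closed_sum p q :
  \sum_(s in R) w (C s) * (box (reorient s L) p.+1)%:R * (box (reorient s M) q.+1)%:R =
  \sum_X w X * dimsum dL X p * dimsum dM (~: X) q.
Proof.
have [c cP] := canonical_lift rL p; have [c' c'P] := canonical_lift rM q.
pose nl s := #|[set r in residues L p | (C s \subset zeros r) && nonneg_lift c s r]|.
pose nm s := #|[set r in residues M q | (~: C s \subset zeros r) && nonneg_lift c' s r]|.
transitivity (\sum_(x in closed_triples L M p q R) w (C x.1.1)).
  rewrite /closed_triples
    (sum_triples_card (mem R) (fun s (f : {ffun E -> 'I_p.+2}) => `[< L (signed s f) >])
      (fun s (f : {ffun E -> 'I_q.+2}) => `[< M (signed s f) >]) (fun s => w (C s))).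
  by [].
rewrite (transfer rL rM orth cP c'P R_inj (W := fun s _ _ => w (C s))); last first.
  by move=> s t _ _ st; rewrite (flip_equiv_C rL rM orth CP st).
rewrite /lift_triples.
have -> : [set y : {ffun E -> bool} * {ffun E -> 'I_p.+1} * {ffun E -> 'I_q.+1} |
     [&& [exists t in R, flip_equiv L M t y.1.1], y.1.2 \in residues L p,
      y.2 \in residues M q, nonneg_lift c y.1.1 y.1.2 & nonneg_lift c' y.1.1 y.2]] =
  [set y | [&& [exists t in R, flip_equiv L M t y.1.1],
     (y.1.2 \in residues L p) && nonneg_lift c y.1.1 y.1.2
   & (y.2 \in residues M q) && nonneg_lift c' y.1.1 y.2]].
  by apply/setP => y; rewrite [LHS]in_set [RHS]in_set; congr (_ && _); rewrite -!andbA;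
    congr (_ && _); rewrite andbCA.
rewrite (sum_triples_card (fun s => [exists t in R, flip_equiv L M t s])
   (fun s r => (r \in residues L p) && nonneg_lift c s r)
   (fun s r => (r \in residues M q) && nonneg_lift c' s r) (fun s => w (C s))).
transitivity (\sum_s w (C s) * (nl s)%:R * (nm s)%:R).
  rewrite big_mkcond /=; apply: eq_bigr => s _; case: ifPn => [_|/covered ->]; last first.
    by rewrite !mul0r.
  (* Slackness against the strictly positive vectors of [s] forces tension lifts to vanish on [C s]
     and flow lifts off it, so the extra zero conditions in [nl] and [nm] cost nothing. *)
  have [/strictly_positive_ge0[f [Lf f0 fC _]] /strictly_positive_ge0[g [Mg g0 gC _]]] := CP s.
  congr (_ * _%:R * _%:R); congr #|pred_of_set _|; apply/setP => r;
    rewrite [LHS]in_set [RHS]in_set; case: (boolP (_ \in residues _ _)) => //= rr.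
    case: (boolP (nonneg_lift c s r)) => [/forallP sr|]; last by rewrite andbF.
    rewrite andbT; apply/esym/subsetP => e eC; rewrite inE -(canonical_eq0 cP _ rr).
    have [Lc _ _] := cP r rr; have /eqP := orthogonal_eq0 orth Lc Mg sr g0 e.
    by rewrite mulf_eq0 (negPf (gC e eC)) orbF.
  case: (boolP (nonneg_lift c' s r)) => [/forallP sr|]; last by rewrite andbF.
  rewrite andbT; apply/esym/subsetP => e eC; rewrite inE -(canonical_eq0 c'P _ rr).
  have [Mc _ _] := c'P r rr; have /eqP := orthogonal_eq0 orth Lf Mc f0 sr e.
  by rewrite mulf_eq0 (negPf (fC e eC)).
rewrite (partition_big C xpredT) //=; apply: eq_bigr => X _.
pose P s := (strictly_positive L (~: X) s)%:R *
    #|[set r in residues L p | (~: ~: X \subset zeros r) && nonneg_lift c s r]|%:R : int.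
pose Q s := (strictly_positive M X s)%:R *
    #|[set r in residues M q | (~: X \subset zeros r) && nonneg_lift c' s r]|%:R : int.
(* By [C_unique] the condition [C s = X] may be replaced by the product of the two positivity
   indicators. *)
have -> : \sum_(s | C s == X) w (C s) * (nl s)%:R * (nm s)%:R = w X * \sum_s P s * Q s.
  rewrite mulr_sumr big_mkcond; apply: eq_bigr => s _.
  case: eqP => CX.
    by rewrite /P /Q /nl /nm -CX setCK; have [-> ->] := CP s; rewrite !mul1r mulrA.
  rewrite /P /Q; case: (boolP (strictly_positive L (~: X) s)) => [LX|];
    last by rewrite !mul0r mulr0.
  case: (boolP (strictly_positive M X s)) => [MX|]; last by rewrite mul0r !mulr0.
  by case: CX; apply: (C_unique orth CP).
rewrite -mulrA; congr (_ * _).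
have two0 : 2 ^+ #|E| != 0 :> int by rewrite expf_neq0.
apply: (mulfI two0); rewrite (@sum_mix _ _ (~: X)); last 2 first.
- by move=> s t st; apply: nonneg_lift_local.
- by move=> s t st; apply: nonneg_lift_local => // e eX; apply: st; rewrite setCK.
have := sum_strictly_positive rM cardM c'P (~: X); rewrite setCK -/(Q _) => ->.
have := sum_strictly_positive rL cardL cP X; rewrite -{1}[X]setCK; rewrite /P.
under [X in _ -> X * _ = _]eq_bigr do rewrite setCK.
rewrite setCK => ->.
by rewrite mulrACA -exprD cardsC {2}/dimsum setCK.
Qed.

(** When the residue vectors have complementary zero sets, at each edge exactly one lift is nonzero
    and dictates the sign: a single pattern [s0] is compatible, and the lifts themselves witness
    [C s0 = zeros r]. Hence each pair of residue vectors is counted once. *)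
Lemma open_sum p q :
  \sum_(x in closed_triples L M p q R)
    (zeros (residue q (signed x.1.1 x.2)) == ~: zeros (residue p (signed x.1.1 x.1.2)))%:R
      * w (C x.1.1) =
  \sum_X w X * #|[set r in residues L p | zeros r == X]|%:R
             * #|[set r in residues M q | zeros r == ~: X]|%:R.
Proof.
have [c cP] := canonical_lift rL p; have [c' c'P] := canonical_lift rM q.
rewrite (transfer rL rM orth cP c'P R_inj
  (W := fun s r r' => (zeros r' == ~: zeros r)%:R * w (C s))); last first.
  by move=> s t r r' st; rewrite (flip_equiv_C rL rM orth CP st).
rewrite sum_triples exchange_big /=.
transitivity (\sum_(r in residues L p) \sum_(r' in residues M q) (zeros r' == ~: zeros r)%:R *
  w (zeros r)).
  rewrite [RHS]big_mkcond; apply: eq_bigr => r _; rewrite exchange_big /=.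
  have [rr|_] := boolP (r \in residues L p); last first.
    by rewrite big1 // => r' _; rewrite big1 // => s _; rewrite andbF mul0r.
  rewrite [RHS]big_mkcond; apply: eq_bigr => r' _.
  have [rr'|_] := boolP (r' \in residues M q); last first.
    by rewrite big1 // => s _; rewrite andbF mul0r.
  have [krr|_] := eqVneq (zeros r') (~: zeros r); last first.
    by rewrite mul0r big1 // => s _; rewrite mul0r mulr0.
  have [Lc _ _] := cP r rr; have [Mc _ _] := c'P r' rr'.
  have kc e : (c r e == 0) = (e \in zeros r) by rewrite inE (canonical_eq0 cP).
  have kc' e : (c' r' e == 0) = (e \notin zeros r).
    by rewrite (canonical_eq0 c'P) //; have := in_setC e (zeros r); rewrite -krr inE.
  pose s0 : {ffun E -> bool} := [ffun e => if e \in zeros r then 0 < c' r' e else 0 < c r e].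
  have pos (x : int) b : x != 0 -> (0 <= sgn b * x) = (b == (0 < x)).
    by case: b; case: (ltP 0 x) => /=; lia.
  have compat s : nonneg_lift c s r && nonneg_lift c' s r' = (s == s0).
    apply/andP/eqP => [[/forallP sr /forallP sr']|->].
      apply/ffunP => e; rewrite ffunE; case: ifPn => ek; apply/eqP.
        by rewrite -pos // kc' ek.
      by rewrite -pos // kc.
    split; apply/forallP => e; rewrite ffunE.
      case: ifPn => ek; last by rewrite pos // kc.
      by move: ek; rewrite -kc => /eqP ->; rewrite mulr0.
    case: ifPn => ek; first by rewrite pos // kc' ek.
    by move: ek; rewrite -kc' => /eqP ->; rewrite mulr0.
  have Cs0 : C s0 = zeros r.
    have /andP[/forallP cs /forallP cs'] : nonneg_lift c s0 r && nonneg_lift c' s0 r' by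
      rewrite compat.
    apply: (C_unique orth CP); apply/asboolP.
      exists (c r); split=> // e; rewrite inE -kc; split; last by rewrite negbK => /eqP.
      by move=> ce; rewrite lt_neqAle cs andbT eq_sym; move: ce; apply: contra => /eqP/sgn_eq0 ->.
    exists (c' r'); split=> // e; rewrite -[_ \in _]negbK -kc' negbK; split; last by move/eqP.
    by move=> ce; rewrite lt_neqAle cs' andbT eq_sym; move: ce; apply: contra => /eqP/sgn_eq0 ->.
  rewrite (bigD1 s0) //= big1 => [|s /negPf ss]; last by rewrite compat ss andbF mul0r.
  rewrite compat eqxx andbT addr0.
  have [_|/covered w0] := boolP [exists t in R, flip_equiv L M t s0]; last first.
    by rewrite -Cs0 w0 !mulr0.
  by rewrite Cs0 !mul1r.
transitivity (\sum_(r in residues L p) w (zeros r) * #|[set r' in residues M q | zeros r' == ~: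
  zeros r]|%:R).
  apply: eq_bigr => r _; rewrite -mulr_suml mulrC; congr (_ * _).
  rewrite card_setE big_mkcond; apply: eq_bigr => r' _.
  by case: (_ \in _).
rewrite (partition_big (@zeros E p) xpredT) //=; apply: eq_bigr => X _.
under eq_bigr => r /andP[_ /eqP ->] do over.
rewrite big_const iter_addr_0 -[LHS]mulr_natr -!mulrA; congr (_ * _).
rewrite mulrC; congr (_%:R * _); apply: eq_card => r.
by rewrite [LHS]unfold_in /= [RHS]in_set.
Qed.

End Sums.

(** * Group-valued tensions and flows *)

Lemma card_fibers (U W : finType) (S : {set U}) (f : U -> W) (n : nat) :
  (forall x, x \in S -> #|[set y in S | f y == f x]| = n) -> #|S| = (#|f @: S| * n)%N.
Proof.
move=> fn; rewrite -sum1_card (partition_big_imset f) /= -sum_nat_const.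
apply: eq_bigr => _ /imsetP[x xS ->]; rewrite -(fn x xS) -sum1_card.
by apply: eq_bigl => y; rewrite inE.
Qed.

Section Components.
Variable H : mgraph.

Lemma adj_sym (u v : vert H) : adj u v = adj v u.
Proof. by apply: eq_existsb => e; rewrite orbC. Qed.

Lemma adj_edge (e : edge H) : adj (src e) (tgt e).
Proof. by apply/existsP; exists e; rewrite !eqxx. Qed.

Lemma comp_of_eq (u v : vert H) : (comp_of u == comp_of v) = connect (@adj H) u v.
Proof.
have cs : connect_sym (@adj H) by apply: sym_connect_sym; exact: adj_sym.
apply/eqP/idP => [|uv]; first by move/setP/(_ v); rewrite !inE connect0.
by apply/setP => w; rewrite !inE (same_connect cs uv).
Qed.

Lemma connect_adj_ind (P : vert H -> Prop) (u : vert H) : P u ->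
  (forall e : edge H, P (src e) <-> P (tgt e)) ->
  forall v, connect (@adj H) u v -> P v.
Proof.
move=> Pu Pe v /connectP[p pp ->] {v}; elim: p u Pu pp => //= w p IHp u Pu /andP[uw].
apply: IHp; case/existsP: uw => e /orP[/andP[/eqP eu /eqP <-]|/andP[/eqP <- /eqP eu]].
  by apply/Pe; rewrite eu.
by apply/Pe; rewrite eu.
Qed.

Definition comp_type := {K : {set vert H} | K \in comps H}.

Lemma in_comps (v : vert H) : comp_of v \in comps H.
Proof. by apply: imset_f; rewrite inE. Qed.

Definition component (v : vert H) : comp_type := exist _ (comp_of v) (in_comps v).

Lemma comp_onto (K : comp_type) : exists v, component v == K.
Proof.
case: K => K KP; case/imsetP: (KP) => v _ Kv; exists v.
by rewrite -val_eqE /= Kv.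
Qed.

Definition comp_rep (K : comp_type) : vert H := xchoose (comp_onto K).

Lemma comp_repK : cancel comp_rep component.
Proof. by move=> K; apply/eqP/(xchooseP (comp_onto K)). Qed.

Lemma card_comp_type : #|{: comp_type}| = #|comps H|.
Proof. by rewrite card_sig; apply: eq_card. Qed.

Lemma comp_eq (u v : vert H) : (component u == component v) = connect (@adj H) u v.
Proof. by rewrite -val_eqE /= comp_of_eq. Qed.

Lemma comp_edge (e : edge H) : component (src e) = component (tgt e).
Proof. by apply/eqP; rewrite comp_eq connect1 ?adj_edge. Qed.

Lemma connect_comp_rep (v : vert H) : connect (@adj H) (comp_rep (component v)) v.
Proof. by rewrite -comp_eq comp_repK. Qed.

(** Besides counting potentials, this serves with two-element values to compare numbers of
    components: inclusions and bijections between function sets become inequalities and equalities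
    of exponents. *)
Lemma card_locally_constant (A : finType) :
  #|[set h : {ffun vert H -> A} | [forall e : edge H, h (src e) == h (tgt e)]]| =
  (#|A| ^ #|comps H|)%N.
Proof.
rewrite -card_comp_type -card_ffun.
pose phi (k : {ffun comp_type -> A}) := [ffun v : vert H => k (component v)].
have phi_inj : injective phi.
  move=> k l kl; apply/ffunP => K.
  by have := congr1 (fun h : {ffun vert H -> A} => h (comp_rep K)) kl; rewrite !ffunE comp_repK.
rewrite -(card_imset _ phi_inj); apply: eq_card => h; rewrite inE.
apply/forallP/imsetP => [hc|[k _ ->] e]; last by rewrite !ffunE comp_edge.
exists [ffun K => h (comp_rep K)] => //; apply/ffunP => v; rewrite !ffunE.
apply: (connect_adj_ind (P := fun x => h x = h (comp_rep (component v)))) (connect_comp_rep v)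
  => //.
by move=> e; rewrite (eqP (hc e)).
Qed.

End Components.

Lemma sub_swap (A : zmodType) (a b c d : A) : (a - b) - (c - d) = (a - c) - (b - d).
Proof. by rewrite !opprB addrACA [RHS]addrACA; congr (_ + _); apply: addrC. Qed.

(** The first isomorphism theorem as a count: the fibres over the image are translates of the
    kernel. *)
Lemma card_additive (I J : finType) (A B : finZmodType) (S : {set {ffun I -> A}})
    (f : {ffun I -> A} -> {ffun J -> B}) :
  (forall x y, x \in S -> y \in S -> x - y \in S) -> {morph f : x y / x - y} ->
  #|S| = (#|f @: S| * #|[set x in S | f x == 0%R]|)%N.
Proof.
move=> SB fB; apply: card_fibers => x xS.
have S0 : 0 \in S by rewrite -(subrr x) SB.
have SN z : z \in S -> - z \in S by move=> zS; rewrite -sub0r SB.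
rewrite -(card_imset _ (subIr x)); apply: eq_card => z.
apply/imsetP/idP => [[y]|].
  by rewrite inE => /andP[yS /eqP yx] ->; rewrite inE SB //= fB yx subrr.
rewrite inE => /andP[zS /eqP z0]; exists (z - - x); last by rewrite opprK addrK.
rewrite inE SB ?SN //=.
have f0 : f 0 = 0 by rewrite -(subrr 0) fB subrr.
have fN y : f (- y) = - f y by rewrite -sub0r fB f0 sub0r.
by rewrite fB fN opprK z0 add0r.
Qed.

(** The map of component sums is onto, since any prescribed sum can be placed at the representative
    of its component. *)
Lemma card_zero_sums (H : mgraph) (A : finZmodType) :
  (#|[set z : {ffun vert H -> A} |
      [forall K : comp_type H, \sum_(v | component v == K) z v == 0%R]%R]|
   * #|A| ^ #|comps H| = #|A| ^ #|vert H|)%N.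
Proof.
rewrite -(card_ffun (vert H) A) -card_comp_type -(card_ffun (comp_type H) A).
pose f (z : {ffun vert H -> A}) : {ffun comp_type H -> A} :=
  [ffun K => \sum_(v | component v == K) z v].
have fB : {morph f : x y / x - y}.
  move=> x y; apply/ffunP => K; rewrite !ffunE -sumrB.
  by apply: eq_bigr => v _; rewrite !ffunE.
have := @card_additive _ _ _ _ setT f (fun x y _ _ => in_setT _) fB.
rewrite cardsT => ->; rewrite mulnC; congr (_ * _)%N.
  rewrite -cardsT; congr #|pred_of_set _|; apply/setP => k; rewrite in_setT; apply/esym/imsetP.
  exists [ffun v => if v == comp_rep (component v) then k (component v) else 0] => //.
  apply/ffunP => K; rewrite ffunE (bigD1 (comp_rep K)) /= ?comp_repK //.
  rewrite ffunE comp_repK eqxx big1 ?addr0 // => v /andP[/eqP <- /negPf nv].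
  by rewrite ffunE nv.
apply: eq_card => z; rewrite !inE; apply/forallP/eqP => [z0|/ffunP z0 K].
  by apply/ffunP => K; rewrite !ffunE (eqP (z0 K)).
by have := z0 K; rewrite !ffunE => ->.
Qed.

Lemma sum_retract (I : finType) (A : zmodType) (z : I -> A) (r : I -> I) :
  (forall v, r (r v) = r v) -> (forall w, \sum_(v | r v == r w) z v = 0) ->
  forall x, \sum_v (if x == r v then z v else 0) = 0.
Proof.
move=> rr z0 x; have [rx|rx] := eqVneq (r x) x.
  rewrite -[RHS](z0 x) [RHS]big_mkcond /=.
  by apply: eq_bigr => v _; rewrite rx eq_sym.
by rewrite big1 // => v _; case: eqP => // xv; rewrite {2}xv -(rr v) -xv eqxx in rx.
Qed.

(** * The boundary operator and its image *)

Section Boundary.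
Variables (G : mgraph) (A : zmodType) (eps : orient G).
Implicit Types (g : edge G -> A) (Y : {set edge G}).

Definition boundary g (v : vert G) : A :=
  \sum_(e | ehead eps e == v) g e - \sum_(e | etail eps e == v) g e.

Lemma is_flowE g : is_flow eps g <-> forall v, boundary g v = 0.
Proof.
split=> [fg v|bg v]; first by rewrite /boundary fg subrr.
by apply/eqP; rewrite -subr_eq0 -/(boundary g v) bg.
Qed.

Lemma boundaryB g g' v : boundary (fun e => g e - g' e) v = boundary g v - boundary g' v.
Proof. by rewrite /boundary !sumrB sub_swap. Qed.

Lemma boundaryD g g' v : boundary (fun e => g e + g' e) v = boundary g v + boundary g' v.
Proof. by rewrite /boundary !big_split /= opprD addrACA. Qed.

Lemma boundary_sum (I : finType) (F : I -> edge G -> A) v :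
  boundary (fun e => \sum_i F i e) v = \sum_i boundary (F i) v.
Proof. by rewrite /boundary sumrB; congr (_ - _); apply: exchange_big. Qed.

Lemma sum_boundary (P : pred (vert G)) g :
  \sum_(v | P v) boundary g v = \sum_e (g e *+ P (ehead eps e) - g e *+ P (etail eps e)).
Proof.
have half (x : edge G -> vert G) :
    \sum_(v | P v) \sum_(e | x e == v) g e = \sum_e g e *+ P (x e).
  rewrite (exchange_big_dep predT) //=; apply: eq_bigr => e _.
  have [Px|nPx] := boolP (P (x e)).
    rewrite (big_pred1 (x e)) // => v /=; rewrite [x e == v]eq_sym.
    by case: (eqVneq v (x e)) => [->|_]; rewrite ?Px ?andbF.
  by rewrite big1 // => v /andP[Pv /eqP ev]; move: nPx; rewrite ev Pv.
by rewrite !sumrB !half.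
Qed.

Lemma comp_ends Y e : e \in Y ->
  component (etail eps e : vert (restriction Y)) = component (ehead eps e : vert (restriction Y)).
Proof.
move=> eY; have := comp_edge (exist _ e eY : edge (restriction Y)).
by rewrite /etail /ehead /=; case: (eps e) => ->.
Qed.

Lemma boundary_comp Y g (K : comp_type (restriction Y)) :
  (forall e, e \notin Y -> g e = 0) -> \sum_(v | component v == K) boundary g v = 0.
Proof.
move=> gY; rewrite (sum_boundary (fun v => component (v : vert (restriction Y)) == K)) big1 //
  => e _.
by have [/comp_ends ->|/gY ->] := boolP (e \in Y); rewrite ?mul0rn subrr.
Qed.

Lemma boundary_indicator (e0 : edge G) (t : A) v :
  boundary (fun e => if e == e0 then t else 0) v =
  (if v == ehead eps e0 then t else 0) - (if v == etail eps e0 then t else 0).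
Proof.
have half (x : edge G -> vert G) :
    \sum_(e | x e == v) (if e == e0 then t else 0) = if v == x e0 then t else 0.
  rewrite -big_mkcondr /=; have [->|nv] := eqVneq v (x e0).
    by rewrite (big_pred1 e0) // => e /=; case: (eqVneq e e0) => [->|]; rewrite ?eqxx ?andbF.
  by rewrite big_pred0 // => e; apply: contraNF nv => /andP[/eqP <- /eqP ->].
by rewrite /boundary !half.
Qed.

(** The amount [t] is shipped from [u] to [v] along a path in [Y], one edge at a time. *)
Lemma boundary_path Y (u v : vert G) (t : A) :
  connect (@adj (restriction Y)) u v ->
  exists g, (forall e, e \notin Y -> g e = 0) /\
    forall x, boundary g x = (if x == v then t else 0) - (if x == u then t else 0).
Proof.
move=> uv; pose P w := exists g, (forall e, e \notin Y -> g e = 0) /\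
    forall x, boundary g x = (if x == w then t else 0) - (if x == u then t else 0).
refine (@connect_adj_ind (restriction Y) P u _ _ v uv) => [|e].
  by exists (fun=> 0); split=> // x; rewrite /boundary !big1 // !subrr.
have eY : val e \in Y := valP e.
pose d (a b x : vert G) : A := (if x == a then t else 0) - (if x == b then t else 0).
(* One edge can carry [t] either way: [s] is the wanted direction, and the sign is changed when
   [eps] disagrees with it. *)
have step (s : bool) : exists k : edge G -> A, (forall e, e \notin Y -> k e = 0) /\
    forall x, boundary k x = d (if s then tgt (val e) else src (val e))
                               (if s then src (val e) else tgt (val e)) x.
  have [es|es] := eqVneq (eps (val e)) s.
    exists (fun e' => if e' == val e then t else 0); split.
      by move=> e'; case: eqP => [->|//]; rewrite eY.
    by move=> x; rewrite boundary_indicator /ehead /etail es; case: (s).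
  exists (fun e' => 0 - (if e' == val e then t else 0)); split.
    by move=> e'; case: eqP => [->|_]; rewrite ?eY ?subr0.
  move=> x; rewrite boundaryB boundary_indicator {1}/boundary !big1 // subrr sub0r opprB.
  by rewrite /ehead /etail; move: es; case: (eps _); case: (s).
split=> -[g [gY bg]].
  have [k [kY bk]] := step true; exists (fun e => g e + k e); split=> [e' e'Y|x].
    by rewrite gY // kY // addr0.
  by rewrite boundaryD bg bk /d addrC addrA subrK.
have [k [kY bk]] := step false; exists (fun e => g e + k e); split=> [e' e'Y|x].
  by rewrite gY // kY // addr0.
by rewrite boundaryD bg bk /d addrC addrA subrK.
Qed.

(** Each [z v] is shipped to [v] from the representative of its component; what is drawn from a
    representative totals 0 by hypothesis. *)
Lemma boundary_onto Y (z : vert G -> A) :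
  (forall K : comp_type (restriction Y), \sum_(v | component v == K) z v = 0) ->
  exists g, (forall e, e \notin Y -> g e = 0) /\ forall v, boundary g v = z v.
Proof.
move=> z0; pose r (v : vert G) : vert G := comp_rep (component (v : vert (restriction Y))).
have /choice[g gP] v := boundary_path (z v) (connect_comp_rep (v : vert (restriction Y))).
exists (fun e => \sum_v g v e); split=> [e eY|x].
  by rewrite big1 // => v _; have [-> //] := gP v.
rewrite boundary_sum (eq_bigr (fun v => (if x == v then z v else 0) -
    (if x == r v then z v else 0))) => [|v _]; last by have [_ ->] := gP v.
rewrite sumrB (bigD1 x) //= eqxx big1 ?addr0 => [|v /negPf xv]; last by rewrite eq_sym xv.
suff -> : \sum_v (if x == r v then z v else 0) = 0 by rewrite subr0.
apply: sum_retract => [v|w]; first by rewrite /r comp_repK.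
rewrite -[RHS](z0 (component (w : vert (restriction Y)))); apply: eq_bigl => v.
by rewrite /r (inj_eq (can_inj (@comp_repK (restriction Y)))).
Qed.

End Boundary.

Section Counts.
Variables (G : mgraph) (A : finZmodType) (eps : orient G).
Implicit Types (X Y : {set edge G}).

(** Restores to a difference of component numbers what truncated subtraction hides, using that
    deleting edges cannot reduce the number of components. *)
Lemma rk_restriction_gap X :
  (rk G - rk (restriction X) + #|comps G| = #|comps (restriction X)|)%N.
Proof.
have cle : (#|comps G| <= #|comps (restriction X)|)%N.
  have := card_locally_constant G bool; have := card_locally_constant (restriction X) bool.
  rewrite card_bool => cX cG; rewrite -(leq_exp2l (m := 2)) // -cX -cG.
  apply: subset_leq_card; apply/subsetP => h; rewrite !inE => /forallP hG.
  by apply/forallP => e; apply: hG.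
have cV : (#|comps (restriction X)| <= #|vert G|)%N.
  by apply: leq_trans (leq_imset_card _ _) _; rewrite cardsT.
rewrite /rk; change #|vert (restriction X)| with #|vert G|; lia.
Qed.

(** Tensions vanishing on [X] come from potentials constant on the components of G|X, modulo those
    constant on the components of G. *)
Lemma card_tensions X :
  #|[set f : {ffun edge G -> A} | `[< is_tension eps f >] && (X \subset zero_set f)]| =
  (#|A| ^ (rk G - rk (restriction X)))%N.
Proof.
pose S := [set h : {ffun vert G -> A} |
  [forall e : edge (restriction X), h (src e) == h (tgt e)]].
pose d (h : {ffun vert G -> A}) := [ffun e : edge G => h (etail eps e) - h (ehead eps e)].
have A0 : (0 < #|A|)%N by apply/card_gt0P; exists 0.
have dB : {morph d : x y / x - y}.
  by move=> x y; apply/ffunP => e; rewrite !ffunE sub_swap.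
have SB x y : x \in S -> y \in S -> x - y \in S.
  rewrite !inE => /forallP xS /forallP yS; apply/forallP => e.
  by rewrite !ffunE (eqP (xS e)) (eqP (yS e)).
have SE h : (h \in S) = [forall e in X, d h e == 0].
  rewrite inE; apply/forallP/forall_inP => hX e.
    move=> eX; have /eqP := hX (exist _ e eX); rewrite ffunE /etail /ehead /=.
    by case: (eps e) => ->; rewrite subrr.
  have := hX (val e) (valP e); rewrite ffunE /etail /ehead subr_eq0.
  by case: (eps _); rewrite // eq_sym.
have cS : #|S| = (#|A| ^ #|comps (restriction X)|)%N.
  by rewrite -(card_locally_constant (restriction X) A); apply: eq_card => h;
    rewrite [LHS]inE [RHS]inE.
have := card_additive SB dB; rewrite cS -(rk_restriction_gap X) expnD.
have -> : [set h in S | d h == 0] = [set h : {ffun vert G -> A} | [forall e : edge G, h (src e)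
  == h (tgt e)]].
  apply/setP => h; rewrite in_set [RHS]in_set SE; apply/andP/forallP => [[_ /eqP/ffunP h0] e|hc].
    have := h0 e; rewrite !ffunE /etail /ehead => /eqP; rewrite subr_eq0.
    by case: (eps e); rewrite // eq_sym.
  have d0 e : d h e = 0.
    apply/eqP; rewrite ffunE /etail /ehead subr_eq0.
    by case: (eps e); rewrite // eq_sym.
  by split; [apply/forall_inP => e _; rewrite d0|apply/eqP/ffunP => e; rewrite d0 ffunE].
rewrite card_locally_constant => /eqP; rewrite eqn_pmul2r ?expn_gt0 ?A0 // => /eqP ->.
apply: eq_card => f; rewrite inE; apply/andP/imsetP => [[/asboolP[h fh] /subsetP fX]|[h]].
  have fd : f = d [ffun v => h v] by apply/ffunP => e; rewrite !ffunE.
  exists [ffun v => h v] => //; rewrite SE; apply/forall_inP => e /fX.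
  by rewrite inE -fd.
rewrite SE => /forall_inP hX ->; split; last by apply/subsetP => e /hX; rewrite inE.
by apply/asboolP; exists h => e; rewrite ffunE.
Qed.

Lemma card_edge_restriction Y : #|edge (restriction Y)| = #|Y|.
Proof. by rewrite card_sig; apply: eq_card. Qed.

(** Rank-nullity for the boundary on functions supported off [X]; its image is the group of vectors
    with zero sum on every component of the restriction. *)
Lemma card_flows X :
  #|[set g : {ffun edge G -> A} | `[< is_flow eps g >] && (X \subset zero_set g)]| =
  (#|A| ^ nullity (restriction (~: X)))%N.
Proof.
pose Y := ~: X; have A0 : (0 < #|A|)%N by apply/card_gt0P; exists 0.
pose S := [set g : {ffun edge G -> A} | X \subset zero_set g].
have SE (g : {ffun edge G -> A}) : reflect (forall e, e \notin Y -> g e = 0) (g \in S).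
  rewrite inE; apply: (iffP subsetP) => [gX e|gX e eX]; last by rewrite inE gX // inE negbK.
  by rewrite inE negbK => /gX; rewrite inE => /eqP.
have SB x y : x \in S -> y \in S -> x - y \in S.
  by move=> /SE xS /SE yS; apply/SE => e eY; rewrite !ffunE xS // yS // subrr.
pose b (g : {ffun edge G -> A}) := [ffun v => boundary eps g v].
have bB : {morph b : x y / x - y}.
  move=> x y; apply/ffunP => v; rewrite !ffunE -boundaryB /boundary.
  by congr (_ - _); apply: eq_bigr => e _; rewrite !ffunE.
have cS : #|S| = (#|A| ^ #|Y|)%N.
  have := card_pffun_on (0 : A) (pred_of_set Y) (pred_of_set [set: A]).
  rewrite cardsT => <-; apply: eq_card => g.
  apply/SE/pffun_onP => [gY|[/supportP gY _]]; last first.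
    by move=> e eY; apply: gY.
  by split; [apply/supportP|move=> x _; rewrite inE].
have := card_additive SB bB; rewrite cS.
have -> : [set g in S | b g == 0] = [set g : {ffun edge G -> A} | `[< is_flow eps g >] && (X
  \subset zero_set g)].
  apply/setP => g; rewrite in_set [RHS]in_set andbC; congr (_ && _); last by rewrite inE.
  apply/eqP/asboolP => [/ffunP g0|/is_flowE g0].
    by apply/is_flowE => v; have := g0 v; rewrite !ffunE.
  by apply/ffunP => v; rewrite !ffunE g0.
have -> : b @: S = [set z : {ffun vert (restriction Y) -> A} |
      [forall K : comp_type (restriction Y), \sum_(v | component v == K) z v == 0]].
  apply/setP => z; rewrite inE; apply/imsetP/forallP => [[g /SE gY ->] K|z0].
    by apply/eqP; rewrite -[RHS](boundary_comp eps K gY); apply: eq_bigr => v _; rewrite ffunE.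
  have [g [gY bg]] := boundary_onto eps (fun K => eqP (z0 K)).
  exists (finfun g); first by apply/SE => e eY; rewrite ffunE gY.
  apply/ffunP => v; rewrite !ffunE -bg /boundary.
  by congr (_ - _); apply: eq_bigr => e _; rewrite ffunE.
move=> eq1; have eq2 := card_zero_sums (restriction Y) A.
move: eq2 eq1; set Z := (X in (X * _)%N) => eq2 eq1.
have cV : (#|comps (restriction Y)| <= #|vert G|)%N.
  by apply: leq_trans (leq_imset_card _ _) _; rewrite cardsT.
have Z0 : (0 < Z)%N.
  by have : (0 < Z * #|A| ^ #|comps (restriction Y)|)%N;
    [rewrite eq2 expn_gt0 A0|rewrite muln_gt0 => /andP[]].
have Zrk : Z = (#|A| ^ rk (restriction Y))%N.
  apply/eqP; rewrite -(eqn_pmul2r (m := #|A| ^ #|comps (restriction Y)|)%N) ?expn_gt0 ?A0 //.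
  by rewrite eq2 -expnD subnK.
apply/eqP; rewrite -(eqn_pmul2l Z0) -eq1 Zrk -expnD /nullity card_edge_restriction.
(* Over the one-element group exponents cannot be compared, but both sides are 1. Otherwise the size
   of the image bounds the rank by |Y|, so the subtraction in [nullity] is not truncated. *)
have [A1|A1] := leqP #|A| 1.
  have -> : #|A| = 1%N by apply/eqP; rewrite eqn_leq A1.
  by rewrite !exp1n.
rewrite subnKC // -(leq_exp2l _ _ A1) -Zrk eq1.
by apply: leq_pmulr; apply/card_gt0P; exists 0; rewrite inE; apply/andP; split;
  [apply/asboolP => v; rewrite !big1 // => e _; rewrite ffunE|apply/subsetP => e _;
    rewrite inE ffunE].
Qed.

End Counts.

(** * The lattices of integer tensions and flows *)

Definition reduce (p : nat) (x : int) : 'I_p.+1 := inord `|(x %% p.+1%:Z)%Z|.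

Lemma reduceK p (x : int) : ((reduce p x : nat)%:Z = x %% p.+1%:Z)%Z.
Proof.
have m0 : 0 <= (x %% p.+1%:Z)%Z by apply: modz_ge0.
have mp : (x %% p.+1%:Z)%Z < p.+1%:Z by apply: ltz_pmod.
by rewrite inordK ?gez0_abs // -ltz_nat gez0_abs.
Qed.

Lemma reduce_eq p (x y : int) : (reduce p x == reduce p y) = (x == y %[mod p.+1%:Z])%Z.
Proof. by rewrite -!reduceK eqz_nat. Qed.

Lemma reduce_nat p (i : 'I_p.+1) : reduce p (i : nat)%:Z = i.
Proof.
by apply/val_inj; have := reduceK p (i : nat)%:Z; rewrite modz_nat modn_small // => -[].
Qed.

Lemma reduceD p : {morph reduce p : x y / x + y}.
Proof.
move=> x y; apply/val_inj/eqP; rewrite -eqz_nat /= -modz_nat PoszD !reduceK.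
by rewrite modzDm.
Qed.

Lemma reduce0 p : reduce p 0 = 0.
Proof. by apply/val_inj/eqP; rewrite -eqz_nat reduceK mod0z. Qed.

Lemma reduceN p : {morph reduce p : x / - x}.
Proof.
by move=> x; apply/eqP; rewrite -addr_eq0 -reduceD addNr reduce0.
Qed.

Lemma reduceB p : {morph reduce p : x y / x - y}.
Proof. by move=> x y; rewrite reduceD reduceN. Qed.

Lemma reduce_eq0 p x : (reduce p x == 0) = (p.+1%:Z %| x)%Z.
Proof. by rewrite -(reduce0 p) reduce_eq eqz_mod_dvd subr0. Qed.

Section Lattices.
Variable G : mgraph.
Implicit Types (f g : edge G -> int) (rho : orient G) (X Y : {set edge G}).

Definition reference : orient G := [ffun=> true].
Definition tensions : (edge G -> int) -> Prop := is_tension reference.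
Definition flows : (edge G -> int) -> Prop := is_flow reference.

Lemma etail_reference e : etail reference e = src e.
Proof. by rewrite /etail ffunE. Qed.

Lemma ehead_reference e : ehead reference e = tgt e.
Proof. by rewrite /ehead ffunE. Qed.

Lemma tensionsE f : tensions f <-> exists h : vert G -> int, forall e, f e = h (src e) - h (tgt
  e).
Proof. by split=> -[h fh]; exists h => e; rewrite fh etail_reference ehead_reference. Qed.

Lemma tensions_reorient rho f : is_tension rho f <-> reorient rho tensions f.
Proof.
split=> -[h fh]; exists h => e; have := fh e;
  rewrite etail_reference ehead_reference /etail /ehead /sgn; case: (rho e);
  rewrite ?mul1r ?mulN1r //.
  by move=> ->; rewrite opprB.
by move=> fe; rewrite -opprB -fe opprK.
Qed.

Lemma boundary_reorient rho g v :
  boundary rho g v = boundary reference (fun e => sgn (rho e) * g e) v.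
Proof.
rewrite /boundary !(big_mkcond (fun e => _ == v)) /= -!sumrB; apply: eq_bigr => e _.
rewrite etail_reference ehead_reference /etail /ehead /sgn.
by case: (rho e); case: eqP => _; case: eqP => _; ring.
Qed.

Lemma flows_reorient rho g : is_flow rho g <-> reorient rho flows g.
Proof.
rewrite is_flowE /reorient /flows is_flowE.
by split=> h v; [rewrite -boundary_reorient|rewrite boundary_reorient].
Qed.

Lemma tensions_flows_orthogonal f g : tensions f -> flows g -> \sum_e f e * g e = 0.
Proof.
case/tensionsE=> h fh /is_flowE bg.
have half (x : edge G -> vert G) :
    \sum_e h (x e) * g e = \sum_v h v * \sum_(e | x e == v) g e.
  rewrite (partition_big x xpredT) //=; apply: eq_bigr => v _; rewrite mulr_sumr.
  by apply: eq_bigr => e /eqP ->.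
under eq_bigr do rewrite fh mulrBl.
rewrite sumrB !half -sumrB big1 // => v _; rewrite -mulrBr.
have := bg v; rewrite /boundary => /eqP; rewrite subr_eq0 => /eqP.
under eq_bigl do rewrite ehead_reference.
under [in RHS]eq_bigl do rewrite etail_reference.
by move=> ->; rewrite subrr mulr0.
Qed.

(** Take floors of the potential divided by p: remainders lie in [0, p), so their differences are
    smaller than p in absolute value. *)
Lemma tensions_roundable : roundable tensions.
Proof.
split.
- by apply/tensionsE; exists (fun=> 0) => e; rewrite subrr.
- move=> f g /tensionsE[h fh] /tensionsE[k gk]; apply/tensionsE.
  by exists (fun v => h v - k v) => e; rewrite fh gk sub_swap.
- move=> f p p0 /tensionsE[h fh].
  exists (fun e => (h (src e) %/ p%:Z)%Z - (h (tgt e) %/ p%:Z)%Z); split.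
    by apply/tensionsE; exists (fun v => (h v %/ p%:Z)%Z).
  move=> e; rewrite fh mulrBr sub_swap.
  have mE x : x - p%:Z * (x %/ p%:Z)%Z = (x %% p%:Z)%Z by rewrite {1}(divz_eq x p) mulrC addrC
    addKr.
  have pn0 : p%:Z != 0 by case: (p) p0.
  have m0 x : 0 <= (x %% p%:Z)%Z by apply: modz_ge0.
  have mp x : (x %% p%:Z)%Z < p%:Z by apply: ltz_pmod; rewrite ltz_nat.
  rewrite !mE; have := m0 (h (src e)); have := m0 (h (tgt e)).
  have := mp (h (src e)); have := mp (h (tgt e)); lia.
Qed.

(* If the ends of [e0] were not connected by the other edges of [F], the sum of
   the boundary of [g] over one side would be [+/- g e0] modulo [p]. *)
Lemma flow_through (F : {set edge G}) (g : edge G -> int) (p : int) e0 : flows g ->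
  e0 \in F -> (forall e, e \notin F -> (p %| g e)%Z) -> ~~ (p %| g e0)%Z ->
  exists c, [/\ flows c, c e0 = 1 & forall e, e \notin F -> c e = 0].
Proof.
move=> /is_flowE bg e0F gF ge0; pose H := restriction (F :\ e0).
have con : connect (@adj H) (tgt e0) (src e0).
  rewrite -comp_eq; apply: contraNT ge0 => ne.
  have := sum_boundary reference (fun v => component (v : vert H) == component (tgt e0 : vert
    H)) g.
  rewrite big1 => [/esym/eqP|v _]; last exact: bg.
  rewrite (bigD1 e0) //= ehead_reference etail_reference eqxx mulr1n [component (src e0 : vert
    H) == _]eq_sym (negPf ne) mulr0n subr0.
  rewrite addr_eq0 => /eqP ->; rewrite rpredN; apply: rpred_sum => e en.
  have [eF|/gF pe] := boolP (e \in F); last by rewrite rpredB // rpredMn.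
  rewrite (@comp_ends _ reference (F :\ e0)) ?subrr ?rpred0 //.
  by rewrite !inE en.
have [k [kF bk]] := @boundary_path G int reference (F :\ e0) _ _ 1 con.
exists (fun e => k e + (if e == e0 then 1 else 0)); split.
- apply/is_flowE => v; rewrite boundaryD boundary_indicator bk ehead_reference etail_reference.
  by rewrite addrC subrKA subrr.
- by rewrite eqxx kF ?setD11.
- move=> e eF; rewrite kF; last by rewrite !inE (negPf eF) andbF.
  by case: eqP => // ee; rewrite ee e0F in eF.
Qed.

(** Integrality of the flow polytope: the rational flow g / p lies between integral bounds. The
    induction is on the total width of the bounds; when no bound can be tightened, the flow is moved
    along a circulation until it touches one. *)
Lemma flow_between (g : edge G -> int) (p : int) (lo hi : edge G -> int) : 0 < p -> flows g ->
  (forall e, p * lo e <= g e <= p * hi e) ->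
  exists a, flows a /\ forall e, lo e <= a e <= hi e.
Proof.
have [n le_n] := ubnP (\sum_e `|hi e - lo e|)%N.
elim: n g p lo hi le_n => // n IHn g p lo hi le_n p0 fg gb.
have lohi e : lo e <= hi e.
  by have /andP[l h] := gb e; have := le_trans l h; rewrite ler_pM2l.
pose F := [set e | lo e < hi e].
have raise (g' : edge G -> int) p' e : 0 < p' -> flows g' ->
    (forall e, p' * lo e <= g' e <= p' * hi e) -> lo e < hi e -> p' * (lo e + 1) <= g' e ->
    exists a, flows a /\ forall e, lo e <= a e <= hi e.
  move=> p'0 fg' gb' lh lg; pose lo' x := if x == e then lo e + 1 else lo x.
  have [|x|a [fa ab]] := IHn g' p' lo' hi _ p'0 fg'.
  - rewrite (bigD1 e) //= in le_n; rewrite (bigD1 e) //= /lo' eqxx.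
    rewrite (eq_bigr (fun x => `|hi x - lo x|%N)) => [|x /negPf -> //].
    rewrite -ltnS; apply: leq_trans le_n; rewrite ltnS -addSn leq_add2r; move: lh; clear; lia.
  - rewrite /lo'; case: eqP => [->|_]; last exact: gb'.
    by rewrite lg; have /andP[] := gb' e.
  exists a; split=> // x; have := ab x; rewrite /lo'; case: eqP => [->|//].
  by move=> /andP[l h]; rewrite h andbT; apply: le_trans l; rewrite lerDl.
have lower (g' : edge G -> int) p' e : 0 < p' -> flows g' ->
    (forall e, p' * lo e <= g' e <= p' * hi e) -> lo e < hi e -> g' e <= p' * (hi e - 1) ->
    exists a, flows a /\ forall e, lo e <= a e <= hi e.
  move=> p'0 fg' gb' lh lg; pose hi' x := if x == e then hi e - 1 else hi x.
  have [|x|a [fa ab]] := IHn g' p' lo hi' _ p'0 fg'.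
  - rewrite (bigD1 e) //= in le_n; rewrite (bigD1 e) //= /hi' eqxx.
    rewrite (eq_bigr (fun x => `|hi x - lo x|%N)) => [|x /negPf -> //].
    rewrite -ltnS; apply: leq_trans le_n; rewrite ltnS -addSn leq_add2r; move: lh; clear; lia.
  - rewrite /hi'; case: eqP => [->|_]; last exact: gb'.
    by rewrite lg; have /andP[-> _] := gb' e.
  exists a; split=> // x; have := ab x; rewrite /hi'; case: eqP => [->|//].
  by move=> /andP[l h]; rewrite l /=; apply: le_trans h _; rewrite gerBl.
have [F0|/set0Pn[e0]] := eqVneq F set0.
  have lh e : lo e = hi e.
    by apply/eqP; rewrite eq_le lohi leNgt; have := in_set0 e; rewrite -F0 inE => ->.
  have gl e : g e = p * lo e by apply/eqP; rewrite eq_le andbC; have := gb e; rewrite -lh.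
  exists lo; split=> [|e]; last by rewrite lexx lohi.
  move=> v; apply: (mulfI (lt0r_neq0 p0)); rewrite !mulr_sumr.
  rewrite (eq_bigr g) => [|e _]; last by rewrite gl.
  by rewrite [RHS](eq_bigr g) => [|e _]; [exact: fg|rewrite gl].
rewrite inE => e0F.
have [[e [eF [h|h]]]|nex] := pselect (exists e, lo e < hi e /\
    (p * (lo e + 1) <= g e \/ g e <= p * (hi e - 1))); first exact: (raise g p e).
  exact: (lower g p e).
(* In the remaining case every edge with room has its value strictly between consecutive
   integers. *)
have tight e : lo e < hi e -> [/\ p * lo e < g e, g e < p * hi e & hi e = lo e + 1].
  move=> eF; have h1 : g e < p * (lo e + 1).
    by rewrite ltNge; apply/negP => h; apply: nex; exists e; split=> //; left.
  have h2 : p * (hi e - 1) < g e.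
    by rewrite ltNge; apply/negP => h; apply: nex; exists e; split=> //; right.
  have hl : hi e = lo e + 1.
    by have := lt_trans h2 h1; rewrite ltr_pM2l // => h; move: eF h; clear; lia.
  by split=> //; [rewrite hl addrK in h2|rewrite hl].
(* Off [F] the values of [g] are multiples of [p] and at [e0] they are not, which is what yields a
   circulation through [e0] inside [F]. *)
have [c [fc ce0 cF]] : exists c, [/\ flows c, c e0 = 1 & forall e, e \notin F -> c e = 0].
  apply: (@flow_through F g p) => //; first by rewrite inE.
    move=> e; rewrite inE -leNgt => hl.
    have lh : lo e = hi e by apply/eqP; rewrite eq_le lohi.
    have -> : g e = p * lo e by apply/eqP; rewrite eq_le andbC; have := gb e; rewrite -lh.
    exact: dvdz_mulr.
  have [l h hl] := tight e0 e0F; apply/negP => /dvdzP dv.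
  have [k gk] : exists k : int, g e0 = k * p := dv.
  move: l h; rewrite gk [k * p]mulrC !ltr_pM2l // hl; clear; lia.
(* Ratio test: [slack] is the room left in the direction of [c], and the minimal ratio picks the
   first edge to reach a bound. Scaling by [|c e|] keeps the moved flow integral, with the new
   denominator [p']. *)
pose slack e := if 0 < c e then p * hi e - g e else g e - p * lo e.
pose ratio e : rat := (slack e)%:~R / `|c e|%:~R.
have c0 : c e0 != 0 by rewrite ce0.
have [e ce emin] := @arg_minP _ _ _ e0 (fun e => c e != 0) ratio c0.
have eF : lo e < hi e by apply/negPn/negP => ne; move: ce; rewrite cF ?eqxx // inE.
have slackP x : c x != 0 -> slack e * `|c x| <= slack x * `|c e|.
  move=> cx; have := emin x cx; rewrite /ratio ler_pdivlMr ?ltr0z ?normr_gt0 //.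
  by rewrite mulrAC ler_pdivrMr ?ltr0z ?normr_gt0 // -!intrM ler_int.
have slack0 : 0 < slack e.
  by have [l h _] := tight e eF; rewrite /slack; case: ifP; rewrite subr_gt0.
pose g' x := `|c e| * g x + slack e * c x; pose p' := p * `|c e|.
have p'0 : 0 < p' by rewrite mulr_gt0 // normr_gt0.
have fg' : flows g'.
  apply/is_flowE => v; rewrite boundaryD.
  have bZ k h : flows h -> boundary reference (fun x => k * h x) v = 0.
    by move=> /is_flowE/(_ v); rewrite /boundary -!mulr_sumr -mulrBr => ->; rewrite mulr0.
  by rewrite !bZ ?addr0.
have g'b x : p' * lo x <= g' x <= p' * hi x.
  have /andP[l h] := gb x; have ce' : 0 < `|c e| by rewrite normr_gt0.
  have l' : p' * lo x <= `|c e| * g x by rewrite /p' mulrAC [_ * `|c e|]mulrC ler_pM2l.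
  have h' : `|c e| * g x <= p' * hi x by rewrite /p' mulrAC [_ * `|c e|]mulrC ler_pM2l.
  rewrite /g'; have [cx0|cx] := eqVneq (c x) 0; first by rewrite cx0 mulr0 addr0 l' h'.
  have := slackP x cx; rewrite /slack -/(slack e); case: (ltP 0 (c x)) => cs sl.
    apply/andP; split; first by apply: (le_trans l'); rewrite lerDl mulr_ge0 ?ltW.
    move: sl; rewrite (gtr0_norm cs) /p'; set u := `|c e|; set v := slack e; clear; lra.
  have cs' : c x < 0 by rewrite lt_neqAle cx.
  apply/andP; split; last by apply: (le_trans _ h'); rewrite gerDl mulr_ge0_le0 ?ltW.
  move: sl; rewrite (ltr0_norm cs') /p'; set u := `|c e|; set v := slack e; clear; lra.
have : g' e = p' * hi e \/ g' e = p' * lo e.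
  rewrite /g' /slack; case: (ltP 0 (c e)) => cs.
    by left; rewrite (gtr0_norm cs) /p' (gtr0_norm cs); ring.
  have cs' : c e < 0 by rewrite lt_neqAle ce.
  by right; rewrite /p' (ltr0_norm cs'); ring.
case=> g'e.
  by apply: (raise g' p' e) => //; rewrite g'e ler_pM2l // lezD1.
by apply: (lower g' p' e) => //; rewrite g'e ler_pM2l // lerBrDr lezD1.
Qed.

(** Floors and ceilings of the values divided by p serve as bounds; the ceiling is written as minus
    the floor of the opposite. *)
Lemma flows_roundable : roundable flows.
Proof.
split.
- by move=> v; rewrite !big1.
- move=> f g /is_flowE bf /is_flowE bg; apply/is_flowE => v.
  by rewrite boundaryB bf bg subrr.
- move=> g p p0 fg.
  have pn0 : p%:Z != 0 by case: (p) p0.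
  have m0 x : 0 <= (x %% p%:Z)%Z by apply: modz_ge0.
  have mp x : (x %% p%:Z)%Z < p%:Z by apply: ltz_pmod; rewrite ltz_nat.
  have dE x := divz_eq x p.
  pose lo e := (g e %/ p%:Z)%Z; pose hi e := - ((- g e) %/ p%:Z)%Z.
  have p0' : 0 < p%:Z by rewrite ltz_nat.
  have [|a [fa ab]] := @flow_between g p lo hi p0' fg.
    move=> e; rewrite /lo /hi; apply/andP; split.
      by rewrite {2}(dE (g e)) mulrC lerDl.
    by rewrite mulrN lerNr {2}(dE (- g e)) mulrC lerDl.
  exists a; split=> // e; have /andP[l h] := ab e.
  have hl : p%:Z * lo e <= p%:Z * a e by rewrite ler_pM2l.
  have hh : p%:Z * a e <= p%:Z * hi e by rewrite ler_pM2l.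
  have := mp (g e); have := mp (- g e); have := dE (g e); have := dE (- g e).
  move: hl hh; rewrite /lo /hi mulrN ![p%:Z * (_ %/ _)%Z]mulrC.
  set A := _ * _; set B := _ * _; set D := _ * _; clear; lia.
Qed.

Lemma residue_tensions p (r : {ffun edge G -> 'I_p.+1}) :
  (r \in residues tensions p) = `[< is_tension reference r >].
Proof.
rewrite inE; apply/asboolP/asboolP => [[f [/tensionsE[h fh] fr]]|[h rh]].
  exists (fun v => reduce p (h v)) => e; rewrite etail_reference ehead_reference.
  rewrite -reduceB -fh -[LHS]reduce_nat; apply/eqP; rewrite eq_sym reduce_eq eqz_mod_dvd.
  exact: fr.
pose k v : int := (h v : nat)%:Z.
exists (fun e => k (src e) - k (tgt e)); split; first by apply/tensionsE; exists k.
move=> e; rewrite -reduce_eq0 !reduceB !reduce_nat rh etail_reference ehead_reference.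
by rewrite subrr.
Qed.

(** The boundary of an integer lift of a modular flow is divisible by p+1. The quotient has zero sum
    on each component, hence is a boundary itself, and p+1 times a preimage corrects the lift. *)
Lemma residue_flows p (r : {ffun edge G -> 'I_p.+1}) :
  (r \in residues flows p) = `[< is_flow reference r >].
Proof.
have red g v : boundary reference (fun e => reduce p (g e)) v = reduce p (boundary reference g v).
  rewrite /boundary reduceB !(big_morph _ (@reduceD p) (reduce0 p)).
  by [].
rewrite inE; apply/asboolP/asboolP => [[g [/is_flowE bg gr]]|/is_flowE br].
  apply/is_flowE => v; have -> : fun_of_fin r = fun e => reduce p (g e).
    apply/funext => e; rewrite -[LHS]reduce_nat; apply/eqP.
    by rewrite eq_sym reduce_eq eqz_mod_dvd gr.
  by rewrite red bg reduce0.
pose g e : int := (r e : nat)%:Z.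
have bg v : (p.+1%:Z %| boundary reference g v)%Z.
  rewrite -reduce_eq0 -red; apply/eqP; rewrite -[RHS](br v); congr (boundary _ _ _).
  by apply/funext => e; rewrite reduce_nat.
pose z v := (boundary reference g v %/ p.+1%:Z)%Z.
have zE v : boundary reference g v = p.+1%:Z * z v by rewrite mulrC divzK.
have [|k [_ bk]] := @boundary_onto G int reference setT z.
  move=> K; apply: (@mulfI _ p.+1%:Z) => //; rewrite mulr0 mulr_sumr.
  rewrite -[RHS](@boundary_comp G int reference setT g K); last by move=> e; rewrite inE.
  by apply: eq_bigr => v _; rewrite zE.
exists (fun e => g e - p.+1%:Z * k e); split.
  apply/is_flowE => v; rewrite boundaryB zE -bk /boundary -!mulr_sumr -mulrBr.
  by rewrite subrr.
by move=> e; rewrite addrAC subrr sub0r rpredN; apply: dvdz_mulr.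
Qed.

Lemma card_residue_tensions p X :
  #|[set r in residues tensions p | X \subset zeros r]| =
  (p.+1 ^ (rk G - rk (restriction X)))%N.
Proof.
rewrite -[X in (X ^ _)%N]card_ord -(card_tensions 'I_p.+1 reference X).
by apply: eq_card => r; rewrite in_set residue_tensions [RHS]in_set.
Qed.

Lemma card_residue_flows p X :
  #|[set r in residues flows p | X \subset zeros r]| =
  (p.+1 ^ nullity (restriction (~: X)))%N.
Proof.
rewrite -[X in (X ^ _)%N]card_ord -(card_flows 'I_p.+1 reference X).
by apply: eq_card => r; rewrite in_set residue_flows [RHS]in_set.
Qed.

End Lattices.

(** * Directed circuits, directed bonds and cut-Eulerian equivalence *)

Section Orientations.
Variable G : mgraph.
Implicit Types (f g : edge G -> int) (rho sigma : orient G).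
Implicit Types (S : {set vert G}) (B C D F X : {set edge G}).

Definition indicator X : edge G -> int := fun e => (e \in X)%:R.

Definition arc_rel rho : rel (vert G) :=
  fun u v => [exists e, (etail rho e == u) && (ehead rho e == v)].

Lemma arc_edge rho e : arc_rel rho (etail rho e) (ehead rho e).
Proof. by apply/existsP; exists e; rewrite !eqxx. Qed.

(** Along the cyclic list the heads are the tails rotated by one place, so every vertex occurs
    equally often among both. *)
Lemma dcircuit_flow rho C : dcircuit rho C -> is_flow rho (indicator C).
Proof.
case/andP => _ /existsP[c /and3P[/eqP cC cyc un]] v.
have uc : uniq c := map_uniq un.
have half (x : edge G -> vert G) :
    \sum_(e | x e == v) indicator C e = (count_mem v [seq x e | e <- c])%:R.
  rewrite /indicator -natr_sum count_map -size_filter -(card_uniqP (filter_uniq _ uc)).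
  rewrite -big_mkcondr sum1_card; congr _%:R; apply: eq_card => e.
  have eC : (e \in C) = (e \in c) by move/setP/(_ e): cC; rewrite inE => <-.
  by rewrite mem_filter [LHS]unfold_in /= eC.
rewrite !half; congr _%:R; apply/permP.
suff -> : [seq ehead rho e | e <- c] = rot 1 [seq etail rho e | e <- c] by rewrite perm_rot.
case: (tval c) cyc => [//|e s] /=; rewrite rot1_cons.
have main e1 e2 : path (fun e e' => ehead rho e == etail rho e') e1 (rcons s e2) ->
    ehead rho e1 :: [seq ehead rho e | e <- s] = rcons [seq etail rho e | e <- s] (etail rho e2).
  elim: s e1 => [|e' s IHs] e1 /=; first by rewrite andbT => /eqP ->.
  by case/andP => /eqP -> /IHs ->.
exact: main.
Qed.

(** A simple directed path from the head of [e] back to its tail, closed by [e], has distinct tails.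
    In [edgeP] the edge [e] is only a default for pairs that are not arcs. *)
Lemma connect_dcircuit rho e : connect (arc_rel rho) (ehead rho e) (etail rho e) ->
  exists2 C, dcircuit rho C & e \in C.
Proof.
case/connectP => p0 p0P e_last; case/shortenP: p0P e_last => p pP un _ e_last {p0}.
have edgeP u v : exists e', arc_rel rho u v -> (etail rho e' = u) /\ (ehead rho e' = v).
  case: (boolP (arc_rel rho u v)) => [/existsP[e' /andP[/eqP <- /eqP <-]]|_]; last by exists e.
  by exists e'.
have /choice[ed edP] : forall uv : vert G * vert G, exists e', arc_rel rho uv.1 uv.2 ->
    (etail rho e' = uv.1) /\ (ehead rho e' = uv.2) by move=> uv; apply: edgeP.
pose s := pairmap (fun u v => ed (u, v)) (ehead rho e) p.
have tails : [seq etail rho e | e <- s] = belast (ehead rho e) p.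
  rewrite /s; elim: p (ehead rho e) pP {un e_last s} => //= v p IHp u /andP[uv /IHp ->].
  by have [-> _] := edP (u, v) uv.
have cyc : path (fun e e' => ehead rho e == etail rho e') e (rcons s e).
  have main e1 e2 : path (arc_rel rho) (ehead rho e1) p -> last (ehead rho e1) p = etail rho e2 ->
    path (fun e e' => ehead rho e == etail rho e') e1
      (rcons (pairmap (fun u v => ed (u, v)) (ehead rho e1) p) e2).
    elim: p e1 {pP un e_last s tails} => [|v p IHp] e1 /=; first by move=> _ ->; rewrite eqxx.
    case/andP => uv vp lp; have [t1 h1] := edP (ehead rho e1, v) uv; rewrite t1 eqxx /=.
    by rewrite /= in h1; rewrite -{2}h1; apply: IHp; rewrite h1.
  exact: main.
have ut : uniq [seq etail rho e | e <- e :: s].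
  by rewrite /= tails e_last -rcons_uniq -lastI.
exists [set e' in e :: s]; last by rewrite inE mem_head.
apply/andP; split; first by apply/set0Pn; exists e; rewrite inE mem_head.
have sz : size (e :: s) == #|[set e' in e :: s]|.
  by rewrite cardsE; apply/eqP/esym/card_uniqP/(map_uniq ut).
by apply/existsP; exists (Tuple sz); apply/and3P; split.
Qed.

Lemma Cset_positive_flow rho : exists g, [/\ is_flow rho g,
  forall e, e \in Cset rho -> 0 < g e & forall e, e \notin Cset rho -> g e = 0].
Proof.
exists (fun e => \sum_(C | dcircuit rho C) indicator C e); split.
- move=> v; rewrite exchange_big [RHS]exchange_big /=; apply: eq_bigr => C.
  by move/dcircuit_flow/(_ v).
- move=> e /bigcupP[C dC eC]; rewrite (bigD1 C) //= /indicator eC ltr_wpDr //.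
  by apply: sumr_ge0.
- move=> e eC; rewrite big1 // => C dC; rewrite /indicator; case: (boolP (e \in C)) => // eC'.
  by case/bigcupP: eC; exists C.
Qed.

Lemma flow_tension_sum rho f g : is_tension rho f -> is_flow rho g -> \sum_e f e * g e = 0.
Proof.
move=> /tensions_reorient Tf /flows_reorient Fg.
rewrite -[RHS](tensions_flows_orthogonal Tf Fg); apply: eq_bigr => e _.
by rewrite mulrACA; case: (rho e); rewrite /= ?mulrNN !mul1r.
Qed.

(* [h v] counts the vertices reachable from [v], so it decreases along arcs,
   strictly along those that lie on no directed circuit. *)
Lemma Cset_positive_tension rho : exists f, [/\ is_tension rho f,
  forall e, e \notin Cset rho -> 0 < f e & forall e, e \in Cset rho -> f e = 0].
Proof.
pose reach v := [set w | connect (arc_rel rho) v w]; pose h v : int := #|reach v|%:Z.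
exists (fun e => h (etail rho e) - h (ehead rho e)).
have sub e : reach (ehead rho e) \subset reach (etail rho e).
  apply/subsetP => w; rewrite !inE; apply: connect_trans.
  exact/connect1/arc_edge.
have T : is_tension rho (fun e => h (etail rho e) - h (ehead rho e)) by exists h.
have f0 e : 0 <= h (etail rho e) - h (ehead rho e).
  by rewrite subr_ge0 lez_nat subset_leq_card.
split=> // e eC.
  rewrite lt_neqAle f0 andbT eq_sym subr_eq0 eqz_nat; apply: contra eC => eqh.
  have /eqP eqr : reach (ehead rho e) == reach (etail rho e).
    by rewrite eqEcard sub (eqP eqh) leqnn.
  have : etail rho e \in reach (ehead rho e) by rewrite eqr inE connect0.
  by rewrite inE => /connect_dcircuit[C dC eC]; apply/bigcupP; exists C.
have [g [Fg g0 gn]] := Cset_positive_flow rho.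
have gge x : 0 <= g x by case: (boolP (x \in Cset rho)) => [/g0/ltW//|/gn ->].
have fg x : true -> 0 <= (h (etail rho x) - h (ehead rho x)) * g x.
  by move=> _; apply: mulr_ge0.
have /eqP := psumr_eq0P fg (flow_tension_sum T Fg) (isT : xpredT e).
by rewrite mulf_eq0 (gt_eqF (g0 e eC)) orbF => /eqP.
Qed.

(** This is the hypothesis [CP] of the lattice argument, in the manner of Minty: positive
    circulations exhaust the edges on directed circuits, a potential increases along all the others
    in the appropriate sense. *)
Lemma Cset_strictly_positive rho :
  strictly_positive (@tensions G) (~: Cset rho) rho /\
  strictly_positive (@flows G) (Cset rho) rho.
Proof.
split; apply/asboolP.
  have [f [Tf f0 fn]] := Cset_positive_tension rho.
  exists (fun e => sgn (rho e) * f e); split; first exact: (tensions_reorient rho f).1.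
  move=> e; rewrite sgnK inE; split; first exact: f0.
  by rewrite negbK => /fn ->; rewrite mulr0.
have [g [Fg g0 gn]] := Cset_positive_flow rho.
exists (fun e => sgn (rho e) * g e); split; first exact: (flows_reorient rho g).1.
by move=> e; rewrite sgnK; split; [apply: g0|move/gn ->; rewrite mulr0].
Qed.

Lemma cut_ends rho S e : (e \in cut S) = ((etail rho e \in S) != (ehead rho e \in S)).
Proof. by rewrite inE /etail /ehead; case: (rho e); rewrite // eq_sym. Qed.

Lemma dbond_tension rho B : dbond rho B -> is_tension rho (indicator B).
Proof.
case/andP => _ /existsP[S /andP[/eqP <- /forall_inP tS]].
exists (fun v => (v \in S)%:R) => e; rewrite /indicator.
have := tS e; rewrite (cut_ends rho).
by case: (etail rho e \in S); case: (ehead rho e \in S) => //= /(_ isT).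
Qed.

Definition dcut rho S := [forall e in cut S, etail rho e \in S].

(** A cut contained in a directed cut may have edges crossing its own shore both ways, so minimality
    among directed cuts does not at once give a bond. Combining the shore [T] with [S] produces
    directed cuts again. *)
Lemma minimal_dcut_bond rho S : cut S != set0 -> dcut rho S ->
  (forall S', cut S' != set0 -> dcut rho S' -> cut S' \subset cut S -> cut S' = cut S) ->
  dbond rho (cut S).
Proof.
move=> S0 dS minS; apply/andP; split; last first.
  by apply/existsP; exists S; rewrite eqxx.
have dSP e : (etail rho e \in S) != (ehead rho e \in S) -> etail rho e \in S.
  by rewrite -cut_ends => /(forall_inP dS).
apply/minsetP; split; first by rewrite S0; apply/existsP; exists S.
move=> B /andP[B0 /existsP[T /eqP TB]] sTS; subst B.
have sub e : (etail rho e \in T) != (ehead rho e \in T) ->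
    (etail rho e \in S) != (ehead rho e \in S).
  by rewrite -!cut_ends; apply: (subsetP sTS).
(* [T] cuts no edge inside [S] or inside its complement, so each of the four
   sets below is a directed cut contained in [cut S]. *)
have small S' : (forall e, (etail rho e \in S') != (ehead rho e \in S') ->
      ((etail rho e \in S) != (ehead rho e \in S)) /\
      ((etail rho e \in S) -> etail rho e \in S')) ->
    cut S' = set0 \/ cut S' = cut S.
  move=> S'P; have [->|S'0] := eqVneq (cut S') set0; [by left|right].
  apply: minS => //.
    by apply/forall_inP => e; rewrite (cut_ends rho) => /S'P[eS]; apply; apply: dSP.
  by apply/subsetP => e; rewrite !(cut_ends rho) => /S'P[].
have case1 : cut (S :&: T) = set0 \/ cut (S :&: T) = cut S.
  apply: small => e; rewrite !inE; have := dSP e; have := sub e.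
  by case: (etail rho e \in S); case: (ehead rho e \in S); case: (etail rho e \in T);
    case: (ehead rho e \in T) => //= h1 h2 _; try (by have := h1 isT); try (by have := h2 isT).
have case2 : cut (S :\: T) = set0 \/ cut (S :\: T) = cut S.
  apply: small => e; rewrite !inE; have := dSP e; have := sub e.
  by case: (etail rho e \in S); case: (ehead rho e \in S); case: (etail rho e \in T);
    case: (ehead rho e \in T) => //= h1 h2 _; try (by have := h1 isT); try (by have := h2 isT).
have case3 : cut (S :|: T) = set0 \/ cut (S :|: T) = cut S.
  apply: small => e; rewrite !inE; have := dSP e; have := sub e.
  by case: (etail rho e \in S); case: (ehead rho e \in S); case: (etail rho e \in T);
    case: (ehead rho e \in T) => //= h1 h2 _; try (by have := h1 isT); try (by have := h2 isT).
have case4 : cut (S :|: ~: T) = set0 \/ cut (S :|: ~: T) = cut S.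
  apply: small => e; rewrite !inE; have := dSP e; have := sub e.
  by case: (etail rho e \in S); case: (ehead rho e \in S); case: (etail rho e \in T);
    case: (ehead rho e \in T) => //= h1 h2 _; try (by have := h1 isT); try (by have := h2 isT).
case/set0Pn: B0 => e0 e0T.
have full S' : cut S' = set0 \/ cut S' = cut S -> e0 \in cut S' ->
    forall e, e \in cut S -> e \in cut S'.
  by case=> [->|-> //]; rewrite inE.
have := e0T; rewrite (cut_ends rho) => e0T'; have e0S := sub e0 e0T'; have t0S := dSP e0 e0S.
have h0S : ehead rho e0 \notin S by move: e0S; rewrite t0S; case: (_ \in S).
apply/eqP; rewrite eqEsubset sTS; apply/subsetP => e eS; rewrite (cut_ends rho).
have := eS; rewrite (cut_ends rho) => eS'; have tS := dSP e eS'.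
have hS : ehead rho e \notin S by move: eS'; rewrite tS; case: (_ \in S).
(* According to the side of [e0] in [T], two of the four auxiliary cuts contain [e0], hence all of
   [cut S]; together they force every edge of [cut S] to cross [T] the same way as [e0]. *)
have [t0T|t0T] := boolP (etail rho e0 \in T).
  have h0T : ehead rho e0 \notin T by move: e0T'; rewrite t0T; case: (_ \in T).
  have m1 : e \in cut (S :&: T).
    by apply: full => //; rewrite (cut_ends rho) !inE t0S t0T (negPf h0S).
  have m3 : e \in cut (S :|: T).
    by apply: full => //; rewrite (cut_ends rho) !inE t0S (negPf h0S) (negPf h0T).
  move: m1 m3; rewrite !(cut_ends rho) !inE tS (negPf hS) /=.
  by case: (etail rho e \in T) => //; case: (ehead rho e \in T).
have h0T : ehead rho e0 \in T by move: e0T'; rewrite (negPf t0T); case: (_ \in T).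
have m2 : e \in cut (S :\: T).
  by apply: full => //; rewrite (cut_ends rho) !inE t0S t0T (negPf h0S) andbF.
have m4 : e \in cut (S :|: ~: T).
  by apply: full => //; rewrite (cut_ends rho) !inE t0S h0T (negPf h0S).
move: m2 m4; rewrite !(cut_ends rho) !inE tS (negPf hS) /= andbF andbT.
by case: (etail rho e \in T) => //; case: (ehead rho e \in T).
Qed.

(** An upper level set of the potential at the tail of [e0] bounds a directed cut of positive edges;
    a minimal one of that kind is a bond. *)
Lemma positive_tension_dbond rho f : is_tension rho f -> (forall e, 0 <= f e) ->
  forall e0, 0 < f e0 -> exists B, dbond rho B /\ forall e, e \in B -> 0 < f e.
Proof.
case=> h fh f0 e0 fe0.
pose P B := [&& B != set0, [exists S, (cut S == B) && dcut rho S] & [forall e in B, 0 < f e]].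
pose S0 := [set v | h (etail rho e0) <= h v].
have S0P : P (cut S0).
  have cS e : e \in cut S0 -> etail rho e \in S0 /\ 0 < f e.
    rewrite (cut_ends rho) !inE; have := f0 e; rewrite fh subr_ge0 subr_gt0.
    move=> ba; case: (leP (h (etail rho e0)) (h (etail rho e))) => ca;
      case: (leP (h (etail rho e0)) (h (ehead rho e))) => cb //= _; split=> //.
    - exact: lt_le_trans cb ca.
    - by have := lt_le_trans ca (le_trans cb ba); rewrite ltxx.
    - by have := lt_le_trans ca (le_trans cb ba); rewrite ltxx.
  apply/and3P; split.
  - apply/set0Pn; exists e0; rewrite (cut_ends rho) !inE lexx.
    by rewrite leNgt -subr_gt0 -fh fe0.
  - by apply/existsP; exists S0; rewrite eqxx; apply/forall_inP => e /cS[].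
  - by apply/forall_inP => e /cS[].
have [B /minsetP[/and3P[B0 /existsP[S /andP[/eqP SB dS]] /forall_inP Bf] minB] _] :=
  minset_exists S0P.
exists B; split=> //; rewrite -SB; apply: minimal_dcut_bond; rewrite ?SB //.
move=> S' S'0 dS' sS'; apply: minB => //; apply/and3P; split=> //.
  by apply/existsP; exists S'; rewrite eqxx.
by apply/forall_inP => e /(subsetP sS')/Bf.
Qed.

(** Indicators of directed bonds are tensions and add up over a partition. Conversely, directed
    bonds are peeled off one by one, the remaining indicator staying a tension. *)
Lemma loc_dcutE rho D : loc_dcut rho D <-> is_tension rho (indicator D).
Proof.
split=> [/andP[_ /existsP[P /andP[PD /forall_inP dP]]]|].
  have -> : indicator D = fun e => \sum_(B in P) indicator B e.
    apply/funext => e; rewrite /indicator -natr_sum; congr _%:R.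
    rewrite -(cover_partition PD); case/and3P: PD => _ triv _.
    case: (boolP (e \in cover P)) => [eP|eP].
      have bP := pblock_mem eP;
        rewrite (bigD1 (pblock P e)) //= mem_pblock eP big1 // => B /andP[BP nB].
      case: (boolP (e \in B)) => // eB; case/negP: nB.
      by rewrite (def_pblock triv BP eB).
    rewrite big1 // => B BP; case: (boolP (e \in B)) => // eB; case/negP: eP.
    by apply/bigcupP; exists B.
  have /choice[h hP] : forall B, exists h : vert G -> int, B \in P ->
      forall e, indicator B e = h (etail rho e) - h (ehead rho e).
    move=> B; case: (boolP (B \in P)) => [/dP/dbond_tension[h hB]|_]; last by exists (fun=> 0).
    by exists h.
  exists (fun v => \sum_(B in P) h B v) => e; rewrite -sumrB.
  by apply: eq_bigr => B BP; rewrite hP.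
move=> T; apply/andP; split.
  (* The edges of [D] are those along which the potential drops by 1, all others have drop 0: its
     parity is a shore of the cut. *)
  case: T => h Th; apply/existsP; exists [set v | odd `|h v|%N]; apply/eqP/setP => e.
  rewrite (cut_ends rho) !inE; have := Th e; rewrite /indicator.
  by case: (e \in D) => /=; case: (h _) => n; case: (h _) => m /=; rewrite ?NegzE; lia.
have [n le_n] := ubnP #|D|; elim: n D T le_n => // n IHn D T le_n.
have [->|/set0Pn[e0 e0D]] := eqVneq D set0.
  apply/existsP; exists set0; apply/andP; split; last by apply/forall_inP => B; rewrite inE.
  by rewrite partition_set0.
have i0 e : 0 <= indicator D e by rewrite /indicator.
have [|B [dB BD]] := positive_tension_dbond T i0 (e0 := e0); first by rewrite /indicator e0D.
have sBD : B \subset D.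
  by apply/subsetP => e /BD; rewrite /indicator; case: (e \in D).
have B0 : B != set0 by case/andP: dB => /minsetp/andP[].
have TB : is_tension rho (indicator (D :\: B)).
  case: T => h Th; have [k Bk] := dbond_tension dB; exists (fun v => h v - k v) => e.
  rewrite -sub_swap -Th -Bk /indicator inE; have := subsetP sBD e.
  by case: (e \in B) => [/(_ isT) ->|_]; rewrite /= ?subrr ?subr0.
have ltB : (#|D :\: B| < n)%N.
  rewrite -ltnS; apply: leq_trans le_n; rewrite ltnS; apply/proper_card/properP.
  split; first exact: subsetDl.
  by case/set0Pn: B0 => e eB; exists e; rewrite ?(subsetP sBD) // inE eB.
have /existsP[P /andP[PD /forall_inP dP]] := IHn _ TB ltB.
apply/existsP; exists (B |: P); apply/andP; split; last first.
  by apply/forall_inP => B'; rewrite !inE => /orP[/eqP ->|/dP].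
have cP := cover_partition PD; case/and3P: PD => _ triv nP.
have disj B' : B' \in P -> [disjoint B & B'].
  move=> BP; rewrite -setI_eq0; apply/eqP/setP => e; rewrite !inE.
  apply/andP => -[eB eB']; have : e \in cover P by apply/bigcupP; exists B'.
  by rewrite cP inE eB.
have BP : B \notin P.
  apply/negP => BP; case/set0Pn: B0 => e eB; have := disj B BP.
  by rewrite -setI_eq0 setIid => /eqP B0; rewrite B0 inE in eB.
apply/and3P; split.
- rewrite /cover big_setU1 //= -/(cover P) cP; apply/eqP/setP => e; rewrite !inE.
  by case: (boolP (e \in B)) => [/(subsetP sBD) ->|].
- by have [] := trivIsetU1 disj triv nP.
- by rewrite !inE negb_or eq_sym B0 nP.
Qed.

Lemma deulerianE rho F : deulerian rho F <-> is_flow rho (indicator F).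
Proof.
have half (x : edge G -> vert G) v :
    \sum_(e | x e == v) indicator F e = #|[set e in F | x e == v]|%:R.
  rewrite /indicator -sum1_card natr_sum [LHS]big_mkcond [RHS]big_mkcond /=.
  by apply: eq_bigr => e _; rewrite inE; case: (e \in F); case: (x e == v).
split=> [/forallP h v|h].
  by rewrite !half (eqP (h v)).
by apply/forallP => v; have := h v; rewrite !half => /eqP; rewrite eqr_nat.
Qed.

(** In the converse direction [flip_split] makes the two flip vectors signed indicators of disjoint
    edge sets, which are the required cut and Eulerian subgraph. *)
Lemma cut_eulerianE rho sigma :
  cut_eulerian rho sigma = flip_equiv (@tensions G) (@flows G) rho sigma.
Proof.
apply/existsP/asboolP => [[D /existsP[F /and4P[/eqP/setP DF dis /loc_dcutE TD /deulerianE FF]]]|].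
  exists (fun e => sgn (rho e) * indicator D e), (fun e => sgn (rho e) * indicator F e).
  split; [exact: (tensions_reorient rho _).1|exact: (flows_reorient rho _).1|move=> e].
  have := DF e; rewrite /indicator !inE.
  case: (boolP (e \in D)) => [eD|_] /=.
    by rewrite (disjointFr dis eD) => /esym/negPf ->; rewrite mulr0 mulr1 addr0.
  by case: (e \in F); case: (rho e == sigma e) => //= _; rewrite ?mulr0 ?mulr1 ?add0r.
case=> a [b [Ta Fb ab]]; have aux := flip_split (@tensions_flows_orthogonal G) Ta Fb ab.
have sn0 e : (sgn (rho e) == 0) = false by case: (rho e).
have ss e : sgn (rho e) * sgn (rho e) = 1 by case: (rho e).
have aE : indicator [set e | a e != 0] = fun e => sgn (rho e) * a e.
  apply/funext => e; rewrite /indicator inE; have := aux e.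
  by case: ifP => _; [|case]; case=> -> _; rewrite ?eqxx ?sn0 /= ?mulr0 ?ss.
have bE : indicator [set e | b e != 0] = fun e => sgn (rho e) * b e.
  apply/funext => e; rewrite /indicator inE; have := aux e.
  by case: ifP => _; [|case]; case=> _ ->; rewrite ?eqxx ?sn0 /= ?mulr0 ?ss.
have reK (f : edge G -> int) : (fun e => sgn (rho e) * (sgn (rho e) * f e)) = f.
  by apply/funext => e; rewrite sgnK.
exists [set e | a e != 0]; apply/existsP; exists [set e | b e != 0]; apply/and4P; split.
- apply/eqP/setP => e; rewrite !inE; have := aux e.
  by case: ifP => _; [|case]; case=> -> ->; rewrite ?eqxx ?sn0.
- rewrite -setI_eq0; apply/eqP/setP => e; rewrite !inE; have := aux e.
  by case: ifP => _; [|case]; case=> -> ->; rewrite ?eqxx ?sn0.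
- by apply/loc_dcutE/tensions_reorient; rewrite aE /reorient reK.
- by apply/deulerianE/flows_reorient; rewrite bE /reorient reK.
Qed.

Lemma acyclicE rho : (rho \in acyclic G) = (Cset rho == set0).
Proof.
rewrite inE; apply/forallP/eqP => [ac|C0 C].
  by apply/setP => e; rewrite inE; apply/bigcupP => -[C dC]; have := ac C; rewrite dC.
apply/negP => dC; case/andP: (dC) => /set0Pn[e eC] _.
by have := in_set0 e; rewrite -C0; case/bigcupP; exists C.
Qed.

(** An edge on no directed circuit carries a positive tension and so yields a directed bond;
    conversely a strictly positive flow cannot be orthogonal to the indicator of a directed bond. *)
Lemma totally_cyclicE rho : (rho \in totally_cyclic G) = (Cset rho == setT).
Proof.
rewrite inE; apply/forallP/eqP => [tc|CT B].
  apply/setP => e; rewrite inE; apply/negPn/negP => eC.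
  have [f [Tf f0 fn]] := Cset_positive_tension rho.
  have fge x : 0 <= f x by case: (boolP (x \in Cset rho)) => [/fn ->|/f0/ltW].
  have [B [dB _]] := positive_tension_dbond Tf fge (f0 e eC).
  by have := tc B; rewrite dB.
apply/negP => dB; case/andP: (dB) => /minsetp/andP[/set0Pn[e eB] _] _.
have [g [Fg g0 gn]] := Cset_positive_flow rho.
have gp x : 0 < g x by apply: g0; rewrite CT inE.
have ig x : true -> 0 <= indicator B x * g x by move=> _; apply: mulr_ge0;
  [rewrite /indicator|apply: ltW].
have /eqP := psumr_eq0P ig (flow_tension_sum (dbond_tension dB) Fg) (isT : xpredT e).
by rewrite mulf_eq0 /indicator eB (gt_eqF (gp e)).
Qed.

Definition ce_class rho : {set orient G} := [set sigma in [set: orient G] | cut_eulerian rho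
  sigma].

Lemma Cset_ce rho sigma : cut_eulerian rho sigma -> Cset rho = Cset sigma.
Proof.
rewrite cut_eulerianE; apply: flip_equiv_C.
- exact: tensions_roundable.
- exact: flows_roundable.
- exact: tensions_flows_orthogonal.
- exact: Cset_strictly_positive.
Qed.

Lemma ce_refl rho : cut_eulerian rho rho.
Proof.
by rewrite cut_eulerianE; apply: flip_equiv_refl;
  [exact: tensions_roundable|exact: flows_roundable].
Qed.

Lemma ce_sym rho sigma : cut_eulerian rho sigma -> cut_eulerian sigma rho.
Proof.
by rewrite !cut_eulerianE; apply: flip_equiv_sym;
  [exact: tensions_roundable|exact: flows_roundable].
Qed.

Lemma ce_trans rho sigma pi : cut_eulerian rho sigma -> cut_eulerian sigma pi -> cut_eulerian
  rho pi.
Proof.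
by rewrite !cut_eulerianE; apply: flip_equiv_trans;
  [exact: tensions_roundable|exact: flows_roundable].
Qed.

(** Stated for a subfamily of classes, so that it serves all classes as well as the acyclic or
    totally cyclic ones. *)
Lemma reps_spec (K : {set {set orient G}}) (R : {set orient G}) :
  K \subset ce_classes G -> reps K R ->
  [/\ {in R &, forall s t, flip_equiv (@tensions G) (@flows G) s t -> s = t},
      forall s, ce_class s \in K -> exists2 t, t \in R & flip_equiv (@tensions G) (@flows G) t s
    & forall s, s \in R -> ce_class s \in K].
Proof.
move=> /subsetP KC /and3P[_ /subsetP RK /forall_inP R1].
have RKP s : s \in R -> ce_class s \in K.
  move=> /RK/bigcupP[B BK sB]; have /imsetP[x _ Bx] := KC B BK.
  have xs : cut_eulerian x s by move: sB; rewrite Bx !inE.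
  suff -> : ce_class s = B by [].
  rewrite Bx; apply/setP => y; rewrite !inE; apply/idP/idP; first exact: ce_trans.
  by apply: ce_trans; apply: ce_sym.
split=> // [s t sR tR|s sK].
  rewrite -cut_eulerianE => st; have /cards1P[z zE] := R1 _ (RKP s sR).
  have : s \in [set z] by rewrite -zE !inE sR ce_refl.
  have : t \in [set z] by rewrite -zE !inE tR st.
  by rewrite !inE => /eqP -> /eqP ->.
have /cards1P[z zE] := R1 _ sK.
have : z \in R :&: ce_class s by rewrite zE inE.
rewrite !inE => /and3P[zR _ sz]; exists z => //.
by rewrite -cut_eulerianE; apply: ce_sym.
Qed.

Lemma ce_class_ce s : ce_class s \in ce_classes G.
Proof. by apply: imset_f; rewrite inE. Qed.

(** Since [Cset] is constant on classes, one acyclic member makes the whole class acyclic. *)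
Lemma ce_class_ac s : (ce_class s \in ac_classes G) = (Cset s == set0).
Proof.
rewrite inE ce_class_ce -acyclicE; apply/subsetP/idP => [-> //|]; first by rewrite !inE ce_refl.
rewrite acyclicE => /eqP C0 t; rewrite !inE -/(acyclic G) => /Cset_ce.
by rewrite C0 => Ct; have := acyclicE t; rewrite -Ct eqxx inE.
Qed.

Lemma ce_class_tc s : (ce_class s \in tc_classes G) = (Cset s == setT).
Proof.
rewrite inE ce_class_ce -totally_cyclicE; apply/subsetP/idP => [-> //|];
  first by rewrite !inE ce_refl.
rewrite totally_cyclicE => /eqP C0 t; rewrite !inE => /Cset_ce.
by rewrite C0 => Ct; have := totally_cyclicE t; rewrite -Ct eqxx inE.
Qed.

End Orientations.

(** * Ranks of minors *)

Lemma sum_sig_sets (V : nmodType) (E : finType) (P : pred E) (F : {set E} -> V) :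
  \sum_(Y : {set {e : E | P e}}) F [set val e | e in Y] =
  \sum_(Y : {set E} | Y \subset [set e | P e]) F Y.
Proof.
symmetry; rewrite (reindex_onto (fun Y : {set {e : E | P e}} => [set val e | e in Y])
  (fun Y => [set e | val e \in Y])) /=.
  apply: eq_bigl => Y; apply/andP; split.
    by apply/subsetP => _ /imsetP[e _ ->]; rewrite inE (valP e).
  by apply/eqP/setP => e; rewrite inE mem_imset //; exact: val_inj.
move=> Y /subsetP sY; apply/setP => e; apply/imsetP/idP => [[x]|eY].
  by rewrite inE => xY ->.
have Pe : P e by have := sY e eY; rewrite inE.
by exists (exist _ e Pe) => //; rewrite inE.
Qed.

Lemma vert_restriction (G : mgraph) (X : {set edge G}) : #|vert (restriction X)| = #|vert G|.
Proof. by []. Qed.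

Lemma comps_le (H : mgraph) : (#|comps H| <= #|vert H|)%N.
Proof. by apply: leq_trans (leq_imset_card _ _) _; rewrite cardsT. Qed.

(** The rank is the dimension of the space of tensions modulo 2, a subspace of the functions on the
    edges. *)
Lemma rk_le_edges (H : mgraph) : (rk H <= #|edge H|)%N.
Proof.
pose d (h : {ffun vert H -> 'I_2}) : {ffun edge H -> 'I_2} := [ffun e => h (src e) - h (tgt e)].
have dB : {morph d : x y / x - y} by move=> x y; apply/ffunP => e; rewrite !ffunE sub_swap.
have := card_additive (fun x y (_ : x \in setT) (_ : y \in setT) => in_setT (x - y)) dB.
have -> : #|[set h in setT | d h == 0]| = (2 ^ #|comps H|)%N.
  rewrite -[X in (X ^ _)%N](card_ord 2) -(card_locally_constant H 'I_2).
  apply: eq_card => h; rewrite !inE; apply/eqP/forallP => [/ffunP h0 e|hc].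
    by have := h0 e; rewrite !ffunE => /eqP; rewrite subr_eq0.
  by apply/ffunP => e; rewrite !ffunE (eqP (hc e)) subrr.
rewrite cardsT card_ffun card_ord => e2.
have le2 : (#|d @: setT| <= 2 ^ #|edge H|)%N.
  by have := max_card (mem (d @: setT)); rewrite card_ffun card_ord.
rewrite /rk leq_subLR -(leq_exp2l (m := 2)) // e2 addnC expnD.
by rewrite leq_pmul2r ?expn_gt0.
Qed.

Section Minors.
Variable G : mgraph.
Implicit Types (X Y Z U : {set edge G}).

Definition rkS X : nat := rk (restriction X).
Definition nulS X : nat := nullity (restriction X).

Lemma comps_restrictionS X U : X \subset U -> (#|comps (restriction U)| <= #|comps (restriction
  X)|)%N.
Proof.
move=> /subsetP sXU; rewrite -(leq_exp2l (m := 2)) // -card_bool -!card_locally_constant.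
apply: subset_leq_card; apply/subsetP => h; rewrite !inE => /forallP hU.
by apply/forallP => e; apply: (hU (exist _ (val e) (sXU _ (valP e)))).
Qed.

Lemma rkS_mono X U : X \subset U -> (rkS X <= rkS U)%N.
Proof. by move=> /comps_restrictionS; rewrite /rkS /rk !vert_restriction; lia. Qed.

Lemma rkS_le_rk X : (rkS X <= rk G)%N.
Proof.
have := rk_restriction_gap X; have := comps_le G; have := comps_le (restriction X).
by rewrite /rkS /rk vert_restriction; lia.
Qed.

Lemma rkS_le_card X : (rkS X <= #|X|)%N.
Proof. by have := rk_le_edges (restriction X); rewrite card_edge_restriction. Qed.

Lemma nulSE X : nulS X = (#|X| - rkS X)%N.
Proof. by rewrite /nulS /nullity card_edge_restriction. Qed.

Lemma rkS_T : rkS setT = rk G.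
Proof.
apply/eqP; rewrite eqn_leq rkS_le_rk /=.
have : (#|comps (restriction [set: edge G])| <= #|comps G|)%N.
  rewrite -(leq_exp2l (m := 2)) // -card_bool -!card_locally_constant.
  apply: subset_leq_card; apply/subsetP => h; rewrite !inE => /forallP hU.
  by apply/forallP => e; apply: (hU (exist _ e (in_setT e))).
by rewrite /rkS /rk vert_restriction; lia.
Qed.

Lemma rk_restriction_restriction X (Z : {set edge (restriction X)}) :
  rk (restriction Z) = rkS [set val e | e in Z].
Proof.
suff eqc : #|comps (restriction Z)| = #|comps (restriction [set val e | e in Z])|.
  by rewrite /rkS /rk !vert_restriction eqc.
apply: (@expnI 2) => //; rewrite -card_bool -!card_locally_constant.
apply: eq_card => h; rewrite [LHS]inE [RHS]inE; apply/forallP/forallP => hc e.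
  by case: e => e eZ; case/imsetP: (eZ) => x xZ ex; have := hc (exist _ x xZ); rewrite /= -ex.
exact: (hc (exist _ (val (val e)) (imset_f val (valP e)))).
Qed.


Lemma contract_vertE X (v : vert (restriction X)) : contract_vert v = component v.
Proof. exact: val_inj. Qed.

(** Pulling back along the contraction identifies the locally constant functions of (G/X)|Y with
    those of the restriction of G to the union of [X] and [Y]. *)
Lemma comps_contraction_restriction X (Y : {set edge (contraction X)}) :
  #|comps (restriction Y)| = #|comps (restriction (X :|: [set val e | e in Y]))|.
Proof.
set U := X :|: _; apply: (@expnI 2) => //; rewrite -card_bool -!card_locally_constant.
pose phi (k : {ffun vert (contraction X) -> bool}) : {ffun vert G -> bool} :=
  [ffun v : vert G => k (contract_vert (v : vert (restriction X)))].
have phi_inj : injective phi.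
  move=> k l kl; apply/ffunP => K;
    have := congr1 (fun h : {ffun vert G -> bool} => h (comp_rep K)) kl.
  by rewrite !ffunE contract_vertE comp_repK.
rewrite -(card_imset _ phi_inj); apply: eq_card => h; rewrite [RHS]inE.
apply/imsetP/forallP => [[k + ->] e|hc].
  rewrite inE => /forallP kc; rewrite !ffunE.
  case: e => e eU /=; have := eU; rewrite inE => /orP[eX|/imsetP[x xY ex]].
    by rewrite !contract_vertE; have := comp_edge (exist _ e eX : edge (restriction X)) => /= ->.
  by have := kc (exist _ x xY); rewrite /= ex.
have hX (v : vert G) : h (comp_rep (component (v : vert (restriction X)))) = h v.
  apply: (@connect_adj_ind (restriction X) (fun x => h (comp_rep (component (v : vert
    (restriction X)))) = h x)
    _ _ _ _ (connect_comp_rep (v : vert (restriction X)))) => // e.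
  have eU : val e \in U by rewrite inE (valP e).
  by have /eqP /= -> := hc (exist _ (val e) eU).
pose k := [ffun K : comp_type (restriction X) => h (comp_rep K)].
have kE (v : vert G) : k (contract_vert (v : vert (restriction X))) = h v.
  by rewrite ffunE contract_vertE hX.
exists k; last by apply/ffunP => v; rewrite ffunE kE.
rewrite inE; apply/forallP => e.
have eU : val (val e) \in U by rewrite inE imset_f ?orbT // (valP e).
have hE : h (src (val (val e))) == h (tgt (val (val e))) := hc (exist _ (val (val e)) eU).
rewrite -(kE (src (val (val e)))) -(kE (tgt (val (val e)))) in hE; exact: hE.
Qed.

Lemma card_vert_contraction X : #|vert (contraction X)| = #|comps (restriction X)|.
Proof. exact: (card_comp_type (restriction X)). Qed.

Lemma rk_contraction_restriction X (Y : {set edge (contraction X)}) :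
  rk (restriction Y) = (rkS (X :|: [set val e | e in Y]) - rkS X)%N.
Proof.
have le1 := comps_le (restriction X); rewrite vert_restriction in le1.
have := comps_restrictionS (subsetUl X [set val e | e in Y]).
rewrite /rk vert_restriction comps_contraction_restriction card_vert_contraction.
by rewrite /rkS /rk !vert_restriction; lia.
Qed.


End Minors.

Lemma rkS_restriction (G : mgraph) (X : {set edge G}) (Z : {set edge (restriction X)}) :
  rkS Z = rkS [set val e | e in Z].
Proof. exact: rk_restriction_restriction. Qed.

Lemma rkS_contraction (G : mgraph) (X : {set edge G}) (Y : {set edge (contraction X)}) :
  rkS Y = (rkS (X :|: [set val e | e in Y]) - rkS X)%N.
Proof. exact: rk_contraction_restriction. Qed.


(** * Subset expansions of the four univariate polynomials, and their values on minors *)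

Section Polynomials.
Implicit Types G H : mgraph.

(** Whitney expansions: the first two are the chromatic polynomial without its factor x^c and the
    flow polynomial; the last two are R(x,-1) and R(-1,y) for the rank generating polynomial R. *)
Definition tau_poly H : {poly rat} :=
  \sum_(X : {set edge H}) (-1) ^+ #|X| *: 'X^(rk H - rkS X).
Definition phi_poly H : {poly rat} :=
  \sum_(X : {set edge H}) (-1) ^+ #|~: X| *: 'X^(nulS X).
Definition taub_poly H : {poly rat} :=
  \sum_(X : {set edge H}) (-1) ^+ nulS X *: 'X^(rk H - rkS X).
Definition phib_poly H : {poly rat} :=
  \sum_(X : {set edge H}) (-1) ^+ (rk H - rkS X) *: 'X^(nulS X).

Lemma rk_contraction G (X : {set edge G}) : rk (contraction X) = (rk G - rkS X)%N.
Proof.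
rewrite -(rkS_T (contraction X)) /rkS rk_contraction_restriction; congr (_ - _)%N.
rewrite -rkS_T; congr rkS; apply/setP => e; rewrite !inE.
case: (boolP (e \in X)) => //= eX; apply/imsetP.
by exists (exist _ e eX); rewrite ?inE.
Qed.

Lemma signr_parity (n m : nat) : odd n = odd m -> (-1) ^+ n = (-1) ^+ m :> rat.
Proof. by move=> nm; rewrite -signr_odd nm signr_odd. Qed.

Lemma tau_contraction G (X : {set edge G}) :
  tau_poly (contraction X) = \sum_(Y : {set edge G} | Y \subset ~: X)
    (-1) ^+ #|Y| *: 'X^(rk G - rkS (X :|: Y)).
Proof.
transitivity (\sum_(Y : {set edge (contraction X)})
   (-1) ^+ #|[set val e | e in Y]| *: 'X^(rk G - rkS (X :|: [set val e | e in Y])) : {poly rat}).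
  apply: eq_bigr => Y _; rewrite card_imset; last exact: val_inj.
  rewrite rk_contraction rkS_contraction; congr (_ *: 'X^_).
  by have := rkS_mono (subsetUl X [set val e | e in Y]); lia.
rewrite (sum_sig_sets _ (fun Y : {set edge G} => (-1) ^+ #|Y| *: 'X^(rk G - rkS (X :|: Y)))).
by apply: eq_bigl => Y; congr (_ \subset _); apply/setP => e; rewrite !inE.
Qed.

Lemma taub_contraction G (X : {set edge G}) :
  taub_poly (contraction X) = \sum_(Y : {set edge G} | Y \subset ~: X)
    (-1) ^+ (#|Y| + rkS X + rkS (X :|: Y)) *: 'X^(rk G - rkS (X :|: Y)).
Proof.
transitivity (\sum_(Y : {set edge (contraction X)})
   (-1) ^+ (#|[set val e | e in Y]| + rkS X + rkS (X :|: [set val e | e in Y]))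
     *: 'X^(rk G - rkS (X :|: [set val e | e in Y])) : {poly rat}).
  apply: eq_bigr => Y _; rewrite card_imset; last exact: val_inj.
  have lem := rkS_mono (subsetUl X [set val e | e in Y]).
  have lec := rkS_le_card Y; move: lec; rewrite nulSE rkS_contraction => lec.
  rewrite rk_contraction; congr (_ *: 'X^_).
    by apply: signr_parity; rewrite oddB // oddB // !oddD -addbA [odd (rkS X) (+) _]addbC.
  by lia.
rewrite (sum_sig_sets _ (fun Y : {set edge G} => (-1) ^+ (#|Y| + rkS X + rkS (X :|: Y)) *:
  'X^(rk G - rkS (X :|: Y)))).
by apply: eq_bigl => Y; congr (_ \subset _); apply/setP => e; rewrite !inE.
Qed.

Lemma phi_restriction G (X : {set edge G}) :
  phi_poly (restriction X) = \sum_(Z : {set edge G} | Z \subset X)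
    (-1) ^+ (#|X| + #|Z|) *: 'X^(nulS Z).
Proof.
transitivity (\sum_(Z : {set edge (restriction X)})
   (-1) ^+ (#|X| + #|[set val e | e in Z]|) *: 'X^(nulS [set val e | e in Z]) : {poly rat}).
  apply: eq_bigr => Z _; rewrite !nulSE card_imset; last exact: val_inj.
  rewrite rkS_restriction; congr (_ *: _); apply: signr_parity.
  have eZ := cardsC Z; rewrite (card_edge_restriction X) in eZ.
  by rewrite -eZ !oddD; case: (odd #|Z|); case: (odd _).
rewrite (sum_sig_sets _ (fun Z : {set edge G} => (-1) ^+ (#|X| + #|Z|) *: 'X^(nulS Z))).
by apply: eq_bigl => Y; rewrite (_ : [set e in X] = X) //; apply/setP => e; rewrite inE.
Qed.

Lemma phib_restriction G (X : {set edge G}) :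
  phib_poly (restriction X) = \sum_(Z : {set edge G} | Z \subset X)
    (-1) ^+ (rkS X + rkS Z) *: 'X^(nulS Z).
Proof.
transitivity (\sum_(Z : {set edge (restriction X)})
   (-1) ^+ (rkS X + rkS [set val e | e in Z]) *: 'X^(nulS [set val e | e in Z]) : {poly rat}).
  apply: eq_bigr => Z _; rewrite !nulSE card_imset; last exact: val_inj.
  rewrite rkS_restriction; congr (_ *: _); apply: signr_parity.
  have : (rkS [set val e | e in Z] <= rkS X)%N.
    apply: rkS_mono; apply/subsetP => _ /imsetP[e _ ->]; exact: valP e.
  by rewrite -/(rkS X); lia.
rewrite (sum_sig_sets _ (fun Z : {set edge G} => (-1) ^+ (rkS X + rkS Z) *: 'X^(nulS Z))).
by apply: eq_bigl => Y; rewrite (_ : [set e in X] = X) //; apply/setP => e; rewrite inE.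
Qed.

End Polynomials.

(** * Polynomial identities and degrees *)

Lemma poly_nat_eq0 (P : {poly rat}) : (forall n : nat, P.[n.+1%:R] = 0) -> P = 0.
Proof.
move=> P0; apply/eqP/negPn/negP => Pn0.
have := @max_poly_roots _ P [seq n.+1%:R | n <- iota 0 (size P)] Pn0.
rewrite size_map size_iota ltnn.
have al : all (root P) [seq n.+1%:R | n <- iota 0 (size P)].
  by apply/allP => _ /mapP[n _ ->]; apply/rootP.
have un : uniq [seq n.+1%:R : rat | n <- iota 0 (size P)].
  by rewrite map_inj_uniq ?iota_uniq // => m n /eqP; rewrite eqr_nat => /eqP[].
by move=> /(_ al un).
Qed.

Lemma poly_nat_ext (P Q : {poly rat}) : (forall n : nat, P.[n.+1%:R] = Q.[n.+1%:R]) -> P = Q.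
Proof.
move=> PQ; apply/eqP; rewrite -subr_eq0; apply/eqP/poly_nat_eq0 => n.
by rewrite hornerD hornerN PQ subrr.
Qed.

Section Bivariate.
Implicit Types (P Q : {mpoly rat[2]}) (t u : {poly rat}) (x y : rat).

Definition exponents (i j : nat) : 'X_{1.. 2} := (U_(ord0) *+ i + U_(ord_max) *+ j)%MM.

Lemma exponents0 i j : exponents i j ord0 = i.
Proof. by rewrite mnmDE !mulmnE !mnm1E /= mul1n mul0n addn0. Qed.

Lemma exponents1 i j : exponents i j ord_max = j.
Proof. by rewrite mnmDE !mulmnE !mnm1E /= mul1n mul0n. Qed.

Lemma exponentsK (m : 'X_{1.. 2}) : exponents (m ord0) (m ord_max) = m.
Proof.
apply/mnmP => k; have [->|->] : k = ord0 \/ k = ord_max; rewrite ?exponents0 ?exponents1 //.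
by case: k => [[|[|]]] // i; [left|right]; apply/val_inj.
Qed.

Lemma mdeg2 (m : 'X_{1.. 2}) : mdeg m = (m ord0 + m ord_max)%N.
Proof. by rewrite mdegE big_ord_recl big_ord1; congr (_ + m _)%N; apply/val_inj. Qed.

Lemma evB P Q x y : ev (P - Q) x y = ev P x y - ev Q x y.
Proof. exact: mevalB. Qed.

Lemma evZ c P x y : ev (c *: P) x y = c * ev P x y.
Proof. exact: mevalZ. Qed.

Lemma ev_sum (I : Type) (r : seq I) (A : pred I) (F : I -> {mpoly rat[2]}) x y :
  ev (\sum_(i <- r | A i) F i) x y = \sum_(i <- r | A i) ev (F i) x y.
Proof. exact: raddf_sum. Qed.

Lemma ev_exponents i j x y : ev 'X_[exponents i j] x y = x ^+ i * y ^+ j.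
Proof.
rewrite /ev mevalX big_ord_recl big_ord1 /= exponents0.
by rewrite (_ : lift ord0 ord0 = ord_max) ?exponents1 //; apply/val_inj.
Qed.

Lemma mono_exponents i j : varx ^+ i * vary ^+ j = 'X_[exponents i j].
Proof. by rewrite /varx /vary !mpolyXn -mpolyXD. Qed.

(** Written in monomials so that coefficients, and therefore degrees, can be read off directly. *)
Definition prod_poly t u : {mpoly rat[2]} :=
  \sum_(i < size t) \sum_(j < size u) (t`_i * u`_j) *: 'X_[exponents i j].

Lemma ev_prod_poly t u x y : ev (prod_poly t u) x y = t.[x] * u.[y].
Proof.
rewrite ev_sum !horner_coef mulr_suml; apply: eq_bigr => i _.
rewrite ev_sum mulr_sumr; apply: eq_bigr => j _.
by rewrite evZ ev_exponents mulrACA.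
Qed.

Lemma coef_prod_poly t u (m : 'X_{1.. 2}) : (prod_poly t u)@_m = t`_(m ord0) * u`_(m ord_max).
Proof.
have trunc (s : {poly rat}) k : s`_k = \sum_(i < size s) s`_i * (i == k :> nat)%:R.
  have [ks|ks] := ltnP k (size s).
    rewrite (bigD1 (Ordinal ks)) //= eqxx mulr1 big1 ?addr0 // => i.
    by rewrite -val_eqE /= => /negPf ->; rewrite mulr0.
  rewrite nth_default // big1 // => i _.
  by rewrite ltn_eqF ?mulr0 // (leq_trans (ltn_ord i)).
rewrite (trunc t) (trunc u) mulr_suml raddf_sum; apply: eq_bigr => i _.
rewrite mulr_sumr raddf_sum; apply: eq_bigr => j _ /=.
rewrite mcoeffZ mcoeffX mulrACA -natrM mulnb; congr (_ * (nat_of_bool _)%:R).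
apply/eqP/andP => [<-|[/eqP im /eqP jm]]; first by rewrite exponents0 exponents1 !eqxx.
by rewrite im jm exponentsK.
Qed.

(** The univariate fact is used twice: in x for each positive integer y, then in y for the
    coefficient [g] of a fixed power of x. *)
Lemma ev_eq0 P : (forall p q : nat, ev P p.+1%:R q.+1%:R = 0) -> P = 0.
Proof.
move=> P0; apply/mpolyP => m; rewrite mcoeff0.
pose f (y : rat) : {poly rat} := \sum_(k <- msupp P) (P@_k * y ^+ k ord_max) *: 'X^(k ord0).
have evE x y : ev P x y = (f y).[x].
  rewrite /ev mevalE horner_sum; apply: eq_bigr => k _.
  rewrite big_ord_recl big_ord1 /= hornerZ hornerXn -mulrA [y ^+ _ * _]mulrC.
  by rewrite (_ : lift ord0 ord0 = ord_max) //; apply/val_inj.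
pose g : {poly rat} := \sum_(k <- msupp P | k ord0 == m ord0) P@_k *: 'X^(k ord_max).
have g0 : g = 0.
  apply: poly_nat_eq0 => q.
  have f0 : f q.+1%:R = 0 by apply: poly_nat_eq0 => p; rewrite -evE.
  rewrite -[RHS](coef0 _ (m ord0)) -f0 coef_sum horner_sum big_mkcond /=.
  apply: eq_bigr => k _; rewrite coefZ coefXn [m ord0 == _]eq_sym.
  by case: eqP => _; rewrite ?hornerZ ?hornerXn ?mulr1 ?mulr0.
have := congr1 (fun s : {poly rat} => s`_(m ord_max)) g0; rewrite coef0 coef_sum.
have [mP|] := boolP (m \in msupp P); last by rewrite mcoeff_msupp negbK => /eqP.
rewrite big_mkcond (bigD1_seq m) ?msupp_uniq //= eqxx coefZ coefXn eqxx mulr1 big1 ?addr0 // =>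
  k km.
case: eqP => // k0; rewrite coefZ coefXn; case: eqP => [k1|_]; rewrite ?mulr0 //.
by case/eqP: km; rewrite -[k]exponentsK -[m]exponentsK k0 k1.
Qed.

Lemma ev_ext P Q : (forall p q : nat, ev P p.+1%:R q.+1%:R = ev Q p.+1%:R q.+1%:R) -> P = Q.
Proof.
move=> PQ; apply/eqP; rewrite -subr_eq0; apply/eqP/ev_eq0 => p q.
by rewrite evB PQ subrr.
Qed.

(** The polynomials to be compared agree only from the top degree on; a nonzero coefficient there is
    enough to equate the degrees. *)
Lemma msize_top P Q (D : nat) : (forall m, (D <= mdeg m)%N -> P@_m = Q@_m) ->
  (exists2 m, (D <= mdeg m)%N & Q@_m != 0) -> msize P = msize Q.
Proof.
move=> PQ [m0 Dm0 Qm0].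
have le A B : (forall m, (D <= mdeg m)%N -> A@_m = B@_m) -> B@_m0 != 0 -> (msize A <= msize B)%N.
  move=> AB Bm0; rewrite msizeE; apply/bigmax_leqP_seq => m mA _.
  have [Dm|mD] := leqP D (mdeg m).
    by apply: msize_mdeg_lt; rewrite mcoeff_msupp -AB // -mcoeff_msupp.
  apply: leq_trans (_ : (mdeg m0).+1 <= _)%N; first by rewrite ltnS ltnW // (leq_trans mD).
  by apply: msize_mdeg_lt; rewrite mcoeff_msupp.
apply/eqP; rewrite eqn_leq !le // ?PQ // => m Dm; by rewrite PQ.
Qed.

Lemma prod_poly_top t u t' u' (a b : nat) (m : 'X_{1.. 2}) :
  (forall i, (a <= i)%N -> t`_i = t'`_i) -> (forall i, (a < i)%N -> t'`_i = 0) ->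
  (forall j, (b <= j)%N -> u`_j = u'`_j) -> (forall j, (b < j)%N -> u'`_j = 0) ->
  (a + b <= mdeg m)%N -> (prod_poly t u)@_m = (prod_poly t' u')@_m.
Proof.
move=> tt' t0 uu' u0; rewrite mdeg2 !coef_prod_poly => abm.
have [ma|ma] := ltnP a (m ord0); first by rewrite tt' ?t0 ?mul0r // ltnW.
have [mb|mb] := ltnP b (m ord_max); first by rewrite uu' ?u0 ?mulr0 // ltnW.
by rewrite tt' ?uu' //; lia.
Qed.

End Bivariate.

(** * Leading coefficients, and substitution of the opposite argument *)

Section ExplicitPolynomials.
Variable H : mgraph.
Implicit Types X : {set edge H}.

(** In degree at least the rank only sets of rank 0 contribute, and for these the nullity is the
    cardinality, so the signs agree. *)
Lemma tau_taub_coef i : (rk H <= i)%N -> (tau_poly H)`_i = (taub_poly H)`_i.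
Proof.
move=> ri; rewrite !coef_sum; apply: eq_bigr => X _; rewrite !coefZ coefXn.
case: eqP => [iX|_]; rewrite ?mulr0 // nulSE.
have := rkS_le_rk X; move: ri; rewrite iX => ri rX.
have -> : rkS X = 0%N by move: ri rX; clear; lia.
by rewrite subn0.
Qed.

Lemma taub_coef0 i : (rk H < i)%N -> (taub_poly H)`_i = 0.
Proof.
move=> ri; rewrite coef_sum big1 // => X _; rewrite coefZ coefXn gtn_eqF ?mulr0 //.
by apply: leq_ltn_trans ri; apply: leq_subr.
Qed.

Lemma nulS_T : nulS [set: edge H] = nullity H.
Proof. by rewrite nulSE rkS_T cardsT. Qed.

(** Nullity is monotone because flows modulo 2 supported in [X] are among all flows modulo 2. *)
Lemma nulS_le X : (nulS X <= nullity H)%N.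
Proof.
rewrite -nulS_T -(leq_exp2l (m := 2)) // -[2%N](card_ord 2).
have := card_flows 'I_2 [ffun=> true] (~: X); rewrite setCK => <-.
have := card_flows 'I_2 [ffun=> true] (~: [set: edge H]); rewrite setCK => <-.
apply: subset_leq_card; apply/subsetP => g; rewrite !inE => /andP[-> _].
by rewrite setCT sub0set.
Qed.

(** Only sets of full nullity contribute, and for these |E \ X| equals r(H) - r(X). *)
Lemma phi_phib_coef j : (nullity H <= j)%N -> (phi_poly H)`_j = (phib_poly H)`_j.
Proof.
move=> nj; rewrite !coef_sum; apply: eq_bigr => X _; rewrite !coefZ coefXn.
case: eqP => [jX|_]; rewrite ?mulr0 //; congr (_ ^+ _ * _).
have := nulS_le X; have := rkS_le_card X; have := rk_le_edges H; have := rkS_le_rk X.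
have := cardsC X; move: nj; rewrite jX nulSE /nullity.
by set a := #|X|; set b := #|~: X|; set c := rkS X; set d := rk H; clear; lia.
Qed.

Lemma phib_coef0 j : (nullity H < j)%N -> (phib_poly H)`_j = 0.
Proof.
move=> nj; rewrite coef_sum big1 // => X _; rewrite coefZ coefXn gtn_eqF ?mulr0 //.
by apply: leq_ltn_trans nj; apply: nulS_le.
Qed.

Lemma tau_opp (x : rat) : (tau_poly H).[- x] = (-1) ^+ rk H * (taub_poly H).[x].
Proof.
rewrite !horner_sum mulr_sumr; apply: eq_bigr => X _; rewrite !hornerZ !hornerXn.
rewrite [(- x) ^+ _]exprNn !mulrA -!exprD; congr (_ * _); apply: signr_parity.
rewrite nulSE !oddD oddB ?rkS_le_rk // oddB ?rkS_le_card //.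
by case: (odd #|X|); case: (odd (rk H)); case: (odd (rkS X)).
Qed.

Lemma taub_opp (x : rat) : (taub_poly H).[- x] = (-1) ^+ rk H * (tau_poly H).[x].
Proof. by rewrite -{2}[x]opprK tau_opp mulrA -exprD addnn -signr_odd odd_double mul1r. Qed.

Lemma phi_opp (y : rat) : (phi_poly H).[- y] = (-1) ^+ nullity H * (phib_poly H).[y].
Proof.
rewrite !horner_sum mulr_sumr; apply: eq_bigr => X _; rewrite !hornerZ !hornerXn.
rewrite [(- y) ^+ _]exprNn !mulrA -!exprD; congr (_ * _); apply: signr_parity.
rewrite nulSE !oddD (oddB (rk_le_edges H)) (oddB (rkS_le_card X)) (oddB (rkS_le_rk X)).
rewrite -(cardsC X) oddD.
by case: (odd #|X|); case: (odd (rk H)); case: (odd (rkS X)); case: (odd _).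
Qed.

Lemma phib_opp (y : rat) : (phib_poly H).[- y] = (-1) ^+ nullity H * (phi_poly H).[y].
Proof. by rewrite -{2}[y]opprK phi_opp mulrA -exprD addnn -signr_odd odd_double mul1r. Qed.

Lemma ev_rank_gen (x y : rat) :
  ev (rank_gen H) x y = \sum_(X : {set edge H}) x ^+ (rk H - rkS X) * y ^+ nulS X.
Proof.
rewrite ev_sum; apply: eq_bigr => X _.
by rewrite mono_exponents ev_exponents.
Qed.

Lemma ev_rank_gen_taub (x : rat) : ev (rank_gen H) x (-1) = (taub_poly H).[x].
Proof.
rewrite ev_rank_gen horner_sum; apply: eq_bigr => X _.
by rewrite hornerZ hornerXn mulrC.
Qed.

Lemma ev_rank_gen_phib (y : rat) : ev (rank_gen H) (-1) y = (phib_poly H).[y].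
Proof.
rewrite ev_rank_gen horner_sum; apply: eq_bigr => X _.
by rewrite hornerZ hornerXn.
Qed.

End ExplicitPolynomials.

(** Expansion of a product over edges: an edge of [W] outside [Z] contributes -1 + 1, an edge of [Z]
    outside [W] contributes 0 + 0. *)
Lemma sum_sign_interval (E : finType) (Z W : {set E}) :
  \sum_(X : {set E}) ((Z \subset X) && (X \subset W))%:R * (-1) ^+ #|X|
  = (Z == W)%:R * (-1) ^+ #|W| :> rat.
Proof.
pose F e : rat := if e \in W then -1 else 0; pose K e : rat := if e \in Z then 0 else 1.
transitivity (\prod_e (F e + K e)).
  rewrite bigA_distr; apply: eq_bigr => X _.
  have [/andP[/subsetP sZX /subsetP sXW]|] := boolP ((Z \subset X) && (X \subset W)).
    rewrite mul1r (bigID (mem X)) /= (eq_bigr (fun=> -1)) => [|e eX]; last by rewrite eX /F sXW.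
    rewrite prodr_const big1 ?mulr1 // => e eX; rewrite (negPf eX) /K.
    by rewrite ifN //; apply: contra eX => /sZX.
  rewrite negb_and mul0r => /orP[/subsetPn[e eZ eX]|/subsetPn[e eX eW]].
    by rewrite (bigD1 e) //= (negPf eX) /K eZ mul0r.
  by rewrite (bigD1 e) //= eX /F (negPf eW) mul0r.
have [ZW|ZW] := eqVneq Z W.
  rewrite mul1r (bigID (mem W)) /= (eq_bigr (fun=> -1)) => [|e eW];
    last by rewrite /F /K ZW eW addr0.
  by rewrite prodr_const big1 ?mulr1 // => e eW; rewrite /F /K ZW (negPf eW) add0r.
rewrite mul0r; have : ~~ ((Z \subset W) && (W \subset Z)) by rewrite -eqEsubset.
rewrite negb_and => /orP[/subsetPn[e eZ eW]|/subsetPn[e eW eZ]].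
  by rewrite (bigD1 e) //= /F /K eZ (negPf eW) addr0 mul0r.
by rewrite (bigD1 e) //= /F /K eW (negPf eZ) addNr mul0r.
Qed.

Lemma sum_supersets (V : nmodType) (E : finType) (X : {set E}) (F : {set E} -> V) :
  \sum_(Y : {set E} | Y \subset ~: X) F (X :|: Y) = \sum_(W : {set E} | X \subset W) F W.
Proof.
symmetry; rewrite (reindex_onto (fun Y => X :|: Y) (fun W => W :\: X)) /=; last first.
  move=> W sX; apply/setP => e; rewrite !inE.
  by case: (boolP (e \in X)) => [/(subsetP sX) ->|].
apply: eq_bigl => Y; rewrite subsetUl /= setDUl setDv set0U.
apply/eqP/idP => [<-|sY]; first by rewrite setDE subsetIr.
by apply/setDidPl; rewrite disjoints_subset.
Qed.

Lemma sum_subsets_setD (V : nmodType) (E : finType) (X : {set E}) (F : {set E} -> V) :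
  \sum_(Y : {set E} | Y \subset X) F (X :\: Y) = \sum_(Z : {set E} | Z \subset X) F Z.
Proof.
symmetry; rewrite (reindex_onto (fun Y => X :\: Y) (fun Y => X :\: Y)) /=; last first.
  by move=> Y sY; rewrite setDDr setDv set0U (setIidPr sY).
apply: eq_bigl => Y; rewrite subsetDl /= setDDr setDv set0U.
by apply/eqP/setIidPr.
Qed.

(* The sign of the term indexed by [Z <= X <= W] depends on [X] only through
   the parity of its cardinality, so the sum over [X] vanishes unless [Z = W]. *)
Lemma rank_gen_convolution (G : mgraph) : rank_gen G =
  \sum_(X : {set edge G}) prod_poly (taub_poly (contraction X)) (phib_poly (restriction X)).
Proof.
apply: ev_ext => p q; set x : rat := p.+1%:R; set y : rat := q.+1%:R.
rewrite ev_rank_gen ev_sum.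
pose T (Z W : {set edge G}) : rat :=
  (-1) ^+ (#|W| + rkS W + rkS Z) * (x ^+ (rk G - rkS W) * y ^+ nulS Z).
transitivity (\sum_(X : {set edge G}) \sum_(W : {set edge G}) \sum_(Z : {set edge G})
    ((Z \subset X) && (X \subset W))%:R * (-1) ^+ #|X| * T Z W); last first.
  apply: eq_bigr => X _; rewrite ev_prod_poly taub_contraction phib_restriction !horner_sum.
  pose U (W : {set edge G}) : rat := (-1) ^+ (#|W| + #|X| + rkS X + rkS W) * x ^+ (rk G - rkS W).
  rewrite [Z in _ = Z * _](eq_bigr (fun Y => U (X :|: Y))) => [|Y sY]; last first.
    rewrite hornerZ hornerXn /U; congr (_ * _); apply: signr_parity.
    have -> : #|X :|: Y| = (#|X| + #|Y|)%N.
      by rewrite cardsU (_ : X :&: Y = set0) ?cards0 ?subn0 //; apply/eqP;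
         rewrite setI_eq0 disjoint_sym disjoints_subset.
    by rewrite !oddD; case: (odd #|X|); case: (odd #|Y|).
  rewrite sum_supersets mulr_suml [RHS]big_mkcond /=; apply: eq_bigr => W _.
  case: (boolP (X \subset W)) => sXW; last first.
    by rewrite big1 // => Z _; rewrite andbF !mul0r.
  rewrite mulr_sumr [RHS]big_mkcond /=; apply: eq_bigr => Z _; rewrite andbT.
  case: (boolP (Z \subset X)) => sZX; last by rewrite !mul0r.
  rewrite mul1r hornerZ hornerXn /T /U mulrACA -exprD mulrA -exprD; congr (_ * _).
  apply: signr_parity; rewrite !oddD.
  by case: (odd #|X|); case: (odd #|W|); case: (odd (rkS X)); case: (odd (rkS W));
    case: (odd (rkS Z)).
rewrite exchange_big /=; apply: eq_bigr => W _; rewrite exchange_big /=.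
rewrite (eq_bigr (fun Z => (Z == W)%:R * (-1) ^+ #|W| * T Z W)) => [|Z _]; last first.
  by rewrite -mulr_suml sum_sign_interval.
rewrite (bigD1 W) //= eqxx mul1r big1 ?addr0 => [|Z /negPf ->]; last by rewrite !mul0r.
rewrite /T mulrA -exprD -signr_odd !oddD.
by case: (odd #|W|); case: (odd (rkS W)); rewrite /= mul1r.
Qed.

Definition kappa_poly (G : mgraph) : {mpoly rat[2]} :=
  \sum_(X : {set edge G}) prod_poly (tau_poly (contraction X)) (phi_poly (restriction X)).

(** [D] is the largest total degree of a term. All terms have coefficient 1, so a monomial of that
    degree cannot cancel. *)
Lemma rank_gen_top (G : mgraph) : exists D : nat,
  (exists2 m, (D <= mdeg m)%N & (rank_gen G)@_m != 0) /\
  (forall X : {set edge G}, (rk G - rkS X + nulS X <= D)%N).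
Proof.
pose a (X : {set edge G}) := (rk G - rkS X + nulS X)%N.
have [X0 _ maxX] := @arg_maxnP _ set0 xpredT a isT.
exists (a X0); split; last by move=> X; apply: maxX.
exists (exponents (rk G - rkS X0) (nulS X0)).
  by rewrite mdeg2 exponents0 exponents1.
rewrite raddf_sum /= (eq_bigr (fun X : {set edge G} =>
    ((exponents (rk G - rkS X) (nulS X) == exponents (rk G - rkS X0) (nulS X0))%:R : rat))).
  rewrite (bigD1 X0) //= eqxx lt0r_neq0 // ltr_wpDr //.
  by apply: sumr_ge0.
by move=> X _; rewrite mono_exponents mcoeffX.
Qed.

(** Compared term by term with the convolution for [rank_gen]: in each product the open and closed
    factors share their coefficients from the rank, respectively the nullity, upwards. *)
Lemma msize_kappa (G : mgraph) : msize (kappa_poly G) = msize (rank_gen G).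
Proof.
have [D [top le]] := rank_gen_top G; apply: (msize_top (D := D)) top => m Dm.
rewrite rank_gen_convolution !raddf_sum; apply: eq_bigr => X _ /=.
apply: (prod_poly_top (a := rk (contraction X)) (b := nullity (restriction X))).
- exact: tau_taub_coef.
- exact: taub_coef0.
- exact: phi_phib_coef.
- exact: phib_coef0.
- by rewrite rk_contraction; apply: leq_trans Dm; apply: le.
Qed.

Lemma tutteE (G : mgraph) : tutte G = \sum_(X : {set edge G})
  prod_poly (('X - 1) ^+ (rk G - rkS X)) (('X - 1) ^+ nulS X).
Proof.
apply: ev_ext => p q; rewrite [RHS]ev_sum /tutte {1}/ev comp_mpoly_meval.
have -> : (fun i : 'I_2 => (tnth [tuple varx - 1;
  vary - 1] i).@[fun i => if i == ord0 then p.+1%:R else q.+1%:R])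
    = (fun i : 'I_2 => if i == ord0 then p.+1%:R - 1 else q.+1%:R - 1 : rat).
  apply/funext => i; have [->|->] : i = ord0 \/ i = ord_max.
    by case: i => [[|[|]]] // i; [left|right]; apply/val_inj.
  - by rewrite /tnth /= mevalB meval1 mevalXU.
  - by rewrite /tnth /= mevalB meval1 mevalXU.
rewrite -/(ev _ _ _) ev_rank_gen; apply: eq_bigr => X _.
by rewrite ev_prod_poly !horner_exp !hornerE.
Qed.

(** Shifting the variables by 1 leaves the top coefficient of each power unchanged. *)
Lemma msize_tutte (G : mgraph) : msize (tutte G) = msize (rank_gen G).
Proof.
have [D [top le]] := rank_gen_top G; apply: (msize_top (D := D)) top => m Dm.
rewrite tutteE; have -> : rank_gen G = \sum_(X : {set edge G})
    prod_poly 'X^(rk G - rkS X) 'X^(nulS X).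
  by apply: ev_ext => p q; rewrite ev_rank_gen ev_sum; apply: eq_bigr => X _;
    rewrite ev_prod_poly !hornerXn.
have lin k i : (k <= i)%N -> (('X - 1 : {poly rat}) ^+ k)`_i = ('X^k : {poly rat})`_i.
  rewrite leq_eqVlt => /orP[/eqP <-|ki].
    have mon : ('X - 1 : {poly rat}) ^+ k \is monic by rewrite monic_exp // monicXsubC.
    rewrite coefXn eqxx; have := monicP mon; rewrite /lead_coef.
    by rewrite size_exp_XsubC.
  by rewrite coefXn gtn_eqF // nth_default // size_exp_XsubC.
have Xn0 k i : (k < i)%N -> ('X^k : {poly rat})`_i = 0 by move=> ki; rewrite coefXn gtn_eqF.
rewrite !raddf_sum; apply: eq_bigr => X _ /=.
apply: (prod_poly_top (a := (rk G - rkS X)%N) (b := nulS X)); try exact: lin; try exact: Xn0.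
by apply: leq_trans Dm; apply: le.
Qed.

(** * The counting functions *)

Section GroupCounts.
Variables (G : mgraph) (A : finZmodType) (eps : orient G).
Implicit Types X Y Z : {set edge G}.

Definition ntensions X : nat :=
  #|[set f : {ffun edge G -> A} | `[< is_tension eps f >] && (zero_set f == X)]|.
Definition nflows X : nat :=
  #|[set g : {ffun edge G -> A} | `[< is_flow eps g >] && (supp_set g == X)]|.

Lemma supp_setE (g : {ffun edge G -> A}) X : (supp_set g == X) = (zero_set g == ~: X).
Proof.
rewrite -(inj_eq (@setC_inj _)); congr (_ == _).
by apply/setP => e; rewrite !inE negbK.
Qed.

(** Inclusion-exclusion over zero sets with [card_tensions] reproduces the expansion of the
    contraction term by term, bypassing the bijection with nowhere-zero tensions of G/X. *)
Lemma ntensionsE X : (ntensions X)%:R = (tau_poly (contraction X)).[#|A|%:R].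
Proof.
pose S := [set f : {ffun edge G -> A} | `[< is_tension eps f >]].
have -> : ntensions X = #|[set f in S | zero_set f == X]|.
  by apply: eq_card => f; rewrite !inE.
rewrite inclusion_exclusion tau_contraction horner_sum; apply: eq_bigr => Y _.
rewrite hornerZ hornerXn -natrX -(card_tensions A eps); congr (_ * _%:R).
by apply: eq_card => f; rewrite !inE.
Qed.

Lemma nflowsE X : (nflows X)%:R = (phi_poly (restriction X)).[#|A|%:R].
Proof.
pose S := [set g : {ffun edge G -> A} | `[< is_flow eps g >]].
have -> : nflows X = #|[set g in S | zero_set g == ~: X]|.
  by apply: eq_card => f; rewrite [LHS]in_set [RHS]in_set supp_setE in_set.
rewrite inclusion_exclusion phi_restriction horner_sum setCK -[RHS]sum_subsets_setD.
apply: eq_bigr => Y sY; rewrite hornerZ hornerXn -natrX.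
have -> : (-1) ^+ (#|X| + #|X :\: Y|) = (-1) ^+ #|Y| :> rat.
  apply: signr_parity; rewrite -(cardsID Y X) (setIidPr sY) !oddD.
  by case: (odd #|Y|); case: (odd _).
have -> : nulS (X :\: Y) = nullity (restriction (~: (~: X :|: Y))).
  by rewrite /nulS setCU setCK setDE.
rewrite -(card_flows A eps); congr (_ * _%:R).
by apply: eq_card => f; rewrite !inE.
Qed.

Lemma tau_countE : tau_count A eps = ntensions set0.
Proof.
apply: eq_card => f; rewrite !inE; apply/asboolP/andP => [[Tf f0]|[/asboolP Tf /eqP/setP f0]].
  by split; [apply/asboolP|apply/eqP/setP => e; rewrite !inE (negPf (f0 e))].
by split=> // e; have := f0 e; rewrite !inE => ->.
Qed.

Lemma phi_countE : phi_count A eps = nflows setT.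
Proof.
apply: eq_card => f; rewrite !inE; apply/asboolP/andP => [[Tf f0]|[/asboolP Tf /eqP/setP f0]].
  by split; [apply/asboolP|apply/eqP/setP => e; rewrite !inE f0].
by split=> // e; have := f0 e; rewrite !inE => ->.
Qed.

Lemma tau_contraction0 : tau_poly (contraction (set0 : {set edge G})) = tau_poly G.
Proof.
by rewrite tau_contraction setC0; apply: eq_big => Y *; rewrite ?subsetT // set0U.
Qed.

Lemma phi_restrictionT : phi_poly (restriction [set: edge G]) = phi_poly G.
Proof.
rewrite phi_restriction; apply: eq_big => [Y|Y _]; first by rewrite subsetT.
congr (_ *: _); apply: signr_parity; rewrite cardsT -(cardsC Y) !oddD.
by case: (odd #|Y|); case: (odd _).
Qed.

End GroupCounts.

Lemma tau_polyP H : is_tau H (tau_poly H).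
Proof. by move=> q A eps <-; rewrite tau_countE ntensionsE tau_contraction0. Qed.

Lemma phi_polyP H : is_phi H (phi_poly H).
Proof. by move=> q A eps <-; rewrite phi_countE nflowsE phi_restrictionT. Qed.

Lemma kappa_polyP G : is_kappa G (kappa_poly G).
Proof.
move=> p q A B eps <- <-; rewrite ev_sum.
under eq_bigr do rewrite ev_prod_poly -(ntensionsE A eps) -(nflowsE B eps) -natrM.
rewrite -natr_sum; congr _%:R; rewrite /kappa_count.
pose S X := setX [set f : {ffun edge G -> A} | `[< is_tension eps f >] && (zero_set f == X)]
  [set g : {ffun edge G -> B} | `[< is_flow eps g >] && (supp_set g == X)].
rewrite -sum1_card (partition_big (fun fg : {ffun edge G -> A} * {ffun edge G -> B} => zero_set
  fg.1) xpredT) //=.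
symmetry; apply: eq_bigr => X _; rewrite /ntensions /nflows -cardsX -sum1_card;
  apply: eq_bigl => -[f g].
rewrite !inE /=; apply/andP/andP => [[/asboolP[Tf Fg fg] /eqP fX]|].
  by rewrite -fg fX eqxx !andbT; split; apply/asboolP.
case=> /andP[/asboolP Tf /eqP fX] /andP[/asboolP Fg /eqP gX]; split; last exact/eqP.
by apply/asboolP; split=> //; rewrite fX gX.
Qed.

Section OrientationPolynomials.
Variables (G : mgraph) (rho : orient G).

Lemma is_tension_reorient : @is_tension G int rho = reorient rho (@tensions G).
Proof. by apply/funext => f; apply/propext/tensions_reorient. Qed.

Lemma is_flow_reorient : @is_flow G int rho = reorient rho (@flows G).
Proof. by apply/funext => g; apply/propext/flows_reorient. Qed.

Lemma is_tension_roundable : roundable (@is_tension G int rho).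
Proof. by rewrite is_tension_reorient; apply: reorient_roundable; apply: tensions_roundable. Qed.

Lemma is_flow_roundable : roundable (@is_flow G int rho).
Proof. by rewrite is_flow_reorient; apply: reorient_roundable; apply: flows_roundable. Qed.

Lemma kappab_or_countE p q :
  kappab_or_count rho p q = (box (@is_tension G int rho) p * box (@is_flow G int rho) q)%N.
Proof.
rewrite /box -cardsX; apply: eq_card => -[f g]; rewrite !inE /=.
by apply/asboolP/andP => -[Tf Fg]; split; apply/asboolP.
Qed.

Lemma nonneg_product (f g : edge G -> int) : is_tension rho f -> is_flow rho g ->
  (forall e, 0 <= f e) -> (forall e, 0 <= g e) -> forall e, f e * g e = 0.
Proof.
move=> Tf Fg f0 g0 e; have fg x : true -> 0 <= f x * g x by move=> _; apply: mulr_ge0.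
exact: (psumr_eq0P fg (flow_tension_sum Tf Fg)).
Qed.

Lemma nonneg_tension_Cset (f : edge G -> int) : is_tension rho f -> (forall e, 0 <= f e) ->
  forall e, e \in Cset rho -> f e = 0.
Proof.
move=> Tf f0 e eC; have [g [Fg g0 gn]] := Cset_positive_flow rho.
have gge x : 0 <= g x by case: (boolP (x \in Cset rho)) => [/g0/ltW//|/gn ->].
have /eqP := nonneg_product Tf Fg f0 gge e.
by rewrite mulf_eq0 (gt_eqF (g0 e eC)) orbF => /eqP.
Qed.

Lemma nonneg_flow_Cset (g : edge G -> int) : is_flow rho g -> (forall e, 0 <= g e) ->
  forall e, e \notin Cset rho -> g e = 0.
Proof.
move=> Fg g0 e eC; have [f [Tf f0 fn]] := Cset_positive_tension rho.
have fge x : 0 <= f x by case: (boolP (x \in Cset rho)) => [/fn ->|/f0/ltW].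
have /eqP := nonneg_product Tf Fg fge g0 e.
by rewrite mulf_eq0 (gt_eqF (f0 e eC)) => /eqP.
Qed.

(** A nonnegative tension vanishes on [Cset rho] and a nonnegative flow off it, so the joint
    conditions fix both zero sets and the count becomes a product. *)
Lemma kappa_or_countE p q : kappa_or_count rho p q =
  (open_box (@is_tension G int rho) p (Cset rho) *
   open_box (@is_flow G int rho) q (~: Cset rho))%N.
Proof.
rewrite /open_box -cardsX; apply: eq_card => -[f g]; rewrite !inE /=.
have f0 e : 0 <= intf f e by [].
have g0 e : 0 <= intf g e by [].
apply/asboolP/andP => [[Tf Fg fg]|[/andP[/asboolP Tf /eqP/setP fC] /andP[/asboolP Fg /eqP/setP
  gC]]].
  have fC := nonneg_tension_Cset Tf f0; have gC := nonneg_flow_Cset Fg g0.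
  split; apply/andP; split; try exact/asboolP; apply/eqP/setP => e; rewrite !inE -eqz_nat.
    apply/eqP/idP => [fe|/fC //]; apply/negPn/negP => /gC ge; have [_] := fg e.
    by rewrite ge addr0 /intf fe.
  apply/eqP/idP => [ge|/gC //]; apply/negP => /fC fe; have [_] := fg e.
  by rewrite fe add0r /intf ge.
split=> // e; have := fC e; have := gC e; rewrite !inE /intf.
case: (e \in Cset rho) => /=.
  by move=> /negbT g1 /eqP ->; rewrite mul0r add0r ltz_nat lt0n.
by move=> /eqP -> /negbT f1; rewrite mulr0 addr0 ltz_nat lt0n.
Qed.

Lemma kappab_or_poly : exists TF : {poly rat} * {poly rat}, forall n : nat,
  TF.1.[n%:R] = (box (@is_tension G int rho) n)%:R /\
  TF.2.[n%:R] = (box (@is_flow G int rho) n)%:R.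
Proof.
have [T TP] := box_polynomial is_tension_roundable.
have [F FP] := box_polynomial is_flow_roundable.
by exists (T, F) => n; rewrite TP ?FP.
Qed.

Lemma kappa_or_poly : exists P, is_kappa_or rho P.
Proof.
have [T TP] := open_box_polynomial (Cset rho) is_tension_roundable.
have [F FP] := open_box_polynomial (~: Cset rho) is_flow_roundable.
exists (prod_poly T F) => p q p0 q0; rewrite ev_prod_poly TP // FP //.
by rewrite kappa_or_countE natrM.
Qed.

Lemma ker_signed_residue p (f : {ffun edge G -> 'I_p.+2}) e :
  (e \in zeros (residue p (signed rho f))) = (p.+1 %| f e)%N.
Proof.
rewrite inE; have -> : residue p (signed rho f) e = reduce p (signed rho f e) by rewrite ffunE.
rewrite -[_ == ord0]/(_ == 0) reduce_eq0 /signed.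
by case: (rho e); rewrite /= ?mul1r ?mulN1r ?rpredN /dvdz.
Qed.

(** Complementarity of the residues already confines closed boxes to open ones: a coordinate at the
    upper end has residue 0, while by orthogonality the other vector vanishes there, so both
    residues would be 0. *)
Lemma open_pairs p q : kappa_or_count rho p.+1 q.+1 =
  #|[set fg : {ffun edge G -> 'I_p.+2} * {ffun edge G -> 'I_q.+2} |
    [&& `[< tensions (signed rho fg.1) >], `[< flows (signed rho fg.2) >]
      & zeros (residue q (signed rho fg.2)) == ~: zeros (residue p (signed rho fg.1))]]|.
Proof.
pose wid m (f : {ffun edge G -> 'I_m.+1}) : {ffun edge G -> 'I_m.+2} :=
  [ffun e => widen_ord (leqnSn _) (f e)].
have wid_inj m : injective (@wid m).
  by move=> f g /ffunP fg; apply/ffunP => e; have := fg e; rewrite !ffunE => -[/val_inj].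
have widE m (f : {ffun edge G -> 'I_m.+1}) e : (wid m f e : nat) = f e by rewrite ffunE.
have inj2 : injective (fun fg : {ffun edge G -> 'I_p.+1} * {ffun edge G -> 'I_q.+1} =>
    (wid p fg.1, wid q fg.2)).
  by move=> [f g] [f' g'] /= [/wid_inj -> /wid_inj ->].
have wint m (f : {ffun edge G -> 'I_m.+1}) : intf (wid m f) = intf f.
  by apply/funext => e; rewrite /intf widE.
rewrite /kappa_or_count -(card_imset _ inj2); apply: eq_card => -[f g].
apply/imsetP/idP => [[[f' g'] + [-> ->]]|].
  rewrite !inE /= => /asboolP[Tf Fg fg]; apply/and3P; split.
  - by apply/asboolP; rewrite -/(reorient rho (@tensions G) (intf (wid p f')))
      -is_tension_reorient wint.
  - by apply/asboolP; rewrite -/(reorient rho (@flows G) (intf (wid q g'))) -is_flow_reorient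
      wint.
  - apply/eqP/setP => e; rewrite in_setC !ker_signed_residue !widE.
    have small m (i : 'I_m.+1) : (m.+1 %| i)%N = ((i : nat) == 0%N).
      by rewrite /dvdn modn_small.
    rewrite !small; have [] := fg e; rewrite /intf /=.
    by case: (nat_of_ord (f' e)) => [|m]; case: (nat_of_ord (g' e)) => [|n].
rewrite inE /= => /and3P[/asboolP Tf /asboolP Fg /eqP/setP fg].
have {}Tf : is_tension rho (intf f) by rewrite is_tension_reorient.
have {}Fg : is_flow rho (intf g) by rewrite is_flow_reorient.
have prod0 := nonneg_product Tf Fg (fun e => isT : 0 <= intf f e) (fun e => isT : 0 <= intf g e).
have key e : [/\ (f e < p.+1)%N, (g e < q.+1)%N & 0 < intf f e + intf g e].
  have := fg e; have := prod0 e; rewrite in_setC !ker_signed_residue /intf.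
  move: (ltn_ord (f e)) (ltn_ord (g e)).
  move: (nat_of_ord (f e)) (nat_of_ord (g e)) => m n lm ln mn0.
  have [->|m0] := posnP m; last first.
    have -> : n = 0%N by move: mn0 m0; clear; nia.
    rewrite dvdn0 => /esym md; split=> //; last by rewrite addr0 ltz_nat.
    by rewrite ltn_neqAle -ltnS lm andbT; apply: contra md => /eqP ->; rewrite dvdnn.
  rewrite dvdn0 => nd; have n0 : (0 < n)%N by case: (posnP n) nd => // ->; rewrite dvdn0.
  split=> //.
  by rewrite ltn_neqAle -ltnS ln andbT; apply/eqP => nq; rewrite nq dvdnn in nd.
have fl e : (f e < p.+1)%N by case: (key e).
have gl e : (g e < q.+1)%N by case: (key e).
have fE : f = wid p [ffun e => Ordinal (fl e)] by apply/ffunP => e; rewrite !ffunE; apply/val_inj.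
have gE : g = wid q [ffun e => Ordinal (gl e)] by apply/ffunP => e; rewrite !ffunE; apply/val_inj.
have fI : intf [ffun e => Ordinal (fl e)] = intf f by rewrite -wint -fE.
have gI : intf [ffun e => Ordinal (gl e)] = intf g by rewrite -wint -gE.
exists ([ffun e => Ordinal (fl e)], [ffun e => Ordinal (gl e)]); last by rewrite -fE -gE.
rewrite inE /=; apply/asboolP; split.
- by rewrite fI.
- by rewrite gI.
- by move=> e; rewrite fI gI; split; [apply: prod0|case: (key e)].
Qed.

End OrientationPolynomials.

(** * Sums over cut-Eulerian classes in terms of minors *)

Section ClassSums.
Variable G : mgraph.
Implicit Types (R : {set orient G}) (X : {set edge G}).

Lemma dimsum_tensions X p :
  (dimsum (fun X => rk G - rkS X)%N X p)%:~R = (taub_poly (contraction X)).[p.+1%:R] :> rat.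
Proof.
rewrite taub_contraction horner_sum rmorph_sum; apply: eq_bigr => Y _ /=.
rewrite hornerZ hornerXn rmorphM /= rmorphXn rmorphN1 rmorphXn rmorph_nat; congr (_ * _).
apply: signr_parity; rewrite !oddD (oddB (rkS_le_rk X)) (oddB (rkS_le_rk (X :|: Y))).
by case: (odd #|Y|); case: (odd (rk G)); case: (odd (rkS X)); case: (odd _).
Qed.

Lemma dimsum_flows X q :
  (dimsum (fun Z => nulS (~: Z)) (~: X) q)%:~R = (phib_poly (restriction X)).[q.+1%:R] :> rat.
Proof.
rewrite phib_restriction horner_sum rmorph_sum setCK -[RHS]sum_subsets_setD.
apply: eq_bigr => Y sY /=.
rewrite hornerZ hornerXn rmorphM /= rmorphXn rmorphN1 rmorphXn rmorph_nat.
rewrite setCU setCK -setDE; congr (_ * _).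
apply: signr_parity; rewrite !oddD !nulSE (oddB (rkS_le_card X)) (oddB (rkS_le_card (X :\: Y))).
rewrite -(cardsID Y X) (setIidPr sY) oddD.
by case: (odd #|Y|); case: (odd #|X :\: Y|); case: (odd (rkS X)); case: (odd _).
Qed.

Section Weighted.
Variables (R : {set orient G}) (w : {set edge G} -> int).
Hypothesis R_inj : {in R &, forall s t, flip_equiv (@tensions G) (@flows G) s t -> s = t}.
Hypothesis R_cover : forall s : orient G, w (Cset s) != 0 ->
  exists2 t, t \in R & flip_equiv (@tensions G) (@flows G) t s.

Lemma closed_class_sum p q :
  \sum_(s in R) (w (Cset s))%:~R * (kappab_or_count s p.+1 q.+1)%:R =
  \sum_X (w X)%:~R * ((taub_poly (contraction X)).[p.+1%:R]
                      * (phib_poly (restriction X)).[q.+1%:R]) :> rat.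
Proof.
have /(congr1 (fun z : int => z%:~R : rat)) := closed_sum (@tensions_roundable G)
  (@flows_roundable G)
  (@tensions_flows_orthogonal G) (@Cset_strictly_positive G)
  (@card_residue_tensions G) (@card_residue_flows G) R_inj R_cover p q.
rewrite !rmorph_sum /=.
rewrite [X in X = _ -> _](eq_bigr (fun s => (w (Cset s))%:~R * (kappab_or_count s p.+1 q.+1)%:R)).
  move=> ->; apply: eq_bigr => X _; rewrite !rmorphM /= -mulrA.
  by rewrite -[X in _ = _ * (X * _)]dimsum_tensions -[X in _ = _ * (_ * X)]dimsum_flows.
move=> s _; rewrite !rmorphM /= !rmorph_nat kappab_or_countE natrM mulrA.
by rewrite is_tension_reorient is_flow_reorient.
Qed.

Lemma open_class_sum p q :
  \sum_(s in R) (w (Cset s))%:~R * (kappa_or_count s p.+1 q.+1)%:R =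
  \sum_X (w X)%:~R * ((tau_poly (contraction X)).[p.+1%:R]
                      * (phi_poly (restriction X)).[q.+1%:R]) :> rat.
Proof.
have /(congr1 (fun z : int => z%:~R : rat)) := open_sum (@tensions_roundable G)
  (@flows_roundable G)
  (@tensions_flows_orthogonal G) (@Cset_strictly_positive G) R_inj R_cover p q.
rewrite !rmorph_sum /= [X in _ = X -> _](eq_bigr (fun X => (w X)%:~R *
   ((tau_poly (contraction X)).[p.+1%:R] * (phi_poly (restriction X)).[q.+1%:R]))); last first.
  move=> X _; rewrite !rmorphM /= !rmorph_nat -mulrA.
  have := ntensionsE 'I_p.+1 (@reference G) X; rewrite card_ord => <-.
  have := nflowsE 'I_q.+1 (@reference G) X; rewrite card_ord => <-.
  congr (_ * (_%:R * _%:R)); apply: eq_card => r; rewrite [LHS]in_set [RHS]in_set.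
    by rewrite residue_tensions.
  by rewrite residue_flows supp_setE.
move=> <-; rewrite -rmorph_sum /= /closed_triples.
rewrite sum_triples rmorph_sum /= big_mkcond /=; apply: eq_bigr => s _.
case: (s \in R) => /=; last by rewrite big1 // => f _; rewrite big1 // => g _; rewrite mul0r.
rewrite open_pairs card_setE mulr_sumr -(pair_bigA _ (fun f g => (w (Cset s))%:~R *
  ([&& `[< tensions (signed s f) >], `[< flows (signed s g) >]
      & zeros (residue q (signed s g)) == ~: zeros (residue p (signed s f))])%:R)) /=.
rewrite rmorph_sum; apply: eq_bigr => f _ /=; rewrite rmorph_sum; apply: eq_bigr => g _ /=.
rewrite !rmorphM /= !rmorph_nat mulrA -natrM mulnb -andbA mulrC.
by [].
Qed.

End Weighted.

End ClassSums.

Lemma reps_ce (G : mgraph) (R : {set orient G}) : reps (ce_classes G) R ->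
  {in R &, forall s t, flip_equiv (@tensions G) (@flows G) s t -> s = t} /\
  forall s : orient G, exists2 t, t \in R & flip_equiv (@tensions G) (@flows G) t s.
Proof.
move=> rR; have [R_inj cov _] := reps_spec (subxx _) rR; split=> // s.
exact/cov/ce_class_ce.
Qed.

Lemma box_tension_totally_cyclic (G : mgraph) (rho : orient G) p : Cset rho = setT ->
  box (@is_tension G int rho) p = 1%N.
Proof.
move=> CT; apply/eqP/cards1P; exists [ffun=> ord0]; apply/setP => f; rewrite !inE.
apply/asboolP/eqP => [Tf|->]; last by exists (fun=> 0) => e; rewrite ffunE subrr.
apply/ffunP => e; rewrite ffunE; apply/val_inj.
have /(_ e) := nonneg_tension_Cset Tf (fun e => isT : 0 <= (f e : nat)%:Z).
by rewrite CT inE => /(_ isT) [].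
Qed.

Lemma box_flow_acyclic (G : mgraph) (rho : orient G) q : Cset rho = set0 ->
  box (@is_flow G int rho) q = 1%N.
Proof.
move=> C0; apply/eqP/cards1P; exists [ffun=> ord0]; apply/setP => g; rewrite !inE.
apply/asboolP/eqP => [Fg|-> v]; last by rewrite !big1 // => e _; rewrite ffunE.
apply/ffunP => e; rewrite ffunE; apply/val_inj.
have /(_ e) := nonneg_flow_Cset Fg (fun e => isT : 0 <= (g e : nat)%:Z).
by rewrite C0 inE => /(_ isT) [].
Qed.

Lemma count_pairs (A B : finType) (R : {set A}) (P : A -> pred B) :
  #|[set rf : A * B | (rf.1 \in R) && P rf.1 rf.2]| = (\sum_(a in R) #|[set b | P a b]|)%N.
Proof.
rewrite -sum1_card (eq_bigl (fun rf : A * B => (rf.1 \in R) && P rf.1 rf.2)); last first.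
  by move=> rf; rewrite inE.
rewrite -(pair_big_dep (mem R) P (fun _ _ => 1%N)) /=; apply: eq_bigr => a _.
by rewrite -sum1_card; apply: eq_bigl => b; rewrite inE.
Qed.

Lemma rkS0 G : rkS (set0 : {set edge G}) = 0%N.
Proof. by apply/eqP; rewrite -leqn0 -(cards0 (edge G)) rkS_le_card. Qed.

Lemma taub_contraction0 G : taub_poly (contraction (set0 : {set edge G})) = taub_poly G.
Proof.
rewrite taub_contraction setC0; apply: eq_big => [Y|Y _]; first by rewrite subsetT.
rewrite set0U rkS0 addn0 nulSE; congr (_ *: _).
by apply: signr_parity; rewrite oddD (oddB (rkS_le_card Y)).
Qed.

Lemma taub_contractionT G : taub_poly (contraction [set: edge G]) = 1.
Proof.
rewrite taub_contraction setCT (big_pred1 set0) => [|Y]; last by rewrite subset0.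
by rewrite setU0 cards0 add0n addnn -signr_odd odd_double scale1r rkS_T subnn.
Qed.

Lemma phib_restriction0 G : phib_poly (restriction (set0 : {set edge G})) = 1.
Proof.
rewrite phib_restriction (big_pred1 set0) => [|Y]; last by rewrite subset0.
by rewrite addnn -signr_odd odd_double scale1r nulSE cards0.
Qed.

Lemma phib_restrictionT G : phib_poly (restriction [set: edge G]) = phib_poly G.
Proof.
rewrite phib_restriction; apply: eq_big => [Z|Z _]; first by rewrite subsetT.
rewrite rkS_T; congr (_ *: _).
by apply: signr_parity; rewrite oddD (oddB (rkS_le_rk Z)).
Qed.

Lemma phi_restriction_at1 G (X : {set edge G}) :
  (phi_poly (restriction X)).[1] = (X == set0)%:R.
Proof.
rewrite phi_restriction -sum_subsets_setD horner_sum -sum_sign_subset.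
apply: eq_bigr => Y sY; rewrite hornerZ hornerXn expr1n mulr1; apply: signr_parity.
rewrite -(cardsID Y X) (setIidPr sY) !oddD.
by case: (odd #|Y|); case: (odd _).
Qed.

Lemma tau_contraction_at1 G (X : {set edge G}) :
  (tau_poly (contraction X)).[1] = (X == setT)%:R.
Proof.
rewrite tau_contraction horner_sum -[X == setT](inj_eq (@setC_inj _)) setCT -sum_sign_subset.
by apply: eq_bigr => Y _; rewrite hornerZ hornerXn expr1n mulr1.
Qed.

(** The weighted class sum with the indicator of [X = set0] needs representatives of the acyclic
    classes only. For these the flow box contains just the zero flow, and on the right only the term
    of the empty set survives. *)
Lemma taub_polyP H : is_taub H (taub_poly H).
Proof.
move=> R q rR; rewrite /taub_count (count_pairs R (fun rho f => `[< is_tension rho (intf f) >])).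
have /choice[TF TFP] := @kappab_or_poly H.
(* The class sum reaches boxes of side at least 1; an identity of polynomials extends it to q =
   0. *)
suff -> : taub_poly H = \sum_(rho in R) (TF rho).1.
  by rewrite horner_sum natr_sum; apply: eq_bigr => rho _; have [-> _] := TFP rho q.
apply: poly_nat_ext => p; rewrite [RHS]horner_sum.
have acC : ac_classes H \subset ce_classes H by apply/subsetP => K; rewrite inE => /andP[].
have [R_inj cov Rac] := reps_spec acC rR.
have RC rho : rho \in R -> Cset rho = set0 by move=> /Rac; rewrite ce_class_ac => /eqP.
pose w (X : {set edge H}) : int := (X == set0)%:R.
have R_cover s : w (Cset s) != 0 -> exists2 t, t \in R & flip_equiv (@tensions H) (@flows H) t s.
  rewrite /w; have [C0 _|_ /eqP//] := eqVneq (Cset s) set0.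
  by apply: cov; rewrite ce_class_ac C0.
have := closed_class_sum R_inj R_cover p 0.
rewrite [X in X = _ -> _](eq_bigr (fun rho => (TF rho).1.[p.+1%:R])) => [->|rho /RC C0];
  last first.
  rewrite /w C0 eqxx mul1r kappab_or_countE (box_flow_acyclic _ C0) muln1.
  by have [-> _] := TFP rho p.+1.
rewrite (bigD1 set0) //= {1}/w eqxx mul1r big1 ?addr0 => [|X /negPf X0]; last first.
  by rewrite /w X0 mul0r.
by rewrite taub_contraction0 phib_restriction0 hornerC mulr1.
Qed.

Lemma phib_polyP H : is_phib H (phib_poly H).
Proof.
move=> R q rR; rewrite /phib_count (count_pairs R (fun rho f => `[< is_flow rho (intf f) >])).
have /choice[TF TFP] := @kappab_or_poly H.
suff -> : phib_poly H = \sum_(rho in R) (TF rho).2.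
  by rewrite horner_sum natr_sum; apply: eq_bigr => rho _; have [_ ->] := TFP rho q.
apply: poly_nat_ext => p; rewrite [RHS]horner_sum.
have tcC : tc_classes H \subset ce_classes H by apply/subsetP => K; rewrite inE => /andP[].
have [R_inj cov Rtc] := reps_spec tcC rR.
have RC rho : rho \in R -> Cset rho = setT by move=> /Rtc; rewrite ce_class_tc => /eqP.
pose w (X : {set edge H}) : int := (X == setT)%:R.
have R_cover s : w (Cset s) != 0 -> exists2 t, t \in R & flip_equiv (@tensions H) (@flows H) t s.
  rewrite /w; have [CT _|_ /eqP//] := eqVneq (Cset s) setT.
  by apply: cov; rewrite ce_class_tc CT.
have := closed_class_sum R_inj R_cover 0 p.
rewrite [X in X = _ -> _](eq_bigr (fun rho => (TF rho).2.[p.+1%:R])) => [->|rho /RC CT];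
  last first.
  rewrite /w CT eqxx mul1r kappab_or_countE (box_tension_totally_cyclic _ CT) mul1n.
  by have [_ ->] := TFP rho p.+1.
rewrite (bigD1 setT) //= {1}/w eqxx mul1r big1 ?addr0 => [|X /negPf X0]; last first.
  by rewrite /w X0 mul0r.
by rewrite taub_contractionT phib_restrictionT hornerC mul1r.
Qed.

Theorem theorem1p2 (G : mgraph) :
  exists (kappa kappab : {mpoly rat[2]})
         (kappa_or kappab_or : orient G -> {mpoly rat[2]})
         (tau phi taub phib : mgraph -> {poly rat}),
  [/\ forall rho, is_kappa_or rho (kappa_or rho),
      forall rho, is_kappab_or rho (kappab_or rho)
    & forall H, [/\ is_tau H (tau H), is_phi H (phi H),
                    is_taub H (taub H) & is_phib H (phib H)]]
  /\
  [/\ [/\ is_kappa G kappa, msize kappa = msize (tutte G),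
          is_kappab G kappab & msize kappab = msize (tutte G)],
      (forall R : {set orient G}, reps (ce_classes G) R ->
         kappa = \sum_(rho in R) kappa_or rho /\
         kappab = \sum_(rho in R) kappab_or rho),
      (forall (R : {set orient G}) (x y : rat), reps (ce_classes G) R ->
         ev kappa (- x) (- y) =
           \sum_(rho in R) (-1) ^+ (rk G + #|Cset rho|) * ev (kappab_or rho) x y
         /\
         ev kappab (- x) (- y) =
           \sum_(rho in R) (-1) ^+ (rk G + #|Cset rho|) * ev (kappa_or rho) x y),
      (forall x y : rat,
         [/\ ev kappa x 1 = (tau G).[x], ev kappa 1 y = (phi G).[y],
             ev kappab x (-1) = (taub G).[x]
           & ev kappab (-1) y = (phib G).[y]])
    & (forall x y : rat,
         ev kappa x y =
           \sum_(X : {set edge G}) (tau (contraction X)).[x] * (phi (restriction X)).[y]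
         /\
         ev kappab x y =
           \sum_(X : {set edge G}) (taub (contraction X)).[x] * (phib (restriction X)).[y])].
Proof.
have /choice[TF TFP] := @kappab_or_poly G.
have /choice[kappa_or kappa_orP] := @kappa_or_poly G.
pose kappab_or rho := prod_poly (TF rho).1 (TF rho).2.
have kappab_orP rho : is_kappab_or rho (kappab_or rho).
  move=> p q; rewrite ev_prod_poly kappab_or_countE natrM.
  by have [-> _] := TFP rho p; have [_ ->] := TFP rho q.
exists (kappa_poly G), (rank_gen G), kappa_or, kappab_or, tau_poly, phi_poly, taub_poly,
  phib_poly.
have kappaE x y : ev (kappa_poly G) x y =
    \sum_(X : {set edge G}) (tau_poly (contraction X)).[x] * (phi_poly (restriction X)).[y].
  by rewrite ev_sum; apply: eq_bigr => X _; rewrite ev_prod_poly.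
have kappabE x y : ev (rank_gen G) x y =
    \sum_(X : {set edge G}) (taub_poly (contraction X)).[x] * (phib_poly (restriction X)).[y].
  by rewrite rank_gen_convolution ev_sum; apply: eq_bigr => X _; rewrite ev_prod_poly.
(* Used below with the constant weight 1 for the decomposition and with a sign for the
   reciprocity. *)
have closed_sumE R (w : {set edge G} -> int) : reps (ce_classes G) R ->
    \sum_(rho in R) (w (Cset rho))%:~R *: kappab_or rho =
    \sum_(X : {set edge G}) (w X)%:~R *: prod_poly (taub_poly (contraction X)) (phib_poly
      (restriction X)).
  move=> /reps_ce[R_inj cov]; apply: ev_ext => p q; rewrite !ev_sum.
  under [RHS]eq_bigr do rewrite evZ ev_prod_poly.
  rewrite -(closed_class_sum R_inj (fun s _ => cov s)).
  by apply: eq_bigr => rho _; rewrite evZ kappab_orP.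
have open_sumE R (w : {set edge G} -> int) : reps (ce_classes G) R ->
    \sum_(rho in R) (w (Cset rho))%:~R *: kappa_or rho =
    \sum_(X : {set edge G}) (w X)%:~R *: prod_poly (tau_poly (contraction X)) (phi_poly
      (restriction X)).
  move=> /reps_ce[R_inj cov]; apply: ev_ext => p q; rewrite !ev_sum.
  under [RHS]eq_bigr do rewrite evZ ev_prod_poly.
  rewrite -(open_class_sum R_inj (fun s _ => cov s)).
  by apply: eq_bigr => rho _; rewrite evZ kappa_orP.
have decomposition R : reps (ce_classes G) R ->
    kappa_poly G = \sum_(rho in R) kappa_or rho /\ rank_gen G = \sum_(rho in R) kappab_or rho.
  move=> rR; split.
    have := open_sumE R (fun=> 1) rR; rewrite (eq_bigr kappa_or) => [->|rho _];
      last by rewrite scale1r.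
    by apply: eq_bigr => X _; rewrite scale1r.
  have := closed_sumE R (fun=> 1) rR; rewrite (eq_bigr kappab_or) => [->|rho _];
    last by rewrite scale1r.
  by rewrite rank_gen_convolution; apply: eq_bigr => X _; rewrite scale1r.
(* The sign produced by changing x, y into -x, -y in the term of [X]; its parity form in terms of
   |X| is what becomes |C_rho| in the class sum. *)
have sign_minors (X : {set edge G}) :
    (-1) ^+ rk (contraction X) * (-1) ^+ nullity (restriction X) = (-1) ^+ (rk G + #|X|) :> rat.
  rewrite -exprD rk_contraction -[nullity _]/(nulS X) nulSE; apply: signr_parity.
  rewrite !oddD (oddB (rkS_le_rk X)) (oddB (rkS_le_card X)).
  by case: (odd (rk G)); case: (odd (rkS X)); case: (odd #|X|).
have signE (n : nat) : (((-1) ^+ n : int)%:~R : rat) = (-1) ^+ n by rewrite rmorphXn /= rmorphN1.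
split; first split=> // H.
  by split; [exact: tau_polyP|exact: phi_polyP|exact: taub_polyP|exact: phib_polyP].
split.
- split; [exact: kappa_polyP|by rewrite msize_kappa msize_tutte| |by rewrite msize_tutte].
  move=> R p q /decomposition[_ ->]; rewrite ev_sum natr_sum.
  by apply: eq_bigr => rho _; rewrite kappab_orP.
- exact: decomposition.
- move=> R x y rR; pose w (X : {set edge G}) : int := (-1) ^+ (rk G + #|X|).
  split.
    rewrite kappaE; have /(congr1 (fun P => ev P x y)) := closed_sumE R w rR.
    rewrite !ev_sum (eq_bigr (fun rho => (-1) ^+ (rk G + #|Cset rho|) * ev (kappab_or rho) x y)).
      move=> ->; apply: eq_bigr => X _; rewrite evZ ev_prod_poly tau_opp phi_opp /w signE.
      by rewrite -sign_minors mulrACA.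
    by move=> rho _; rewrite evZ /w signE.
  rewrite kappabE; have /(congr1 (fun P => ev P x y)) := open_sumE R w rR.
  rewrite !ev_sum (eq_bigr (fun rho => (-1) ^+ (rk G + #|Cset rho|) * ev (kappa_or rho) x y)).
    move=> ->; apply: eq_bigr => X _; rewrite evZ ev_prod_poly taub_opp phib_opp /w signE.
    by rewrite -sign_minors mulrACA.
  by move=> rho _; rewrite evZ /w signE.
- move=> x y; split.
  (* At y = 1, the order of the trivial group, the flow polynomial of G|X is 0 unless [X] is empty;
     dually for tensions of G/X in the next case. *)
  + rewrite kappaE (bigD1 set0) //= tau_contraction0 phi_restriction_at1 eqxx mulr1.
    by rewrite big1 ?addr0 // => X /negPf X0; rewrite phi_restriction_at1 X0 mulr0.
  + rewrite kappaE (bigD1 setT) //= phi_restrictionT tau_contraction_at1 eqxx mul1r.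
    by rewrite big1 ?addr0 // => X /negPf XT; rewrite tau_contraction_at1 XT mul0r.
  + exact: ev_rank_gen_taub.
  + exact: ev_rank_gen_phib.
- by move=> x y; split; [exact: kappaE|exact: kappabE].
Qed.
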